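(* Let $(E,\nu,\Gamma)$ be a full Markov triple with infinitesimal generator $L$ and Dirichlet form $\mathcal{E}$, and let $F\in\operatorname{Dom}(\mathcal{E})$. Assume that (1) there exists some $p>1$ such that $\mathbb{E}[1/\Gamma(F)^p]<\infty$; (2) $\tau$ is the function defined by $\tau(x)=\mathbb{E}[\Gamma(F)\mid F=x]$; (3) the sequences $\{f_k:k\ge0\}$ and $\{h_k:k\ge1\}$ are well-defined in the following iterative way: (a) for all $k\ge0$, $f_k(F)\in\operatorname{Dom}(L)$; (b) there exists a constant $a$ such that $f_0(x)=\int_a^x\frac1{\tau(y)}\,dy$ and, for $k\ge1$, $f_k(x)=\int_a^x\frac{h_k(y)}{\tau(y)}\,dy$, where $h_k(x)=\mathbb{E}[Lf_{k-1}(F)\mid F=x]$; (c) $\mathbb{E}\big[|\Gamma(F)h_k(F)|^{p/(p-1)}\big]<\infty$ for all $k\geq 1$. Then for every integer $k\ge0$, the $k$-th derivative of the density $p_F$ of $F$ exists and has the representation $$p_F^{(k)}(x)=-\mathbb{E}\big[\mathbf 1_{\{x\le F\}}Lf_k(F)\big]=-\mathbb{E}\big[\mathbf 1_{\{x\le F\}}h_{k+1}(F)\big].$$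
   Context: Full Markov triple $(E,\nu,\Gamma)$ (in the sense of Bakry–Gentil–Ledoux), with $\mathbb{E}$ denoting integration against $\nu$: - $(E,\mathcal{F},\nu)$ is a probability space with $L^2(E,\mathcal{F},\nu)$ separable. $\mathcal{A}$ is a vector space of real random variables on it, stable under products and under the action of smooth functions $\Psi:\mathbb{R}^k\to\mathbb{R}$. $\mathcal{A}_0\subseteq\mathcal{A}$ is a subalgebra of bounded functions, dense in $L^p(E,\nu)$ for all $p\in[1,\infty)$, stable under smooth functions, and an ideal in $\mathcal{A}$. - The carré du champ $\Gamma:\mathcal{A}_0\times\mathcal{A}_0\to\mathcal{A}_0$ is bilinear, symmetric, with $\Gamma(F):=\Gamma(F,F)\ge0$; for every $F\in\mathcal{A}_0$ there is a finite $c_F$ with $|\mathbb{E}[\Gamma(F,G)]|\le c_F\|G\|_2$ for all $G\in\mathcal{A}_0$. The Dirichlet form is $\mathcal{E}(F,G)=\mathbb{E}[\Gamma(F,G)]$; $\operatorname{Dom}(\mathcal{E})\subseteq L^2(\nu)$ is the completion of $\mathcal{A}_0$ under $(\|F\|_2^2+\mathcal{E}(F,F))^{1/2}$, and $\mathcal{E},\Gamma$ extend to $\operatorname{Dom}(\mathcal{E})\times\operatorname{Dom}(\mathcal{E})$ by continuity and polarization, with $\Gamma$ valued in $L^1(\nu)$. - $L$ is a self-adjoint linear operator defined on $\mathcal{A}_0$ by $\mathbb{E}[G\,LF]=\mathbb{E}[F\,LG]=-\mathbb{E}[\Gamma(F,G)]$, with $L(\mathcal{A}_0)\subseteq\mathcal{A}_0$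 and $\mathbb{E}[LF]=0$. $\operatorname{Dom}(L)$ consists of all $F\in\operatorname{Dom}(\mathcal{E})$ with $|\mathcal{E}(F,G)|\le c_F\|G\|_2$ for all $G\in\operatorname{Dom}(\mathcal{E})$ and some finite $c_F$; $L$ extends to $\operatorname{Dom}(L)$ by integration by parts. $L1=0$, and $L$ is ergodic: $LF=0$ with $F\in\operatorname{Dom}(L)$ implies $F$ constant. - $L:\mathcal{A}\to\mathcal{A}$ extends $L:\mathcal{A}_0\to\mathcal{A}_0$, and on $\mathcal{A}\times\mathcal{A}$, $\Gamma(F,G)=\frac12(L(FG)-F\,LG-G\,LF)$. For $F\in\mathcal{A}$, $\Gamma(F)\ge0$ with equality iff $F$ is constant. - Diffusion property: for $C^\infty$ functions $\Psi:\mathbb{R}^m\to\mathbb{R}$ and $F_1,\dots,F_m,G\in\mathcal{A}$, $\Gamma(\Psi(F_1,\dots,F_m),G)=\sum_j\partial_j\Psi(F_1,\dots,F_m)\Gamma(F_j,G)$ and $L\Psi(F_1,\dots,F_m)=\sum_i\partial_i\Psi(F_1,\dots,F_m)LF_i+\sum_{i,j}\partial_{ij}\Psi(F_1,\dots,F_m)\Gamma(F_i,F_j)$. - The integration by parts formula also holds if $F\in\mathcal{A}$, $G\in\mathcal{A}_0$ (or vice versa). $Lf_k(F)$ means $L$ applied to the random variable $f_k(F)$. *)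

(* Defs.v *)
From HB Require Import structures.
From mathcomp Require Import all_boot all_order all_algebra.
From mathcomp Require Import all_classical all_reals all_analysis.

Set Implicit Arguments.
Unset Strict Implicit.
Unset Printing Implicit Defensive.

Import Order.TTheory GRing.Theory Num.Theory.
Import numFieldNormedType.Exports.

Local Open Scope classical_set_scope.
Local Open Scope ring_scope.

Definition partial_derivative (R : realType) (m : nat) (j : 'I_m)
    (Psi : 'rV[R]_m -> R) : 'rV[R]_m -> R :=
  fun x => 'D_(delta_mx ord0 j) Psi x.

(* C^oo on R^m: all iterated partial derivatives exist and are continuous. *)
Definition smooth (R : realType) (m : nat) (Psi : 'rV[R]_m -> R) : Prop :=
  forall s : seq 'I_m,
    let g := foldr (@partial_derivative R m) Psi s in
    continuous g /\ forall j x, derivable g x (delta_mx ord0 j).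

Definition eval_at (T : Type) (R : realType) (m : nat) (Psi : 'rV[R]_m -> R)
    (F : 'I_m -> T -> R) : T -> R :=
  fun t => Psi (\row_(i < m) F i t).

(* Random variables are represented by functions and identified only up to
   almost sure equality: every identity between random variables below is an
   almost sure one. [cdc] and [gen] are meaningful only on their respective
   domains ([alg] and Dom(E) for [cdc], [alg] and Dom(L) for [gen]). *)
Record markov_data d (T : measurableType d) (R : realType) := MarkovData {
  alg : set (T -> R) ;
  alg0 : set (T -> R) ;
  cdc : (T -> R) -> (T -> R) -> (T -> R) ;
  gen : (T -> R) -> (T -> R) }.

Section markov_triple.
Context d (T : measurableType d) (R : realType).
Variables (P : probability T R) (M : markov_data T R).

Local Notation A := (alg M).
Local Notation A0 := (alg0 M).
Local Notation Gamma := (cdc M).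
Local Notation L := (gen M).

Definition norm (p : R) (F : T -> R) : \bar R := 'N[P]_(p%:E)[EFin \o F]%E.
Arguments norm p%_R F%_R.

Definition energy (F G : T -> R) : R := \int[P]_t (Gamma F G t).

Definition form_approx (F : T -> R) (u : nat -> T -> R) : Prop :=
  [/\ (forall n, A0 (u n)),
      norm 2 (F \- u n) @[n --> \oo] --> 0%E &
      forall e : R, 0 < e -> exists N, forall m n, (N <= m)%N -> (N <= n)%N ->
        energy (u m \- u n) (u m \- u n) < e].

(* The completion of A0 for the form norm, realized inside L^2: limits in L^2
   of sequences of A0 that are Cauchy for the form norm. *)
Definition DomE (F : T -> R) : Prop :=
  F \in Lfun P 2%:E /\ exists u, form_approx F u.

Definition DomL (F : T -> R) : Prop :=
  DomE F /\ exists c : R, forall G, DomE G ->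
    (`|energy F G|%:E <= c%:E * norm 2 G)%E.

Record full_markov_triple : Prop := FullMarkovTriple {
  L2_separable : exists D : nat -> T -> R,
    (forall n, D n \in Lfun P 2%:E) /\
    forall F, F \in Lfun P 2%:E -> forall e : R, 0 < e ->
      exists n, (norm 2 (F \- D n) < e%:E)%E ;

  alg_measurable : forall F, A F -> measurable_fun setT F ;
  alg_0 : A (cst 0) ;
  alg_lin : forall (a : R) F G, A F -> A G -> A (fun t => a * F t + G t) ;
  alg_mul : forall F G, A F -> A G -> A (F \* G) ;
  alg_smooth : forall m (Psi : 'rV[R]_m -> R) F, smooth Psi ->
    (forall i, A (F i)) -> A (eval_at Psi F) ;

  alg0_sub : A0 `<=` A ;
  alg0_bounded : forall F, A0 F ->
    exists C : R, \forall t \ae P, `|F t| <= C ;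
  alg0_0 : A0 (cst 0) ;
  alg0_lin : forall (a : R) F G, A0 F -> A0 G ->
    A0 (fun t => a * F t + G t) ;
  alg0_mul : forall F G, A0 F -> A0 G -> A0 (F \* G) ;
  (* [Psi 0 = 0] is Bakry, Gentil and Ledoux's convention: without it A0 would
     contain the constants and, being an ideal, would be all of A. *)
  alg0_smooth : forall m (Psi : 'rV[R]_m -> R) F, smooth Psi -> Psi 0 = 0 ->
    (forall i, A0 (F i)) -> A0 (eval_at Psi F) ;
  alg0_ideal : forall F G, A F -> A0 G -> A0 (F \* G) ;
  alg0_dense : forall p : R, 1 <= p -> forall F, F \in Lfun P p%:E ->
    forall e : R, 0 < e -> exists2 G, A0 G & (norm p (F \- G) < e%:E)%E ;

  cdc_alg0 : forall F G, A0 F -> A0 G -> A0 (Gamma F G) ;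
  cdc_lin : forall (a : R) F G H, A0 F -> A0 G -> A0 H ->
    \forall t \ae P,
      Gamma (fun s => a * F s + G s) H t = a * Gamma F H t + Gamma G H t ;
  cdc_sym : forall F G, A0 F -> A0 G ->
    \forall t \ae P, Gamma F G t = Gamma G F t ;
  energy_bound : forall F, A0 F -> exists c : R, forall G, A0 G ->
    (`|energy F G|%:E <= c%:E * norm 2 G)%E ;

  (* Extension of Gamma to Dom(E) by continuity, with values in L^1. *)
  cdc_L1 : forall F G, DomE F -> DomE G -> Gamma F G \in Lfun P 1%:E ;
  cdc_cont : forall F G u v, DomE F -> DomE G ->
    form_approx F u -> form_approx G v ->
    norm 1 (Gamma F G \- Gamma (u n) (v n)) @[n --> \oo] --> 0%E ;

  gen_alg : forall F, A F -> A (L F) ;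
  gen_alg0 : forall F, A0 F -> A0 (L F) ;
  gen_lin : forall (a : R) F G, A F -> A G ->
    \forall t \ae P, L (fun s => a * F s + G s) t = a * L F t + L G t ;
  gen_mean0 : forall F, A0 F -> \int[P]_t L F t = 0 ;
  gen_ibp : forall F G, A F -> A0 G ->
    \int[P]_t (F t * L G t) = - energy F G /\
    \int[P]_t (G t * L F t) = - energy F G ;

  gen_DomL_L2 : forall F, DomL F -> L F \in Lfun P 2%:E ;
  gen_DomL_ibp : forall F G, DomL F -> DomE G ->
    \int[P]_t (G t * L F t) = - energy F G ;
  DomL_1 : DomL (cst 1) ;
  gen_1 : \forall t \ae P, L (cst 1) t = 0 ;
  gen_ergodic : forall F, DomL F -> (\forall t \ae P, L F t = 0) ->
    exists c : R, \forall t \ae P, F t = c ;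

  cdc_gen : forall F G, A F -> A G -> \forall t \ae P,
    Gamma F G t = 2^-1 * (L (F \* G) t - F t * L G t - G t * L F t) ;
  cdc_ge0 : forall F, A F -> \forall t \ae P, 0 <= Gamma F F t ;
  cdc_eq0 : forall F, A F ->
    (\forall t \ae P, Gamma F F t = 0) <->
    (exists c : R, \forall t \ae P, F t = c) ;

  cdc_diffusion : forall m (Psi : 'rV[R]_m -> R) F G, smooth Psi ->
    (forall i, A (F i)) -> A G -> \forall t \ae P,
    Gamma (eval_at Psi F) G t =
      \sum_(j < m) eval_at (partial_derivative j Psi) F t * Gamma (F j) G t ;
  gen_diffusion : forall m (Psi : 'rV[R]_m -> R) F, smooth Psi ->
    (forall i, A (F i)) -> \forall t \ae P,
    L (eval_at Psi F) t =
      \sum_(i < m) eval_at (partial_derivative i Psi) F t * L (F i) t +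
      \sum_(i < m) \sum_(j < m)
        eval_at (partial_derivative i (partial_derivative j Psi)) F t *
        Gamma (F i) (F j) t }.

(* [g] is a version of x |-> E[Y | X = x]. *)
Definition is_condexp (X Y : T -> R) (g : R -> R) : Prop :=
  [/\ measurable_fun setT g,
      P.-integrable setT (EFin \o (g \o X)) &
      forall B : set R, measurable B ->
        (\int[P]_(t in X @^-1` B) (Y t)%:E =
         \int[P]_(t in X @^-1` B) (g (X t))%:E)%E].

Definition oriented_integral (g : R -> R) (a x : R) : R :=
  if a <= x then \int[lebesgue_measure]_(y in `[a, x]) g y
  else - \int[lebesgue_measure]_(y in `[x, a]) g y.

(* f(x) is the absolutely convergent integral of [g] from [a] to [x], for almost
   every [x] with respect to the law of [X]. Conditional expectations given
   X = x, hence the integrands, carry no information off the range of [X]. *)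
Definition is_primitive (X : T -> R) (a : R) (g f : R -> R) : Prop :=
  \forall t \ae P,
    lebesgue_measure.-integrable `[Num.min a (X t), Num.max a (X t)]
      (EFin \o g) /\
    f (X t) = oriented_integral g a (X t).

Definition is_density (X : T -> R) (q : R -> R) : Prop :=
  [/\ measurable_fun setT q, (forall x, 0 <= q x) &
      forall B : set R, measurable B ->
        P (X @^-1` B) = (\int[lebesgue_measure]_(x in B) (q x)%:E)%E].

End markov_triple.

Definition n_derivable (R : realType) (k : nat) (q : R -> R) : Prop :=
  forall j, (j < k)%N -> forall x, derivable (derive1n j q) x 1.

(* Main.v *)
Require Import Defs.
From HB Require Import structures.
From mathcomp Require Import all_boot all_order all_algebra.
From mathcomp Require Import all_classical all_reals all_analysis.
From mathcomp Require Import measurable_realfun.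
From mathcomp Require Import ring lra.

Import Order.TTheory GRing.Theory Num.Theory.
Import numFieldNormedType.Exports.

Local Open Scope classical_set_scope.
Local Open Scope ring_scope.

Set Implicit Arguments.
Unset Strict Implicit.
Unset Printing Implicit Defensive.

(** Put q_k(x) = - E[1_{x <= F} L f_k(F)]. The theorem says that q_0 is a density
    of F and that q_k' = q_(k+1); both come from integration by parts against
    functions of F. Let b be bounded and Borel, with primitive B. By the chain rule,
<<
      E[B(F) L f_k(F)] = - E[Gamma(B(F), f_k(F))] = - E[b(F) Gamma(F, f_k(F))],
>>
    and, if f_k(F) obeys the chain rule too, Gamma(F, f_k(F)) is (h_k / tau)(F) Gamma(F)
    (with h_0 = 1), whose conditional expectation given F is h_k(F). For b the
    indicator of [x, y[ the right-hand side is thus - P(x <= F < y) if k = 0, and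
<<
      - E[1_{x <= F < y} h_k(F)] = - E[1_{x <= F < y} L f_(k-1)(F)]
                                 = q_(k-1)(x) - q_(k-1)(y)
>>
    if k >= 1. Here B is the ramp that rises from 0 to y - x between x and y, so that
    B(F) / (y - x) tends to 1_{x <= F} when y - x tends to 0 (F has no atom). Hence q_0
    is the derivative of P(F < x) and q_(k-1)' = q_k; see [distribution_derivative],
    [survival_step] and [law_density].

    The work lies in the chain rule, since Gamma reaches Dom(E) by approximation from
    A0 and the diffusion property concerns smooth functions only.

    - For bounded Borel slopes, [chain_rule_bounded]: the softplus functions are
      smooth and their slopes, the logistic functions, converge to indicators of rays;
      the monotone class theorem does the rest.
    - For the slope 1 / tau of f_0, [cdc_G0]: the energy E[Gamma(F) / tau(F)^2]
      = E[1 / tau(F)] is at most E[1 / Gamma(F)], which is finite. The truncated slopes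
      give a sequence that is Cauchy in energy and converges almost surely, and
      [energy_cvg0_ae] identifies its limit.
    - The slope h_k / tau of f_k, for k >= 1, may have infinite energy; it is only
      integrable between a and F. What the argument above uses is merely
      E[v(F) Gamma(F, f_k(F))] = E[v(F) h_k(F)], and this is [cdc_iterate]. Its proof
      pairs L f_0(F) with ramp(f_k(F) - A_n(F)) psi(F), where A_n is the primitive of the
      truncated slope: this product is bounded and tends to 0, whereas the gradient of
      the ramp keeps Gamma(F, f_k(F)) - (h_k / tau)(F) Gamma(F) alive in the limit. *)

(** * Real sequences *)

Section real_sequences.
Context (R : realType).
Implicit Types u v : nat -> R.

Lemma cvg_eq u v (l : R) : u =1 v -> u @ \oo --> l -> v @ \oo --> l.
Proof. by move=> /funext ->. Qed.

Lemma cvg0P u : (forall e, 0 < e -> exists N, forall n, (N <= n)%N -> `|u n| <= e) ->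
  u @ \oo --> (0 : R).
Proof.
move=> H; apply/cvgr0Pnorm_le => e e0; have [N HN] := H e e0.
by exists N.
Qed.

Lemma cvg0_ex u e : u @ \oo --> (0 : R) -> 0 < e ->
  exists N, forall n, (N <= n)%N -> `|u n| <= e.
Proof. by move=> /cvgr0Pnorm_le + e0 => /(_ e e0) [N _ HN]; exists N. Qed.

Lemma cvg0_le u v : (forall n, `|u n| <= v n) -> v @ \oo --> (0 : R) -> u @ \oo --> (0 : R).
Proof.
move=> uv v0; apply: cvg0P => e e0; have [N HN] := cvg0_ex v0 e0.
exists N => n Nn; apply: (le_trans (uv n)); apply: (le_trans (ler_norm _)).
exact: HN.
Qed.

Lemma cvg0D u v : u @ \oo --> (0 : R) -> v @ \oo --> (0 : R) ->
  u n + v n @[n --> \oo] --> (0 : R).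
Proof. by move=> u0 v0; rewrite -[X in _ --> X](addr0 (0 : R)); exact: cvgD. Qed.

Lemma cvg0Z c u : u @ \oo --> (0 : R) -> c * u n @[n --> \oo] --> (0 : R).
Proof.
move=> u0; rewrite -[X in _ --> X](mulr0 c).
by apply: cvgM => //; exact: cvg_cst.
Qed.

Lemma cvg0_sqr u : u @ \oo --> (0 : R) -> u n ^+ 2 @[n --> \oo] --> (0 : R).
Proof.
move=> u0; rewrite -[X in _ --> X](mulr0 (0 : R)).
by under eq_fun do rewrite expr2; exact: cvgM.
Qed.

Lemma cvg0_subl u (l : R) : u @ \oo --> l -> l - u n @[n --> \oo] --> (0 : R).
Proof. by move=> ul; rewrite -[X in _ --> X](subrr l); apply: cvgB => //; exact: cvg_cst. Qed.

Lemma cvg0_subr u (l : R) : u @ \oo --> l -> u n - l @[n --> \oo] --> (0 : R).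
Proof. by move=> ul; rewrite -[X in _ --> X](subrr l); apply: cvgB => //; exact: cvg_cst. Qed.

Lemma cvg0Mr u (l : R) : u @ \oo --> (0 : R) -> u n * l @[n --> \oo] --> (0 : R).
Proof. by move=> u0; rewrite -[X in _ --> X](mul0r l); apply: cvgM => //; exact: cvg_cst. Qed.

Lemma cvg_minr u (l c : R) : u @ \oo --> l -> Num.min (u n) c @[n --> \oo] --> Num.min l c.
Proof.
move=> ul; apply/subr_cvg0; have /cvg_norm := cvg0_subr ul; rewrite normr0.
apply: cvg0_le => n; rewrite ler_norml.
have := ler_norm (u n - l); have := ler_norm (l - u n); rewrite (distrC l).
by case: (leP (u n) c) => ?; case: (leP l c) => ? h1 h2; apply/andP; split; lra.
Qed.

(** The inequality [c <= (k a + b / k) / 2], available for every [k], replaces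
    [c <= sqrt (a b)] in all the Cauchy-Schwarz arguments below. *)
Lemma young_cvg0 (c a : nat -> R) (b : R) : a @ \oo --> (0 : R) -> 0 <= b ->
  (forall n, 0 <= a n) ->
  (forall n (k : R), 0 < k -> `|c n| <= 2^-1 * (k * a n + k^-1 * b)) ->
  c @ \oo --> (0 : R).
Proof.
move=> a0 b0 an0 H; apply: cvg0P => e e0.
pose k := (b + 1) / e; have k0 : 0 < k by rewrite divr_gt0// ltr_wpDl.
have [N HN] := cvg0_ex a0 (divr_gt0 e0 k0); exists N => n /HN.
rewrite ger0_norm// ler_pdivlMr// => h; apply: (le_trans (H n k k0)).
have : k^-1 * b <= e.
  by rewrite /k invf_div mulrAC ler_pdivrMr ?ltr_wpDl// ler_pM2l// lerDl.
by move: h; rewrite (mulrC (a n)); lra.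
Qed.

End real_sequences.

(** * Integrability, expectation and L2 *)

Section expectation.
Context d (T : measurableType d) (R : realType) (P : probability T R).
Implicit Types X Y Z : T -> R.

Definition Int X : Prop := P.-integrable setT (EFin \o X).
Definition Ex X : R := \int[P]_t X t.

Lemma Int_meas X : Int X -> measurable_fun setT X.
Proof. by move=> /integrableP[mX _]; apply/measurable_EFinP. Qed.

Lemma Int_cst c : Int (fun=> c).
Proof. exact: finite_measure_integrable_cst. Qed.

Lemma IntD X Y : Int X -> Int Y -> Int (fun t => X t + Y t).
Proof. exact: integrableD. Qed.

Lemma IntB X Y : Int X -> Int Y -> Int (fun t => X t - Y t).
Proof. exact: integrableB. Qed.

Lemma IntZ c X : Int X -> Int (fun t => c * X t).
Proof. exact: integrableZl. Qed.

Lemma Int_abs X : Int X -> Int (fun t => `|X t|).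
Proof. exact: integrable_norm. Qed.

Lemma Int_dist X Y : Int X -> Int Y -> Int (fun t => `|X t - Y t|).
Proof. by move=> iX iY; apply: Int_abs; exact: IntB. Qed.

Lemma ExD X Y : Int X -> Int Y -> Ex (fun t => X t + Y t) = Ex X + Ex Y.
Proof. exact: RintegralD. Qed.

Lemma ExB X Y : Int X -> Int Y -> Ex (fun t => X t - Y t) = Ex X - Ex Y.
Proof. exact: RintegralB. Qed.

Lemma ExZ c X : Int X -> Ex (fun t => c * X t) = c * Ex X.
Proof. exact: RintegralZl. Qed.

Lemma Ex_cst c : Ex (fun=> c) = c.
Proof. by rewrite /Ex Rintegral_cst//= (@probability_setT _ _ _ P) mulr1. Qed.

Lemma Ex_ereal X : Int X -> (\int[P]_t (X t)%:E)%E = (Ex X)%:E.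
Proof. by move=> iX; rewrite fineK//; exact: integrable_fin_num. Qed.

Lemma Ex_ae_eq X Y : measurable_fun setT X -> measurable_fun setT Y ->
  (\forall t \ae P, X t = Y t) -> Ex X = Ex Y.
Proof.
move=> mX mY XY; rewrite /Ex /Rintegral; congr fine.
apply: ae_eq_integral => //; [exact/measurable_EFinP..|].
by apply: filterS XY => t + _ /=; move=> ->.
Qed.

Lemma Int_le X Y : measurable_fun setT X ->
  (\forall t \ae P, `|X t| <= Y t) -> Int Y -> Int X.
Proof.
move=> mX XY iY; have mY := Int_meas iY.
apply/integrableP; split; first exact/measurable_EFinP.
move/integrableP : iY => [_]; apply: le_lt_trans.
apply: ae_ge0_le_integral => //.
- by apply/measurable_EFinP; exact: measurableT_comp.
- by apply/measurable_EFinP; exact: measurableT_comp.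
- by apply: filterS XY => t + _; rewrite lee_fin => /le_trans; apply; exact: ler_norm.
Qed.

Lemma Int_ae_eq X Y : Int X -> measurable_fun setT Y ->
  (\forall t \ae P, X t = Y t) -> Int Y.
Proof.
move=> iX mY XY; apply: (Int_le mY _ (Int_abs iX)).
by apply: filterS XY => t ->.
Qed.

Lemma Ex_le X Y : Int X -> Int Y -> (\forall t \ae P, X t <= Y t) -> Ex X <= Ex Y.
Proof.
move=> iX iY XY; rewrite -subr_ge0 -ExB//.
have mXY : measurable_fun setT (fun t => Y t - X t) by apply: Int_meas; exact: IntB.
rewrite (@Ex_ae_eq _ (fun t => `|Y t - X t|))//.
- by apply: Rintegral_ge0.
- exact: measurableT_comp.
- by apply: filterS XY => t tXY; rewrite ger0_norm// subr_ge0.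
Qed.

Lemma Ex_ge0 X : Int X -> (\forall t \ae P, 0 <= X t) -> 0 <= Ex X.
Proof. by move=> iX X0; rewrite -(Ex_cst 0); apply: Ex_le => //; exact: Int_cst. Qed.

Lemma Ex_absle X : Int X -> `|Ex X| <= Ex (fun t => `|X t|).
Proof. exact: le_normr_Rintegral. Qed.

Lemma Int_bdd X C : measurable_fun setT X -> (\forall t \ae P, `|X t| <= C) -> Int X.
Proof. by move=> mX XC; apply: (Int_le mX XC); exact: Int_cst. Qed.

Lemma IntM_bdd (b : T -> R) X C : measurable_fun setT b ->
  (\forall t \ae P, `|b t| <= C) -> Int X -> Int (fun t => b t * X t).
Proof.
move=> mb bC iX; apply: (@Int_le _ (fun t => C * `|X t|)).
- by apply: measurable_funM => //; exact: Int_meas.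
- by apply: filterS bC => t tC; rewrite normrM ler_wpM2r.
- by apply: IntZ; exact: Int_abs.
Qed.

Lemma Ex_eq0 X : Int X -> (\forall t \ae P, 0 <= X t) -> Ex X = 0 ->
  \forall t \ae P, X t = 0.
Proof.
move=> iX X0 EX0; have mX := Int_meas iX.
have : (\int[P]_t `|(X t)%:E| = 0)%E.
  transitivity (Ex X)%:E; last by rewrite EX0.
  rewrite -(Ex_ereal iX); apply: ae_eq_integral => //.
  - by apply/measurable_EFinP; exact: measurableT_comp.
  - exact/measurable_EFinP.
  - by apply: filterS X0 => t X0 _ /=; rewrite ger0_norm.
have mX' : measurable_fun setT (EFin \o X) by exact/measurable_EFinP.
move/(ae_eq_integral_abs P measurableT mX').
by apply: filterS => t /(_ I) [].
Qed.

Lemma Ex_dct (X : nat -> T -> R) Z Y : (forall n, measurable_fun setT (X n)) ->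
  measurable_fun setT Z ->
  (\forall t \ae P, X ^~ t @ \oo --> Z t) -> Int Y ->
  (forall n, \forall t \ae P, `|X n t| <= Y t) ->
  [/\ Int Z, (forall n, Int (X n)),
   Ex (fun t => `|X n t - Z t|) @[n --> \oo] --> 0 &
   Ex (X n) @[n --> \oo] --> Ex Z].
Proof.
move=> mX mZ XZ iY XY.
have iX n : Int (X n) by exact: (Int_le _ (XY n) iY).
have [] := @dominated_convergence _ _ _ P _ measurableT (fun n => EFin \o X n)
   (EFin \o Z) (EFin \o Y).
- by move=> n; exact/measurable_EFinP.
- exact/measurable_EFinP.
- by apply: filterS XZ => t Xt _; apply: cvg_EFin => //; exact: nearW.
- exact: iY.
- have /ae_foralln : forall n, \forall t \ae P, (`|X n t| <= Y t) by [].
  by apply: filterS => t Xt n _ /=; rewrite lee_fin.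
- move=> iZ cv0 cvZ; split => //.
  + by have /fine_cvgP[_] := cv0.
  + have {}cvZ : (\int[P]_x (EFin \o X n) x)%E @[n --> \oo] --> (Ex Z)%:E.
      by rewrite -Ex_ereal.
    by have /fine_cvgP[_] := cvZ.
Qed.

(** Square integrability, as the real-valued condition that is convenient for
    estimates. *)
Definition L2 X : Prop := measurable_fun setT X /\ Int (fun t => X t ^+ 2).

Lemma LfunL2 X : X \in Lfun P 2%:E <-> L2 X.
Proof.
split=> [lX|[mX iX]].
  split; last exact: Lfun2_integrable_sqr.
  by move: lX; rewrite inE => /andP[]; rewrite inE.
rewrite inE; apply/andP; split; rewrite inE//= /finite_norm.
rewrite unlock /=; apply: poweR_lty.
move/integrableP: iX => [_]; apply: le_lt_trans.
rewrite le_eqVlt; apply/orP; left; apply/eqP; apply: eq_integral => t _ /=.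
by rewrite powR_mulrn// -normrX.
Qed.

Lemma L2M X Y : L2 X -> L2 Y -> Int (fun t => X t * Y t).
Proof.
move=> /LfunL2 lX /LfunL2 lY.
by apply/Lfun1_integrable; exact: Lfun2_mul_Lfun1.
Qed.

Lemma L2_lin a X Y : L2 X -> L2 Y -> L2 (fun t => a * X t + Y t).
Proof.
move=> lX lY; have [mX iX] := lX; have [mY iY] := lY; split.
  by apply: measurable_funD => //; exact: measurable_funM.
rewrite [X in Int X](_ : _ = fun t => a ^+ 2 * X t ^+ 2 + (Y t ^+ 2 + (2 * a) * (X t * Y t))).
  by apply: IntD; [exact: IntZ|apply: IntD => //; apply: IntZ; exact: L2M].
by apply/funext => t; ring.
Qed.

Lemma L2D X Y : L2 X -> L2 Y -> L2 (fun t => X t + Y t).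
Proof. by move=> lX /(L2_lin 1 lX); under eq_fun do rewrite mul1r. Qed.

Lemma L2Z c X : L2 X -> L2 (fun t => c * X t).
Proof.
move=> lX; have := L2_lin (c - 1) lX lX.
by under eq_fun do rewrite mulrBl mul1r subrK.
Qed.

Lemma L2B X Y : L2 X -> L2 Y -> L2 (fun t => X t - Y t).
Proof. by move=> lX /(L2Z (-1)) /(L2D lX); under eq_fun do rewrite mulN1r. Qed.

(** Cauchy-Schwarz, linearized: optimizing [k] would bring square roots in. *)
Lemma L2M_young X Y (k : R) : 0 < k -> L2 X -> L2 Y ->
  `|Ex (fun t => X t * Y t)| <=
  2^-1 * (k * Ex (fun t => X t ^+ 2) + k^-1 * Ex (fun t => Y t ^+ 2)).
Proof.
move=> k0 lX lY; have iXY := L2M lX lY; have [_ iX] := lX; have [_ iY] := lY.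
apply: (le_trans (Ex_absle iXY)).
rewrite -!ExZ// -ExD; [|exact: IntZ..].
rewrite -ExZ; last by apply: IntD; exact: IntZ.
apply: Ex_le; [exact: Int_abs|by apply: IntZ; apply: IntD; exact: IntZ|].
apply: nearW => t; have k1 : k * k^-1 = 1 by rewrite divff// gt_eqF.
have h (s : R) : s ^+ 2 = 1 ->
    0 <= k^-1 * (k * X t + s * Y t) ^+ 2 -> - s * (X t * Y t) <=
    2^-1 * (k * X t ^+ 2 + k^-1 * Y t ^+ 2).
  move=> s2; rewrite (_ : k^-1 * _ = (k * k^-1) * (k * X t ^+ 2 + 2 * s * (X t * Y t))
    + s ^+ 2 * (k^-1 * Y t ^+ 2)); last by ring.
  by rewrite k1 s2; lra.
have nn s : 0 <= k^-1 * (k * X t + s * Y t) ^+ 2.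
  by rewrite mulr_ge0 ?sqr_ge0// invr_ge0 ltW.
rewrite ler_norml; apply/andP; split.
  by have := h 1 (expr1n _ _) (nn 1); lra.
by have := h (-1) _ (nn _); rewrite sqrrN expr1n => /(_ erefl); lra.
Qed.

Lemma L2M_cvg (X : nat -> T -> R) Z Y : L2 Z -> (forall n, L2 (X n)) -> L2 Y ->
  Ex (fun t => (Z t - X n t) ^+ 2) @[n --> \oo] --> (0 : R) ->
  Ex (fun t => X n t * Y t) @[n --> \oo] --> Ex (fun t => Z t * Y t).
Proof.
move=> lZ lX lY c0; apply/subr_cvg0.
apply: (young_cvg0 c0 (_ : 0 <= Ex (fun t => Y t ^+ 2))) => [|n|n k k0].
- by apply: Rintegral_ge0 => t _; exact: sqr_ge0.
- by apply: Rintegral_ge0 => t _; exact: sqr_ge0.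
- rewrite distrC -ExB; [|exact: L2M..].
  rewrite (_ : (fun t => _) = fun t => (Z t - X n t) * Y t).
    by apply: L2M_young => //; exact: L2B.
  by apply/funext => t; rewrite mulrBl.
Qed.

Lemma L2_bdd X C : measurable_fun setT X -> (\forall t \ae P, `|X t| <= C) -> L2 X.
Proof.
move=> mX XC; split => //; apply: (@Int_bdd _ (C ^+ 2)).
  exact: measurable_funX.
by apply: filterS XC => t tC; rewrite normrX lerXn2r// nnegrE (le_trans _ tC).
Qed.

Lemma L2_cst c : L2 (fun=> c).
Proof. by apply: (@L2_bdd _ `|c|) => //; exact: nearW. Qed.

Lemma L2_Int X : L2 X -> Int X.
Proof.
move=> lX; have := L2M lX (L2_cst 1).
by under eq_fun do rewrite mulr1.
Qed.

Lemma L2_le X Y : measurable_fun setT X -> (\forall t \ae P, `|X t| <= `|Y t|) ->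
  L2 Y -> L2 X.
Proof.
move=> mX XY [mY iY]; split => //; apply: (Int_le _ _ iY).
  exact: measurable_funX.
apply: filterS XY => t tXY.
by rewrite normrX -[leRHS]real_normK ?num_real// lerXn2r.
Qed.

Lemma norm2E X : L2 X -> norm P 2 X = (Num.sqrt (Ex (fun t => X t ^+ 2)))%:E.
Proof.
move=> [mX iX]; rewrite /norm unlock/=.
under eq_integral => t _ do rewrite /= powR_mulrn// -normrX ger0_norm ?sqr_ge0//.
by rewrite Ex_ereal//= powR12_sqrt// Rintegral_ge0// => t _; exact: sqr_ge0.
Qed.

Lemma norm1E X : Int X -> norm P 1 X = (Ex (fun t => `|X t|))%:E.
Proof. by move=> iX; rewrite /norm Lnorm1 -Ex_ereal//; exact: Int_abs. Qed.

Lemma norm2_cvg (X : nat -> T -> R) : (forall n, L2 (X n)) ->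
  norm P 2 (X n) @[n --> \oo] --> 0%E <->
  Ex (fun t => X n t ^+ 2) @[n --> \oo] --> 0.
Proof.
move=> lX.
have X0 n : 0 <= Ex (fun t => X n t ^+ 2) by apply: Rintegral_ge0 => t _; exact: sqr_ge0.
have -> : (fun n => norm P 2 (X n)) =
    (fun n => (Num.sqrt (Ex (fun t => X n t ^+ 2)))%:E).
  by apply/funext => n; rewrite norm2E.
split=> [/fine_cvgP[_ /=]|] cv0.
  rewrite -[X in _ --> X](mulr0 (0 : R)).
  by apply: (cvg_eq _ (cvgM cv0 cv0)) => n /=; rewrite -expr2 sqr_sqrtr.
apply: cvg_EFin; first exact: nearW.
rewrite -[X in _ --> X](sqrtr0 R).
exact: (continuous_cvg _ (@sqrt_continuous R 0) cv0).
Qed.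

Lemma norm1_cvg (X : nat -> T -> R) : (forall n, Int (X n)) ->
  norm P 1 (X n) @[n --> \oo] --> 0%E ->
  Ex (fun t => `|X n t|) @[n --> \oo] --> 0.
Proof.
move=> iX; rewrite (_ : (fun n => norm P 1 (X n)) =
    (fun n => (Ex (fun t => `|X n t|))%:E)) => [/fine_cvgP[_]//|].
by apply/funext => n; rewrite norm1E.
Qed.

End expectation.

(** * Small weights *)

Section small_weights.
Context d (T : measurableType d) (R : realType) (P : probability T R).
Implicit Types X Y Z : T -> R.
Local Notation Int := (@Int _ _ _ P).
Local Notation Ex := (@Ex _ _ _ P).
Local Notation L2 := (@L2 _ _ _ P).
(** [k |X| <= 1 + (k X) ^ 2]. *)
Lemma L1_of_L2 (X : nat -> T -> R) : (forall n, L2 (X n)) ->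
  Ex (fun t => X n t ^+ 2) @[n --> \oo] --> (0 : R) ->
  Ex (fun t => `|X n t|) @[n --> \oo] --> (0 : R).
Proof.
move=> lX c0; apply: (@young_cvg0 _ _ _ 1 c0) => // [n|n k k0].
  by apply: Rintegral_ge0 => t _; exact: sqr_ge0.
rewrite ger0_norm; last exact: Rintegral_ge0.
have [_ iX] := lX n; rewrite mulr1 -(Ex_cst P k^-1) -ExZ//.
rewrite -ExD; [|exact: IntZ|exact: Int_cst].
rewrite -ExZ; last by apply: IntD; [exact: IntZ|exact: Int_cst].
apply: Ex_le; first by apply: Int_abs; exact: L2_Int.
  by apply: IntZ; apply: IntD; [exact: IntZ|exact: Int_cst].
apply: nearW => t; rewrite -(ler_pM2l k0) mulrCA mulrDr divff ?gt_eqF//.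
have := sqr_ge0 (k * `|X n t| - 1); rewrite sqrrB1 exprMn real_normK ?num_real//.
by lra.
Qed.

Lemma measurable_superlevel X (c : R) : measurable_fun setT X ->
  measurable [set t | c < X t].
Proof.
move=> mX; rewrite -[X in measurable X]setTI.
have := mX measurableT `]c, +oo[%classic (measurable_itv _).
by congr (measurable (_ `&` _)); apply/seteqP; split => t /=; rewrite in_itv/= andbT.
Qed.

(** Weights that are bounded by [C] and small in L1 make the weighted integral of a
    fixed [X] small: split [X] at a high level [N], so that the weights cost at most
    [N Ex D] below [N], and the tail of [X] is small above it. *)
Lemma Ex_weighted_small X (C e : R) : Int X -> 0 <= C -> 0 < e ->
  exists2 dl : R, 0 < dl & forall Y D : T -> R, measurable_fun setT Y ->
    (\forall t \ae P, `|Y t| <= C) -> (\forall t \ae P, `|Y t| <= D t) ->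
    Int D -> Ex D <= dl -> Ex (fun t => `|Y t * X t|) <= e.
Proof.
move=> iX C0 e0; have mX := Int_meas iX.
pose tail n t := `|X t| * \1_([set s | n%:R < `|X s|]) t.
have mtail n : measurable_fun setT (tail n).
  apply: measurable_funM; first exact: measurableT_comp.
  apply: measurable_indic; apply: measurable_superlevel.
  exact: measurableT_comp.
have [|||_ itail _ ctail] := Ex_dct (X := tail) (Z := fun=> 0) (Y := fun t => `|X t|)
  mtail _ _ (Int_abs iX).
- exact: measurable_cst.
- apply: nearW => t; apply: cvg_near_cst.
  exists (Num.truncn `|X t|).+1 => // n /= Xn; rewrite /tail indicE memNset ?mulr0//=.
  apply/negP; rewrite -leNgt (le_trans (ltW (truncnS_gt _)))// ler_nat//.
- move=> n; apply: nearW => t; rewrite /tail normrM normr_id ler_piMr//.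
  by rewrite indicE; case: (_ \in _); rewrite ?normr1 ?normr0.
rewrite Ex_cst in ctail.
have C1 : 0 < C + 1 by rewrite ltr_wpDl.
have [N /(_ N (leqnn _)) HN] : exists N, forall n, (N <= n)%N ->
    `|Ex (tail n)| <= e / 2 / (C + 1).
  by apply: cvg0_ex ctail _; rewrite !divr_gt0.
exists (e / 2 / N.+1%:R); first by rewrite !divr_gt0.
move=> Y D mY YC YD iD ED.
have iYX := IntM_bdd mY YC iX.
apply: (@le_trans _ _ (N%:R * Ex D + C * Ex (tail N))).
  rewrite -!ExZ// -ExD; [|exact: IntZ..].
  apply: Ex_le; [exact: Int_abs|by apply: IntD; exact: IntZ|].
  apply: filter_app YD; apply: filterS YC => t YC YD; rewrite normrM /tail.
  have [XN|XN] := ltP N%:R `|X t|.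
    rewrite indicE mem_set//= mulr1 ler_wpDl//.
      by rewrite mulr_ge0// (le_trans _ YD).
    by rewrite ler_wpM2r.
  rewrite indicE memNset/=; last by apply/negP; rewrite -leNgt.
  rewrite !mulr0 addr0 mulrC.
  by apply: ler_pM.
have ED0 : 0 <= Ex D.
  by apply: Ex_ge0 => //; apply: filterS YD => t; exact: le_trans.
have h1 : N%:R * Ex D <= e / 2.
  rewrite (@le_trans _ _ (N.+1%:R * Ex D))// ?ler_wpM2r ?ler_nat//.
  by rewrite mulrC -ler_pdivlMr.
have h2 : C * Ex (tail N) <= e / 2.
  have := le_trans (ler_norm _) HN; rewrite ler_pdivlMr// => h.
  have : 0 <= Ex (tail N).
    by apply: Rintegral_ge0 => t _; rewrite /tail mulr_ge0// indicE.
  by move: h; lra.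
lra.
Qed.

Lemma Ex_dct0 (X : nat -> T -> R) Y : (forall n, measurable_fun setT (X n)) ->
  (\forall t \ae P, X ^~ t @ \oo --> (0 : R)) -> Int Y ->
  (forall n, \forall t \ae P, `|X n t| <= Y t) ->
  Ex (X n) @[n --> \oo] --> (0 : R).
Proof.
move=> mX X0 iY XY; rewrite -[X in _ --> X](Ex_cst P 0).
by have [] := Ex_dct (Z := fun=> 0) mX (measurable_cst _) X0 iY XY.
Qed.

End small_weights.

(** * Limits in L1 *)

Section L1_limits.
Context d (T : measurableType d) (R : realType) (P : probability T R).
Implicit Types (X Y : T -> R) (Z : nat -> T -> R).
Local Notation Int := (@Int _ _ _ P).
Local Notation Ex := (@Ex _ _ _ P).

(** The carre du champ takes its values in L1, and this is the convergence in which
    it is continuous. *)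
Definition L1lim Z X : Prop :=
  [/\ Int X, forall n, Int (Z n) & Ex (fun t => `|X t - Z n t|) @[n --> \oo] --> (0 : R)].

Lemma L1lim_le Z X (v : nat -> R) : Int X -> (forall n, Int (Z n)) ->
  (forall n, Ex (fun t => `|X t - Z n t|) <= v n) -> v @ \oo --> (0 : R) -> L1lim Z X.
Proof.
move=> iX iZ Zv v0; split => //; apply: cvg0_le v0 => n.
by rewrite ger0_norm//; apply: Rintegral_ge0.
Qed.

Lemma L1lim_ae Z Z' X : L1lim Z X -> (forall n, Int (Z' n)) ->
  (forall n, \forall t \ae P, Z n t = Z' n t) -> L1lim Z' X.
Proof.
move=> [iX iZ cZ] iZ' ZZ'; split => //; apply: (cvg_eq _ cZ) => n.
apply: Ex_ae_eq.
- by apply: (@Int_meas _ _ _ P); exact: Int_dist.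
- by apply: (@Int_meas _ _ _ P); exact: Int_dist.
- by apply: filterS (ZZ' n) => t ->.
Qed.

Lemma ae_eq0_of_small X (v : nat -> R) : Int X -> (\forall t \ae P, 0 <= X t) ->
  (forall n, Ex X <= v n) -> v @ \oo --> (0 : R) -> \forall t \ae P, X t = 0.
Proof.
move=> iX X0 Xv v0; apply: (Ex_eq0 iX X0); apply/eqP.
rewrite eq_le Ex_ge0// andbT; apply/ler_addgt0Pr => e e0; rewrite add0r.
have [N /(_ N (leqnn _)) HN] := cvg0_ex v0 e0.
exact: le_trans (Xv N) (le_trans (ler_norm _) HN).
Qed.

Lemma L1lim_uniq Z X Y : L1lim Z X -> L1lim Z Y -> \forall t \ae P, X t = Y t.
Proof.
move=> [iX iZ cX] [iY _ cY].
have := @ae_eq0_of_small (fun t => `|X t - Y t|)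
  (fun n => Ex (fun t => `|X t - Z n t|) + Ex (fun t => `|Y t - Z n t|)).
move=> /(_ (Int_dist iX iY) _ _ (cvg0D cX cY)) H.
have {H} : \forall t \ae P, `|X t - Y t| = 0.
  apply: H => [|n]; first exact: nearW.
  rewrite -ExD; [|exact: Int_dist..].
  apply: Ex_le; [exact: Int_dist|apply: IntD; exact: Int_dist|].
  by apply: nearW => t; rewrite [leRHS]addrC (distrC (Y t)) addrC; exact: ler_distD.
by apply: filterS => t /normr0_eq0/subr0_eq.
Qed.

Lemma L1lim_ge0 Z X : L1lim Z X -> (forall n, \forall t \ae P, 0 <= Z n t) ->
  \forall t \ae P, 0 <= X t.
Proof.
move=> [iX iZ cX] Z0.
have iXa : Int (fun t => `|X t| - X t) by apply: IntB => //; exact: Int_abs.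
have c2 : 2 * Ex (fun t => `|X t - Z n t|) @[n --> \oo] --> (0 : R).
  exact: cvg0Z.
have : \forall t \ae P, `|X t| - X t = 0.
  apply: (ae_eq0_of_small iXa _ _ c2) => [|n].
    by apply: nearW => t; rewrite subr_ge0 ler_norm.
  rewrite -ExZ; last exact: Int_dist.
  apply: Ex_le => //; first by apply: IntZ; exact: Int_dist.
  apply: filterS (Z0 n) => t Zt.
  have := ler_norm (Z n t - X t); rewrite distrC => h1.
  have h2 := normr_ge0 (X t - Z n t); case: (ger0P (X t)) => ?; lra.
by apply: filterS => t /subr0_eq <-.
Qed.

Lemma L1lim_lin a Z Z' X Y : L1lim Z X -> L1lim Z' Y ->
  L1lim (fun n t => a * Z n t + Z' n t) (fun t => a * X t + Y t).
Proof.
move=> [iX iZ cX] [iY iZ' cY].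
apply: (@L1lim_le _ _ (fun n => `|a| * Ex (fun t => `|X t - Z n t|) + Ex (fun t => `|Y t - Z' n t|))).
- by apply: IntD => //; exact: IntZ.
- by move=> n; apply: IntD => //; exact: IntZ.
- move=> n; rewrite -ExZ; last by exact: Int_dist.
  rewrite -ExD; [|by apply: IntZ; exact: Int_dist|by exact: Int_dist].
  apply: Ex_le.
  + by apply: Int_dist; apply: IntD => //; exact: IntZ.
  + by apply: IntD; [apply: IntZ|]; exact: Int_dist.
  + apply: nearW => t; rewrite -normrM (le_trans _ (ler_normD _ _))//.
    by rewrite le_eqVlt; apply/orP; left; apply/eqP; congr `|_|; ring.
- by apply: cvg0D => //; exact: cvg0Z.
Qed.

Lemma L1lim_Ex Z X : L1lim Z X -> Ex (Z n) @[n --> \oo] --> Ex X.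
Proof.
move=> [iX iZ cX]; apply/subr_cvg0.
apply: cvg0_le cX => n; rewrite distrC -ExB//.
by apply: Ex_absle; exact: IntB.
Qed.

(** Capping the distances at 1 provides the domination. *)
Lemma L1lim_ae_lim Z X Y : L1lim Z X -> measurable_fun setT Y ->
  (\forall t \ae P, Z ^~ t @ \oo --> Y t) -> \forall t \ae P, X t = Y t.
Proof.
move=> [iX iZ cZ] mY ZY.
have mXY (W : T -> R) : measurable_fun setT W ->
    measurable_fun setT (fun t => Num.min `|X t - W t| 1).
  move=> mW; apply: measurable_minr => //; apply: measurableT_comp => //.
  by apply: measurable_funB => //; exact: Int_meas iX.
have bd (x : R) : `|Num.min `|x| 1| <= 1.
  have h : 0 <= Num.min `|x| 1 by rewrite le_min normr_ge0 ler01.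
  by rewrite ger0_norm// ge_min lexx orbT.
have imin (W : T -> R) : measurable_fun setT W -> Int (fun t => Num.min `|X t - W t| 1).
  by move=> mW; apply: (@Int_bdd _ _ _ _ _ 1); [exact: mXY|apply: nearW => t; exact: bd].
have mZ n := Int_meas (iZ n).
have [|||||_ _ _ h] := @Ex_dct _ _ _ P (fun n t => Num.min `|X t - Z n t| 1)
   (fun t => Num.min `|X t - Y t| 1) (fun=> 1).
- by move=> n; exact: mXY.
- exact: mXY.
- apply: filterS ZY => t Zt; apply: cvg_minr; apply: cvg_norm.
  by apply: cvgB => //; exact: cvg_cst.
- exact: Int_cst.
- by move=> n; apply: nearW => t; exact: bd.
have E0 : Ex (fun t => Num.min `|X t - Y t| 1) = 0.
  apply: (cvg_unique (@norm_hausdorff _ _) h); apply: cvg0_le cZ => n.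
  rewrite ger0_norm; last first.
    by apply: Rintegral_ge0 => t _; rewrite le_min normr_ge0 ler01.
  apply: Ex_le; [exact: imin|exact: Int_dist|].
  by apply: nearW => t; rewrite ge_min lexx.
have m0 : \forall t \ae P, 0 <= Num.min `|X t - Y t| 1.
  by apply: nearW => t; rewrite le_min normr_ge0 ler01.
apply: filterS (Ex_eq0 (imin _ mY) m0 E0) => t.
case: leP => _; first by move/normr0_eq0/subr0_eq.
by move/eqP; rewrite oner_eq0.
Qed.

End L1_limits.

(** * Bounded Borel functions and the monotone class theorem *)

Section monotone_class.
Context (R : realType).
Implicit Types b g : R -> R.

Definition bounded_borel b : Prop :=
  measurable_fun setT b /\ exists C : R, forall x, `|b x| <= C.

Lemma bounded_borel_lin c b g : bounded_borel b -> bounded_borel g ->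
  bounded_borel (fun x => c * b x + g x).
Proof.
move=> [mb [C bC]] [mg [D gD]]; split.
  by apply: measurable_funD => //; exact: measurable_funM.
exists (`|c| * C + D) => x; apply: (le_trans (ler_normD _ _)).
by rewrite normrM lerD// ler_wpM2l.
Qed.

Lemma bounded_borel_cst c : bounded_borel (fun=> c).
Proof. by split => //; exists `|c|. Qed.

Lemma bounded_borelM b g : bounded_borel b -> bounded_borel g ->
  bounded_borel (fun x => b x * g x).
Proof.
move=> [mb [C bC]] [mg [D gD]]; split; first exact: measurable_funM.
by exists (C * D) => x; rewrite normrM ler_pM.
Qed.

Lemma bounded_borel_indic (B : set R) : measurable B -> bounded_borel (\1_B : R -> R).
Proof.
move=> mB; split; first exact: measurable_indic.
by exists 1 => x; rewrite indicE; case: (_ \in _); rewrite ?normr1 ?normr0.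
Qed.

Lemma indic_lt (x y : R) : \1_(`]x, +oo[%classic) y = (x < y)%R%:R :> R.
Proof.
rewrite indicE; congr (nat_of_bool _)%:R.
by apply/idP/idP; rewrite inE/= in_itv/= andbT.
Qed.

(** The floor of [y], for [0 <= y <= K], as a sum of indicators of superlevel sets:
    this is how a bounded function becomes a limit of linear combinations of
    indicators. *)
Fixpoint staircase (K : nat) (y : R) : R :=
  if K is K'.+1 then staircase K' y + (K'.+1%:R <= y)%R%:R else 0.

Lemma staircaseP K y : 0 <= y -> y <= K%:R -> y - 1 <= staircase K y <= y.
Proof.
move=> y0 yK.
have : forall k, [/\ staircase k y <= y, staircase k y <= k%:R &
    staircase k y = k%:R \/ y - 1 < staircase k y].
  elim=> [|k [h1 h2 h3]] /=; first by split => //; left.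
  have [ky|yk] /= := leP (k.+1%:R) y.
    have {}h3 : staircase k y = k%:R.
      by case: h3 => // h3; move: ky h2 h3; rewrite -natr1; lra.
    by rewrite h3 natr1; split => //; left.
  rewrite addr0; split => //; first by rewrite (le_trans h2)// ler_nat.
  by right; case: h3 => // ->; move: yk; rewrite -natr1; lra.
move=> /(_ K)[-> h2 h3]; rewrite andbT; case: h3 => [->|/ltW//].
by lra.
Qed.

(** The rays are stable under intersection, so that the pi-lambda theorem gives the
    indicators of Borel sets; staircases give the other bounded functions. *)
Lemma monotone_class (H : (R -> R) -> Prop) :
  (forall x, H \1_(`]x, +oo[%classic)) ->
  (forall c b g, bounded_borel b -> bounded_borel g -> H b -> H g ->
    H (fun x => c * b x + g x)) ->
  (forall (b_ : nat -> R -> R) b (C : R), (forall n, measurable_fun setT (b_ n)) ->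
    (forall n x, `|b_ n x| <= C) -> (forall n, H (b_ n)) ->
    (forall x, b_ ^~ x @ \oo --> b x) -> H b) ->
  forall b, bounded_borel b -> H b.
Proof.
move=> Hray Hlin Hlim.
have indic_bb (B : set R) : measurable B -> bounded_borel (\1_B : R -> R).
  exact: bounded_borel_indic.
have H1 : H (fun=> 1).
  apply: (Hlim (fun n => \1_(`](- n%:R), +oo[%classic)) _ 1) => [n|n x|n|x].
  - by apply: measurable_indic; exact: measurable_itv.
  - by rewrite indicE; case: (_ \in _); rewrite ?normr1 ?normr0.
  - exact: Hray.
  - apply: cvg_near_cst; exists (Num.truncn `|x|).+1 => // n /= xn.
    rewrite indic_lt (_ : (_ < x)%R)// ltrNl (le_lt_trans (ler_norm _))// normrN.
    by rewrite (lt_le_trans (truncnS_gt _))// ler_nat.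
have Hset (B : set R) : measurable B -> H \1_B.
  pose G := [set A | exists x : R, A = `]x, +oo[%classic].
  have GE : (measurable : set (set R)) = <<s G >>.
    exact: (etrans (@RGenOInfty.measurableE R)).
  move=> mB; suff : (<<s G >> `<=` [set A | measurable A /\ H \1_A]).
    by move=> /(_ B); rewrite -GE => /(_ mB)[].
  apply: lambda_system_subset => //.
  - move=> _ _ [x ->] [y ->]; exists (Num.max x y); apply/seteqP; split => z /=.
      by rewrite !in_itv/= !andbT => -[xz yz]; rewrite gt_max xz.
    by rewrite !in_itv/= !andbT gt_max => /andP[].
  - split => //=.
    + split => //; rewrite (_ : \1_setT = fun=> 1)//.
      by apply/funext => x; rewrite indicE in_setT.
    + move=> A C CA [mA HA] [mC HC]; split; first exact: measurableD.
      have := Hlin (-1) _ _ (indic_bb _ mC) (indic_bb _ mA) HC HA.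
      congr H; apply/funext => x; rewrite !indicE in_setD.
      have [xC|xC] := boolP (x \in C); last by rewrite /= andbT mulr0 add0r.
      by rewrite (_ : x \in A) /= ?mulN1r ?addNr//; move: xC; rewrite !inE; exact: CA.
    + move=> A ndA HA; have mA n : measurable (A n) by have [] := HA n.
      split; first exact: bigcupT_measurable.
      apply: (Hlim (fun n => \1_(A n)) _ 1) => [n|n x|n|x].
      * exact: measurable_indic.
      * by rewrite indicE; case: (_ \in _); rewrite ?normr1 ?normr0.
      * by have [] := HA n.
      * have [[n _ nx]|nx] := pselect ((\bigcup_k A k) x).
          apply: cvg_near_cst; exists n => // m /= nm.
          rewrite !indicE !mem_set//; first by exists n.
          by move/subsetPset : (ndA _ _ nm); exact.
        apply: cvg_near_cst; apply: nearW => n.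
        rewrite !indicE !memNset//; apply: contra_not nx => nx; by exists n.
  - by move=> A [x ->]; split => //; exact: Hray.
have H0 : H (fun=> 0).
  have := Hlin (-1) _ _ (bounded_borel_cst 1) (bounded_borel_cst 1) H1 H1.
  by congr H; apply/funext => x; lra.
move=> b [mb [C bC]].
have [K CK] : exists K : nat, C <= K%:R.
  by exists (Num.truncn C).+1; apply: ltW; exact: truncnS_gt.
have mbK n : measurable_fun setT (fun x => n.+1%:R * (b x + K%:R)).
  by apply: measurable_funM => //; exact: measurable_funD.
have mle n k : measurable [set x | k.+1%:R <= n.+1%:R * (b x + K%:R)].
  rewrite -[X in measurable X]setTI.
  have := mbK n measurableT `[k.+1%:R, +oo[%classic (measurable_itv _).
  congr (measurable (_ `&` _)); apply/seteqP; split => x /=; rewrite in_itv/= andbT//.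
have Hst n k : bounded_borel (fun x => staircase k (n.+1%:R * (b x + K%:R))) /\
    H (fun x => staircase k (n.+1%:R * (b x + K%:R))).
  elim: k => [|k [IHb IH]] /=; first by split => //; exact: bounded_borel_cst.
  have e : (fun x => staircase k (n.+1%:R * (b x + K%:R)) +
      (k.+1%:R <= n.+1%:R * (b x + K%:R))%R%:R) =
      (fun x => 1 * staircase k (n.+1%:R * (b x + K%:R)) +
       \1_([set x | k.+1%:R <= n.+1%:R * (b x + K%:R)]) x).
    apply/funext => x; rewrite mul1r indicE; congr (_ + (nat_of_bool _)%:R).
    by apply/idP/idP; rewrite inE.
  rewrite e; split; first by apply: bounded_borel_lin => //; exact: indic_bb.
  by apply: Hlin => //; [exact: indic_bb|exact: Hset].
pose st n x := staircase (2 * K * n.+1) (n.+1%:R * (b x + K%:R)).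
have b_bounds x : 0 <= b x + K%:R <= 2 * K%:R.
  have := bC x; rewrite ler_norml => /andP[h1 h2]; apply/andP; split; lra.
have stP n x : `|n.+1%:R^-1 * st n x - K%:R - b x| <= n.+1%:R^-1.
  have /andP[h0 h1] := b_bounds x.
  have := @staircaseP (2 * K * n.+1) (n.+1%:R * (b x + K%:R)).
  rewrite mulr_ge0// !natrM mulrC ler_wpM2r// => /(_ isT isT).
  rewrite /st (mulrC (n.+1%:R)); set s := staircase _ _.
  have n0 : 0 < n.+1%:R :> R by [].
  have n1 : n.+1%:R^-1 * n.+1%:R = 1 :> R by rewrite mulVf ?gt_eqF.
  move: n0 n1; set N := n.+1%:R => n0 n1 /andP[h2 h3].
  have i0 : 0 < N^-1 by rewrite invr_gt0.
  have h4 : N^-1 * ((b x + K%:R) * N - 1) <= N^-1 * s by rewrite ler_pM2l.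
  have h5 : N^-1 * s <= N^-1 * ((b x + K%:R) * N) by rewrite ler_pM2l.
  have e : N^-1 * ((b x + K%:R) * N) = b x + K%:R by rewrite mulrCA n1 mulr1.
  rewrite mulrBr e mulr1 in h4; rewrite e in h5.
  move: h4 h5; rewrite ler_norml.
  move: (N^-1 * s) (N^-1) (b x) => q i y h4 h5; apply/andP; split; lra.
apply: (Hlim (fun n x => n.+1%:R^-1 * st n x + (- K%:R * 1 + 0)) _ (C + 1)).
- move=> n; apply: measurable_funD => //; apply: measurable_funM => //.
  by have [[]] := Hst n (2 * K * n.+1)%N.
- move=> n x; rewrite mulr1 addr0.
  rewrite (_ : _ - _ = (n.+1%:R^-1 * st n x - K%:R - b x) + b x); last by ring.
  rewrite (le_trans (ler_normD _ _))// addrC lerD//.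
  by apply: (le_trans (stP n x)); rewrite invf_le1 ?ler1n.
- move=> n; have [bs Hs] := Hst n (2 * K * n.+1)%N.
  apply: (Hlin _ _ (fun=> - K%:R * 1 + 0)) => //; first exact: bounded_borel_cst.
  by apply: (Hlin _ (fun=> 1) (fun=> 0)) => //; exact: bounded_borel_cst.
- move=> x; apply/subr_cvg0; apply: cvg0_le (@cvg_harmonic R) => n.
  by rewrite mulr1 addr0; exact: stP.
Qed.
End monotone_class.

(** * Conditional expectations *)

Section conditional_expectations.
Context d (T : measurableType d) (R : realType) (P : probability T R).
Implicit Types X Y Z : T -> R.
Local Notation Int := (@Int _ _ _ P).
Local Notation Ex := (@Ex _ _ _ P).

(** Cut to 0, rather than capped: the values of [truncate n g] are values of [g] or 0,
    and [truncate n g / g] is an indicator. *)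
Definition truncate (n : nat) (g : R -> R) (y : R) : R :=
  if `|g y| <= n%:R then g y else 0.

Lemma truncate_measurable n g : measurable_fun setT g ->
  measurable_fun setT (truncate n g).
Proof.
move=> mg; rewrite (_ : truncate n g = fun y => g y * \1_([set x | `|g x| <= n%:R]) y).
  apply: measurable_funM => //; apply: measurable_indic.
  rewrite (_ : [set x | _] = ~` [set x | n%:R < `|g x|]).
    by apply: measurableC; apply: measurable_superlevel; exact: measurableT_comp.
  by apply/seteqP; split => x /=; rewrite leNgt => /negP.
apply/funext => y; rewrite /truncate indicE; case: ifPn => h.
  by rewrite mem_set// mulr1.
by rewrite memNset ?mulr0//; exact/negP.
Qed.

Lemma truncate_le n g y : `|truncate n g y| <= `|g y|.
Proof. by rewrite /truncate; case: ifP => // _; rewrite normr0. Qed.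

Lemma truncate_bounded n g : measurable_fun setT g -> bounded_borel (truncate n g).
Proof.
move=> mg; split; first exact: truncate_measurable.
by exists n%:R => y; rewrite /truncate; case: ifP => // _; rewrite normr0.
Qed.

Lemma truncate_cvg g y : truncate n g y @[n --> \oo] --> g y.
Proof.
apply: cvg_near_cst; exists (Num.truncn `|g y|).+1 => // n /= gn.
rewrite /truncate ifT// (le_trans (ltW (truncnS_gt _)))// ler_nat//.
Qed.

Lemma truncate_ge0 n g y : 0 <= g y -> 0 <= truncate n g y.
Proof. by rewrite /truncate; case: ifP. Qed.

(** Fatou's lemma, in the form of a criterion of integrability. The variables are
    capped at [m] to be compared under the expectation, and then [m] grows. *)
Lemma Ex_fatou X (Z : nat -> T -> R) (K : R) : (forall n, Int (Z n)) ->
  (forall n, \forall t \ae P, 0 <= Z n t) -> measurable_fun setT X ->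
  (\forall t \ae P, Z ^~ t @ \oo --> X t) -> (forall n, Ex (Z n) <= K) -> Int X.
Proof.
move=> iZ Z0 mX ZX ZK; apply/integrableP; split; first exact/measurable_EFinP.
have maX : measurable_fun setT (fun t => `|X t|) by exact: measurableT_comp.
have mmin m : measurable_fun setT (fun t => Num.min `|X t| m%:R) by exact: measurable_minr.
have min_bd (x : R) m : 0 <= x -> `|Num.min x m%:R| <= m%:R.
  move=> x0; have h : 0 <= Num.min x m%:R by rewrite le_min x0/=.
  by rewrite ger0_norm// ge_min lexx orbT.
have mZ n : measurable_fun setT (fun t => `|Z n t|).
  by apply: measurableT_comp => //; exact: Int_meas (iZ n).
have minK m : Ex (fun t => Num.min `|X t| m%:R) <= K.
  have [|||||_ iZm _ h] := @Ex_dct _ _ _ P (fun n t => Num.min `|Z n t| m%:R)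
      (fun t => Num.min `|X t| m%:R) (fun=> m%:R).
  - by move=> n; exact: measurable_minr.
  - exact: mmin.
  - apply: filterS ZX => t Zt.
    by apply: cvg_minr; exact: cvg_norm.
  - exact: Int_cst.
  - by move=> n; apply: nearW => t; exact: min_bd.
  - apply: (cvgr_to_le h); apply: nearW => n; apply: le_trans (ZK n).
    apply: Ex_le => //; apply: filterS (Z0 n) => t Zt.
    by rewrite ge_min ger0_norm// lexx.
have iX m : Int (fun t => Num.min `|X t| m%:R).
  by apply: (@Int_bdd _ _ _ _ _ m%:R) => //; apply: nearW => t; exact: min_bd.
have := @cvg_monotone_convergence _ _ _ P _ measurableT
  (fun m t => (Num.min `|X t| m%:R)%:E) _ _ _.
have -> : (fun t => limn (fun m => (Num.min `|X t| m%:R)%:E)) = fun t => `|(X t)%:E|%E.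
  apply/funext => t; apply/cvg_lim => //; apply: cvg_EFin; first exact: nearW.
  apply: cvg_near_cst; exists (Num.truncn `|X t|).+1 => // n /= Xn.
  by apply/min_idPl; rewrite (le_trans (ltW (truncnS_gt _)))// ler_nat.
move=> h; have {}h := h (fun m => (measurable_EFinP _ _).2 (mmin m)) _ _.
have {h}h : (\int[P]_t (Num.min `|X t| m%:R)%:E)%E @[m --> \oo] --> (\int[P]_t `|(X t)%:E|)%E.
  apply: h => [m t _|t _ m m' mm'].
    by rewrite lee_fin le_min normr_ge0/=.
  by rewrite lee_fin le_min ge_min lexx/= ge_min ler_nat mm' orbT.
apply: (@le_lt_trans _ _ K%:E); last exact: ltry.
rewrite -(cvg_lim (@ereal_hausdorff _) h); apply: lime_le; first by apply/cvg_ex; eexists; exact: h.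
by apply: nearW => m; rewrite Ex_ereal// lee_fin.
Qed.

(** The bounded functions of [X] form a monotone class that contains the rays; the
    others are limits of their truncations. *)
Lemma Ex_ray_zero X Y (w : R -> R) : measurable_fun setT X -> Int Y ->
  (forall x, Ex (fun t => \1_(`]x, +oo[%classic) (X t) * Y t) = 0) ->
  measurable_fun setT w -> Int (fun t => w (X t) * Y t) ->
  Ex (fun t => w (X t) * Y t) = 0.
Proof.
move=> mX iY Yray mw iwY.
have iM b : bounded_borel b -> Int (fun t => b (X t) * Y t).
  move=> [mb [C bC]]; apply: (@IntM_bdd _ _ _ _ _ _ C) => //; last exact: nearW.
  exact: measurableT_comp.
have bdd b : bounded_borel b -> Ex (fun t => b (X t) * Y t) = 0.
  move: b; apply: monotone_class => //.
  - move=> c b g bb bg Hb Hg; rewrite (_ : (fun t => _) = fun t =>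
      c * (b (X t) * Y t) + g (X t) * Y t); last by apply/funext => t; ring.
    rewrite ExD; [|by apply: IntZ; exact: iM|exact: iM].
    by rewrite ExZ ?Hb ?Hg ?mulr0 ?addr0//; exact: iM.
  - move=> b_ b C mb_ bC Hb cb.
    have mb : measurable_fun setT b by apply: (measurable_fun_cvg mb_) => x _.
    have [|||||_ _ _] := @Ex_dct _ _ _ P (fun n t => b_ n (X t) * Y t)
        (fun t => b (X t) * Y t) (fun t => C * `|Y t|).
    + by move=> n; apply: measurable_funM; [exact: measurableT_comp|exact: Int_meas iY].
    + by apply: measurable_funM; [exact: measurableT_comp|exact: Int_meas iY].
    + by apply: nearW => t; apply: cvgM; [exact: cb|exact: cvg_cst].
    + by apply: IntZ; exact: Int_abs.
    + by move=> n; apply: nearW => t; rewrite normrM ler_wpM2r.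
    + move=> h; apply: (cvg_unique (@norm_hausdorff _ _) h).
      by apply: cvg_near_cst; apply: nearW => n; exact: Hb.
have [|||||_ _ _] := @Ex_dct _ _ _ P (fun n t => truncate n w (X t) * Y t)
    (fun t => w (X t) * Y t) (fun t => `|w (X t) * Y t|).
- move=> n; apply: measurable_funM; last exact: Int_meas iY.
  by apply: measurableT_comp => //; exact: truncate_measurable.
- exact: Int_meas iwY.
- by apply: nearW => t; apply: cvgM; [exact: truncate_cvg|exact: cvg_cst].
- exact: Int_abs.
- by move=> n; apply: nearW => t; rewrite !normrM ler_wpM2r// truncate_le.
- move=> h; apply: (cvg_unique (@norm_hausdorff _ _) h).
  by apply: cvg_near_cst; apply: nearW => n; apply: bdd; exact: truncate_bounded.
Qed.

Lemma Int_of_truncate X Y (w : R -> R) (K : R) : measurable_fun setT X -> Int Y ->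
  (\forall t \ae P, 0 <= Y t) -> measurable_fun setT w -> (forall x, 0 <= w x) ->
  (forall n, Ex (fun t => truncate n w (X t) * Y t) <= K) ->
  Int (fun t => w (X t) * Y t).
Proof.
move=> mX iY Y0 mw w0 HK.
apply: (@Ex_fatou _ (fun n t => truncate n w (X t) * Y t) K) => //.
- move=> n; apply: (@IntM_bdd _ _ _ _ _ _ n%:R) => //.
    by apply: measurableT_comp => //; exact: truncate_measurable.
  apply: nearW => t; rewrite /truncate; case: ifP => // _.
  by rewrite normr0.
- by move=> n; apply: filterS Y0 => t Yt; rewrite mulr_ge0// truncate_ge0.
- by apply: measurable_funM; [exact: measurableT_comp|exact: Int_meas iY].
- by apply: nearW => t; apply: cvgM; [exact: truncate_cvg|exact: cvg_cst].
Qed.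

Lemma integral_preimage X Y (B : set R) : measurable_fun setT X -> measurable B ->
  Int Y -> (\int[P]_(t in X @^-1` B) (Y t)%:E)%E = (Ex (fun t => \1_B (X t) * Y t))%:E.
Proof.
move=> mX mB iY; rewrite integral_mkcond -Ex_ereal.
  apply: eq_integral => t _; rewrite /restrict indicE.
  by case: ifPn => tB; rewrite (_ : (X t \in B) = (t \in X @^-1` B))//
     ?tB ?(negbTE tB) ?mul1r ?mul0r.
apply: (@IntM_bdd _ _ _ _ _ _ 1) => //; first exact: measurableT_comp.
by apply: nearW => t; rewrite indicE; case: (_ \in _); rewrite ?normr1 ?normr0.
Qed.

Lemma condexp_Ex X Y (g w : R -> R) : is_condexp P X Y g -> measurable_fun setT X ->
  Int Y -> measurable_fun setT w -> Int (fun t => w (X t) * (Y t - g (X t))) ->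
  Ex (fun t => w (X t) * (Y t - g (X t))) = 0.
Proof.
move=> [mg ig Yg] mX iY mw iw; apply: Ex_ray_zero => //; first exact: IntB.
move=> x; have mx : measurable (`]x, +oo[%classic : set R) by exact: measurable_itv.
have := Yg _ mx; rewrite !integral_preimage// => -[/eqP].
have iB Z : Int Z -> Int (fun t => \1_(`]x, +oo[%classic : set R) (X t) * Z t).
  apply: (@IntM_bdd _ _ _ _ _ _ 1) => //; first exact: measurableT_comp.
  by apply: nearW => t; rewrite indicE; case: (_ \in _); rewrite ?normr1 ?normr0.
rewrite -subr_eq0 -ExB; [|exact: iB..] => /eqP <-.
by congr Ex; apply/funext => t; rewrite mulrBr.
Qed.

(** For nonnegative [Y], integrability against the conditional expectation gives
    integrability against [Y], since the truncated weights have equal integrals. *)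
Lemma condexp_ge0 X Y (g w : R -> R) : is_condexp P X Y g -> measurable_fun setT X ->
  Int Y -> (\forall t \ae P, 0 <= Y t) -> measurable_fun setT w -> (forall x, 0 <= w x) ->
  Int (fun t => w (X t) * g (X t)) ->
  Int (fun t => w (X t) * Y t) /\
  Ex (fun t => w (X t) * Y t) = Ex (fun t => w (X t) * g (X t)).
Proof.
move=> cg mX iY Y0 mw w0 iwg; have [mg ig Yg] := cg.
have bM b Z : bounded_borel b -> Int Z -> Int (fun t => b (X t) * Z t).
  move=> [mb [C bC]]; apply: (@IntM_bdd _ _ _ _ _ _ C); last exact: nearW.
  exact: measurableT_comp.
have iwY : Int (fun t => w (X t) * Y t).
  apply: (@Int_of_truncate _ _ _ (Ex (fun t => `|w (X t) * g (X t)|))) => // n.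
  have bt := truncate_bounded n mw; have mt := truncate_measurable n mw.
  have := condexp_Ex cg mX iY mt (bM _ _ bt (IntB iY ig)).
  under [X in Ex X = _ -> _]eq_fun do rewrite mulrBr.
  rewrite ExB; [|exact: bM..].
  move/eqP; rewrite subr_eq0 => /eqP ->; apply: Ex_le; [exact: bM|exact: Int_abs|].
  apply: nearW => t; apply: (le_trans (ler_norm _)); rewrite !normrM ler_wpM2r//.
  exact: truncate_le.
have e : (fun t => w (X t) * (Y t - g (X t))) = fun t => w (X t) * Y t - w (X t) * g (X t).
  by apply/funext => t; rewrite mulrBr.
split => //; have := condexp_Ex cg mX iY mw; rewrite e => /(_ (IntB iwY iwg)).
by rewrite ExB// => /eqP; rewrite subr_eq0 => /eqP.
Qed.

Lemma measurable_funV X : measurable_fun setT X -> measurable_fun setT (fun t => (X t)^-1).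
Proof.
move=> mX; rewrite (_ : (fun t => _) = fun t => X t * (X t ^+ 2) `^ (-1)).
  apply: measurable_funM => //; apply: (measurableT_comp (measurable_powR _)).
  exact: measurable_funX.
apply/funext => t; rewrite powR_inv1 ?sqr_ge0//.
have [->|Xt0] := eqVneq (X t) 0; first by rewrite invr0 mul0r.
by rewrite expr2 invfM mulrA divff// mul1r.
Qed.

(** The inverse in [\bar R] is infinite at 0, so that a finite moment excludes the
    value 0; and [1 / X <= 1 + (1 / X) ^ p]. *)
Lemma inv_moment_Int X (p : R) : measurable_fun setT X -> (\forall t \ae P, 0 <= X t) ->
  1 < p -> (\int[P]_t ((X t)%:E^-1 `^ p) < +oo)%E ->
  (\forall t \ae P, 0 < X t) /\ Int (fun t => (X t)^-1).
Proof.
move=> mX X0 p1 Hfin; have p0 : 0 < p by exact: lt_trans p1.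
pose V t := ((X t)%:E^-1 `^ p)%E.
have mXV := measurable_funV mX.
have mV : measurable_fun setT V.
  apply: (measurableT_comp (@measurable_poweR _ p)).
  under eq_fun do rewrite inver.
  apply: measurable_fun_ifT => //.
    by apply: measurable_fun_eqr => //; exact: measurable_cst.
  by apply/measurable_EFinP.
have V0 t : (0 <= V t)%E by exact: poweR_ge0.
have iV : P.-integrable setT V.
  by apply/integrableP; split => //; under eq_integral do rewrite gee0_abs//.
have Xpos : \forall t \ae P, 0 < X t.
  apply: filter_app X0; apply: filterS (integrable_ae measurableT iV) => t /(_ I).
  rewrite /V inver lt_neqAle eq_sym; case: eqP => //= _.
  by rewrite gt_eqF.
split => //.
have iVf : Int (fine \o V).
  apply: le_integrable iV => // [|t _].
    by apply/measurable_EFinP; apply: measurableT_comp => //; exact: measurable_fine.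
  by rewrite /=; case: (V t) => [r||]; rewrite ?normr0 ?leey.
apply: (@Int_le _ _ _ _ _ (fun t => 1 + fine (V t))) => //; last first.
  by apply: IntD => //; exact: Int_cst.
apply: filterS Xpos => t Xt; rewrite /V inver gt_eqF//=.
have y0 : 0 < (X t)^-1 by rewrite invr_gt0.
rewrite gtr0_norm//; have [y1|y1] := leP (X t)^-1 1.
  by rewrite ler_wpDr// powR_ge0.
rewrite ler_wpDl//; apply: le_trans (ler_powR (ltW y1) (ltW p1)).
by rewrite powRr1// ltW.
Qed.

End conditional_expectations.

(** * Primitives of Borel functions *)

Section oriented_integrals.
Context (R : realType).
Implicit Types b g : R -> R.
Local Notation mu := (@lebesgue_measure R).
Local Notation oi := (@oriented_integral R).

Lemma bounded_borel_integrable b x y : bounded_borel b ->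
  mu.-integrable `[x, y] (EFin \o b).
Proof.
move=> [mb [C bC]]; apply: measurable_bounded_integrable.
- exact: measurable_itv.
- by rewrite /= lebesgue_measure_itv/=; case: ifPn => // _; rewrite -EFinB ltry.
- exact: measurable_funTS.
- exists C; split; first by rewrite num_real.
  by move=> M CM z _; exact: le_trans (bC z) (ltW CM).
Qed.

Lemma oiE b c a x : bounded_borel b -> c <= a -> c <= x ->
  oi b a x = \int[mu]_(y in `[c, x]) b y - \int[mu]_(y in `[c, a]) b y.
Proof.
move=> bb; rewrite /oriented_integral.
have split_at u v : c <= u -> u <= v ->
    \int[mu]_(y in `[c, v]) b y - \int[mu]_(y in `[c, u]) b y = \int[mu]_(y in `[u, v]) b y.
  move=> cu uv; rewrite (@Rintegral_itvB _ b (BLeft c) (BRight v) u) ?bnd_simp//.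
    2: exact: bounded_borel_integrable.
  rewrite Rintegral_itv_obnd_cbnd//.
  apply: integrableS (bounded_borel_integrable u v bb) => //.
  by apply: subset_itv => //; rewrite bnd_simp.
case: (leP a x) => [ax ca cx|/ltW xa ca cx]; first by rewrite -(split_at a x).
by rewrite -(split_at x a)// opprB.
Qed.

Lemma oi_xx g a : oi g a a = 0.
Proof. by rewrite /oriented_integral lexx set_itv1 Rintegral_set1. Qed.

Lemma oi_chasles b a x y : bounded_borel b -> oi b a y = oi b a x + oi b x y.
Proof.
move=> bb; pose c := Num.min a (Num.min x y).
have [ca cx cy] : [/\ c <= a, c <= x & c <= y].
  by rewrite /c; split; rewrite !ge_min lexx ?orbT.
by rewrite !(@oiE b c)//; ring.
Qed.

Lemma oi_lin c b g a x : bounded_borel b -> bounded_borel g ->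
  oi (fun y => c * b y + g y) a x = c * oi b a x + oi g a x.
Proof.
move=> bb bg; have lin u v : \int[mu]_(y in `[u, v]) (c * b y + g y) =
    c * (\int[mu]_(y in `[u, v]) b y) + \int[mu]_(y in `[u, v]) g y.
  rewrite RintegralD//; [|exact: integrableZl (bounded_borel_integrable _ _ _)|
    exact: bounded_borel_integrable].
  by rewrite RintegralZl//; exact: bounded_borel_integrable.
by rewrite /oriented_integral !lin; case: ifP => // _; ring.
Qed.

(** The range of integration, whatever the order of the endpoints. *)
Local Notation span a x := (`[Num.min a x, Num.max a x]%classic).

Lemma oi_span g a x : oi g a x =
  (if a <= x then 1 else -1) * \int[mu]_(y in span a x) g y.
Proof.
rewrite /oriented_integral; case: (leP a x) => ax; rewrite ?mul1r ?mulN1r//.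
Qed.

Lemma eq_oi g g' a x : {in `[Num.min a x, Num.max a x], g =1 g'} ->
  oi g a x = oi g' a x.
Proof.
move=> gg'; rewrite !oi_span; congr (_ * _); apply: eq_Rintegral => y.
by rewrite inE/= => /gg'.
Qed.

Lemma oi_abs_le g a x : mu.-integrable (span a x) (EFin \o g) ->
  `|oi g a x| <= \int[mu]_(y in span a x) `|g y|.
Proof.
move=> ig; rewrite oi_span normrM (_ : `|if _ then _ else _| = 1) ?mul1r.
  exact: le_normr_Rintegral.
by case: ifP; rewrite ?normrN normr1.
Qed.

Lemma oi_bound b (C a x : R) : bounded_borel b -> (forall y, `|b y| <= C) ->
  `|oi b a x| <= C * `|x - a|.
Proof.
move=> bb bC; have C0 : 0 <= C := le_trans (normr_ge0 _) (bC 0).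
have ib := @bounded_borel_integrable b (Num.min a x) (Num.max a x) bb.
apply: (le_trans (oi_abs_le ib)).
apply: (@le_trans _ _ (\int[mu]_(y in span a x) C)).
  apply: le_Rintegral => //.
  - by have := integrable_norm ib.
  - by apply: bounded_borel_integrable; exact: bounded_borel_cst.
rewrite Rintegral_cst// ler_wpM2l//= lebesgue_measure_itv/= lte_fin.
case: (leP a x) => ax.
  by case: ifPn => //= _; rewrite ger0_norm ?subr_ge0.
by rewrite ax/= distrC ger0_norm// subr_ge0 ltW.
Qed.

Lemma oi_dct (g_ : nat -> R -> R) g (k : R -> R) a x : (forall n, measurable_fun setT (g_ n)) ->
  measurable_fun setT g -> (forall y, g_ ^~ y @ \oo --> g y) ->
  mu.-integrable (span a x) (EFin \o k) -> (forall n y, `|g_ n y| <= k y) ->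
  oi (g_ n) a x @[n --> \oo] --> oi g a x.
Proof.
move=> mg_ mg gg ik gk.
have [] := @dominated_convergence _ _ _ mu _ (measurable_itv _) (fun n => EFin \o g_ n)
   (EFin \o g) (EFin \o k) _ _ _ ik.
- by move=> n; apply/measurable_EFinP; exact: (measurable_funTS (mg_ n)).
- by apply/measurable_EFinP; exact: (measurable_funTS mg).
- by apply: nearW => y _; apply: cvg_EFin; [exact: nearW|exact: gg].
- by apply: nearW => y n _; rewrite /= lee_fin.
- move=> ig _ h; rewrite oi_span.
  apply: (@cvg_eq _ (fun n => (if a <= x then 1 else -1) *
     \int[mu]_(y in span a x) g_ n y)).
    by move=> n; rewrite oi_span.
  apply: cvgM; first exact: cvg_cst.
  have {}h : (\int[mu]_(y in span a x) (g_ n y)%:E)%E @[n --> \oo] -->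
      (\int[mu]_(y in span a x) g y)%:E.
    by rewrite /Rintegral fineK//; exact: integrable_fin_num.
  by have /fine_cvgP[_] := h.
Qed.

Lemma oi_measurable b a : bounded_borel b -> measurable_fun setT (oi b a).
Proof.
move=> bb; apply: continuous_measurable_fun => x; apply/cvgrPdist_le => e e0.
have [_ [C bC]] := bb; have C0 : 0 <= C := le_trans (normr_ge0 _) (bC 0).
near=> y; rewrite distrC (@oi_chasles b a x y bb) addrAC subrr add0r.
apply: (le_trans (oi_bound _ _ bb bC)).
have : `|y - x| <= e / (C + 1).
  rewrite distrC; near: y; apply: cvgr_dist_le; first exact: cvg_id.
  by rewrite divr_gt0// ltr_wpDl.
rewrite ler_pdivlMr ?ltr_wpDl//; have := normr_ge0 (y - x); nra.
Unshelve. all: by end_near. Qed.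

Lemma oi_FTC (G g : R -> R) a x : continuous g -> (forall y : R, is_derive y 1 G (g y)) ->
  oi g a x = G x - G a.
Proof.
move=> cg dG; have dG1 (y : R) : derivable G y 1 by have [] := dG y.
have cG : continuous G by move=> y; apply: differentiable_continuous; exact/derivable1_diffP.
have FTC u v : u < v -> \int[mu]_(y in `[u, v]) g y = G v - G u.
  move=> uv; rewrite /Rintegral (@continuous_FTC2 _ g G u v)//.
  - exact: continuous_subspaceT.
  - split=> [y _||]; first exact: dG1.
      by apply: cvg_at_right_filter; exact: cG.
    by apply: cvg_at_left_filter; exact: cG.
  - by move=> y _; rewrite derive1E; exact: derive_val.
rewrite /oriented_integral; case: ltgtP => [ax|xa|->].
- by rewrite FTC.
- by rewrite FTC// opprB.
- by rewrite set_itv1 Rintegral_set1 subrr.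
Qed.

(** The ramp that rises from 0 at [x] to [y - x] at [y]. *)
Lemma oi_indic x y z : x <= y ->
  oi \1_(`[x, y[%classic) x z = if z <= x then 0 else if z <= y then z - x else y - x.
Proof.
move=> xy; rewrite /oriented_integral.
have e u v : \int[mu]_(t in `[u, v]) \1_(`[x, y[%classic) t =
    fine (mu (`[x, y[%classic `&` `[u, v]%classic)).
  by rewrite /Rintegral integral_indic.
rewrite !e; case: ltgtP => [xz|zx|->].
- have [zy|yz] := leP z y.
    case: (ltgtP z y) zy => // [zy|->] _.
      rewrite (_ : _ `&` _ = `[x, z]%classic).
        by rewrite /= lebesgue_measure_itv/= lte_fin xz.
      apply/seteqP; split => t /=; rewrite !in_itv/=; first by case.
      by move=> /andP[-> tz]; rewrite tz (le_lt_trans tz zy).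
    rewrite (_ : _ `&` _ = `[x, y[%classic).
      by rewrite /= lebesgue_measure_itv/= lte_fin; case: ltgtP xy => // ->; rewrite subrr.
    apply/seteqP; split => t /=; rewrite !in_itv/=; first by case.
    by move=> /andP[-> ty]; rewrite ty ltW.
  rewrite (_ : _ `&` _ = `[x, y[%classic).
    by rewrite /= lebesgue_measure_itv/= lte_fin; case: ltgtP xy => // ->; rewrite subrr.
  apply/seteqP; split => t /=; rewrite !in_itv/=; first by case.
  by move=> /andP[-> ty]; rewrite ty ltW// (lt_trans ty).
- apply/eqP; rewrite oppr_eq0; apply/eqP.
  rewrite (_ : mu _ = 0%E)//; apply/eqP; rewrite eq_le measure_ge0 andbT.
  rewrite -(lebesgue_measure_set1 x) le_measure ?inE//; first exact: measurableI.
  by move=> t /= []; rewrite !in_itv/= => /andP[xt _] /andP[_ tx]; apply/eqP; rewrite eq_le tx.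
- rewrite (_ : mu _ = 0%E)//; apply/eqP; rewrite eq_le measure_ge0 andbT.
  rewrite -(lebesgue_measure_set1 z) le_measure ?inE//; first exact: measurableI.
  by move=> t /= []; rewrite !in_itv/= => /andP[xt _] /andP[_ tx]; apply/eqP; rewrite eq_le tx.
Qed.

(** The truncation to [-1, 1], presented as a primitive so that the chain rule for
    bounded slopes applies to it. *)
Definition ramp_slope : R -> R := \1_(`[(-1 : R), 1[%classic).
Definition ramp (y : R) : R := oi ramp_slope 0 y.

Lemma ramp_slope_bounded : bounded_borel ramp_slope.
Proof. exact: bounded_borel_indic. Qed.

Lemma rampE y : ramp y = if y <= -1 then -1 else if y <= 1 then y else 1.
Proof.
rewrite /ramp (@oi_chasles _ 0 (-1) y ramp_slope_bounded).
have := @oi_chasles _ (-1) 0 (-1) ramp_slope_bounded; rewrite oi_xx.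
have n11 : (-1 : R) <= 1 by lra.
rewrite !(oi_indic _ n11).
have -> : (0 <= (-1 : R)) = false by lra.
rewrite ler01 opprK add0r => /eqP; rewrite eq_sym addrC addr_eq0 => /eqP ->.
by case: ifP => _; [lra|case: ifP => _; lra].
Qed.

Lemma ramp_le1 y : `|ramp y| <= 1.
Proof.
rewrite rampE ler_norml; case: (leP y (-1)) => h; first by apply/andP; split; lra.
by case: (leP y 1) => h'; apply/andP; split; lra.
Qed.

Lemma ramp_ler y : `|ramp y| <= `|y|.
Proof.
rewrite rampE; case: (leP y (-1)) => h.
  by rewrite normrN normr1 ler0_norm; lra.
by case: (leP y 1) => // h'; rewrite normr1 ger0_norm; lra.
Qed.

Lemma cvg_ramp_slope (v : nat -> R) : v @ \oo --> (0 : R) ->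
  1 - ramp_slope (v n) @[n --> \oo] --> (0 : R).
Proof.
have h0 : 0 < 2^-1 :> R by rewrite invr_gt0.
move=> v0; have [N HN] := cvg0_ex v0 h0.
apply: cvg_near_cst; exists N => // n /= /HN; rewrite ler_norml => /andP[h1 h2].
by rewrite /ramp_slope indicE mem_set ?subrr//= in_itv/=; apply/andP; split; lra.
Qed.

(** An approximation of the indicator of ]x, +oo[ by primitives of bounded functions. *)
Definition steep_ramp (j : nat) (x y : R) : R :=
  j.+1%:R * oriented_integral \1_(`[x, x + j.+1%:R^-1[%classic) x y.

Lemma steep_ramp01 j (x y : R) : 0 <= steep_ramp j x y <= 1.
Proof.
have xj : x <= x + j.+1%:R^-1 by rewrite lerDl invr_ge0.
have j0 : 0 <= j.+1%:R :> R by [].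
have jV : j.+1%:R * j.+1%:R^-1 = 1 :> R by rewrite mulfV ?pnatr_eq0.
rewrite /steep_ramp oi_indic//; case: (leP y x) => h1; first by rewrite mulr0 lexx ler01.
case: (leP y _) => h2; last by rewrite addrAC subrr add0r jV lexx ler01.
apply/andP; split; first by rewrite mulr_ge0// subr_ge0 ltW.
by rewrite -[leRHS]jV ler_wpM2l// lerBlDl.
Qed.

Lemma steep_ramp_cvg (x y : R) :
  steep_ramp j x y @[j --> \oo] --> (\1_(`]x, +oo[%classic) y : R).
Proof.
rewrite indic_lt; have [h1|h1] := ltP x y; last first.
  apply: cvg_near_cst; apply: nearW => j.
  by rewrite /steep_ramp oi_indic ?lerDl ?invr_ge0// h1 mulr0.
have yx : 0 < y - x by rewrite subr_gt0.
have [N HN] := cvg0_ex (@cvg_harmonic _) yx.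
apply: cvg_near_cst; exists N => // j /= /HN; rewrite ger0_norm ?invr_ge0// => hj.
rewrite /steep_ramp oi_indic ?lerDl ?invr_ge0// leNgt h1/=.
case: (leP y _) => h2; last by rewrite addrAC subrr add0r mulfV.
rewrite (_ : y - x = j.+1%:R^-1) ?mulfV//; apply/eqP; rewrite eq_le hj andbT.
by rewrite lerBlDl.
Qed.

(** The normalized ramp and the indicator agree outside [u, v], and both lie between 0
    and 1 inside. *)
Lemma ramp_error (u v x y : R) : u < v -> u <= x <= v ->
  `|(v - u)^-1 * oriented_integral \1_(`[u, v[%classic) u y - \1_(`[x, +oo[%classic) y| <=
  \1_(`[u, v]%classic) y :> R.
Proof.
move=> uv /andP[ux xv]; have vu : 0 < v - u by rewrite subr_gt0.
have indE (B : set R) : 0 <= (\1_B y : R) <= 1 by rewrite indicE; case: (_ \in _); rewrite lexx ler01.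
rewrite (oi_indic _ (ltW uv)); have [yu|uy] := ltP y u.
  rewrite (ltW yu) mulr0 sub0r normrN !indicE [X in `|X%:R|](_ : _ = 0%N) ?normr0//.
  by rewrite memNset//= in_itv/= andbT leNgt (lt_le_trans yu).
have [vy|yv] := ltP v y.
  have -> : (y <= u) = false by rewrite leNgt (lt_trans uv vy).
  rewrite mulVf ?gt_eqF// [\1_(`[x, +oo[%classic) y]indicE mem_set.
    by rewrite subrr normr0; have /andP[] := indE `[u, v]%classic.
  by rewrite /= in_itv/= andbT (le_trans xv)// ltW.
rewrite [leRHS]indicE mem_set/= ?in_itv/= ?uy//.
have /andP[] := indE `[x, +oo[%classic; move: (\1_(`[x, +oo[%classic) y) => i i0 i1.
suff /andP[] : 0 <= (v - u)^-1 * (if y <= u then 0 else y - u) <= 1.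
  by move: (_^-1 * _) => j j0 j1; rewrite ler_norml; apply/andP; split; lra.
case: (leP y u) => yu; first by rewrite mulr0 lexx ler01.
apply/andP; split; first by rewrite ltW// mulr_gt0 ?invr_gt0 ?subr_gt0.
by rewrite mulrC ler_pdivrMr// mul1r lerB.
Qed.

Lemma integrable_itv_join (k : R -> R) (u v w : R) : measurable_fun setT k ->
  u <= v -> v <= w ->
  lebesgue_measure.-integrable `[u, v] (EFin \o k) ->
  lebesgue_measure.-integrable `[v, w] (EFin \o k) ->
  lebesgue_measure.-integrable `[u, w] (EFin \o k).
Proof.
move=> mk uv vw /integrableP[_ iu] /integrableP[_ iv].
have mka (D : set R) : measurable_fun D (fun y => `|(k y)%:E|%E).
  by apply/measurable_EFinP; apply: measurable_funTS; exact: measurableT_comp.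
apply/integrableP; split; first by apply/measurable_EFinP; exact: measurable_funTS.
have -> : `[u, w]%classic = `[u, v] `|` `]v, w].
  apply/seteqP; split => z /=; rewrite !in_itv/=.
    by move=> /andP[uz zw]; case: (leP z v) => zv; [left; rewrite uz|right].
  by move=> [] /andP[h1 h2]; apply/andP; split; lra.
rewrite ge0_integral_setU//=; [|by apply: mka|]; last first.
  rewrite disj_set2E; apply/eqP/seteqP; split => z //=; rewrite !in_itv/=.
  by move=> [/andP[_ h1] /andP[h2 _]]; lra.
apply: lte_add_pinfty => //; apply: le_lt_trans iv.
apply: ge0_subset_integral => //; [exact: mka|] => z /=; rewrite !in_itv/=.
by move=> /andP[/ltW -> ->].
Qed.

(** Come within [1 / (n + 1)] of the supremum of [J] on [a0, a0 + n]: every point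
    below some point of [J] is overtaken in the end. *)
Lemma cofinal_sequence (J : R -> Prop) (a0 : R) : J a0 ->
  exists b : nat -> R, [/\ forall n, J (b n), forall n, a0 <= b n &
    forall x y, J y -> x < y -> \forall n \near \oo, x < b n].
Proof.
move=> Ja; pose S n := [set y | J y /\ a0 <= y <= a0 + n%:R].
have hS n : has_sup (S n).
  split; first by exists a0; split => //; apply/andP; split; rewrite ?lerDl.
  by exists (a0 + n%:R) => y [_ /andP[]].
have ex n : exists y, S n y /\ sup (S n) - n.+1%:R^-1 < y.
  have n0 : 0 < n.+1%:R^-1 :> R by rewrite invr_gt0.
  by have [y Sy] := sup_adherent n0 (hS n); exists y.
have [b Hb] := choice ex; exists b; split=> [n|n|x y Jy xy].
- by have [[]] := Hb n.
- by have [[_ /andP[]]] := Hb n.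
have [ya|ay] := ltP y a0.
  by apply: nearW => n; have [[_ /andP[+ _]] _] := Hb n; lra.
have yx : 0 < y - x by rewrite subr_gt0.
have [N HN] := cvg0_ex (@cvg_harmonic _) yx.
exists (maxn N (Num.truncn (y - a0)).+1) => // n /=; rewrite geq_max => /andP[Nn yn].
have := HN n Nn; rewrite /= ger0_norm ?invr_ge0// => hn.
have [_ hb] := Hb n.
have : y <= sup (S n).
  apply: (sup_upper_bound (hS n)); split => //; rewrite ay/=.
  by rewrite -lerBlDl (le_trans (ltW (truncnS_gt _)))// ler_nat.
by move: hn hb; move: (_^-1) => i; lra.
Qed.

End oriented_integrals.

(** * Softplus and logistic functions *)

Section smooth_functions.
Context (R : realType).

(** Smoothness is a matter of directional derivatives on row vectors, which on R^1 are
    ordinary derivatives. *)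
Lemma partial_derivative1 (D D' : R -> R) (j : 'I_1) :
  (forall x : R, is_derive x 1 D (D' x)) ->
  let Psi := fun v : 'rV[R]_1 => D (v ord0 ord0) in
  partial_derivative j Psi = (fun v => D' (v ord0 ord0)) /\
  forall v, derivable Psi v (delta_mx ord0 j).
Proof.
move=> dD Psi; rewrite (ord1 j).
have e (v : 'rV[R]_1) :
    (fun h : R => h^-1 *: ((Psi \o shift v) (h *: delta_mx ord0 ord0) - Psi v)) =
    (fun h : R => h^-1 *: ((D \o shift (v ord0 ord0)) (h *: 1) - D (v ord0 ord0))).
  by apply/funext => h; rewrite /Psi /= !mxE !eqxx.
split; last by move=> v; rewrite /derivable e; have [] := dD (v ord0 ord0).
apply/funext => v; rewrite /partial_derivative /derive e.
by have [_] := dD (v ord0 ord0).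
Qed.

Lemma smooth_of_jet (D : nat -> R -> R) :
  (forall n (x : R), is_derive x 1 (D n) (D n.+1 x)) ->
  smooth (fun v : 'rV[R]_1 => D 0%N (v ord0 ord0)).
Proof.
move=> dD s.
have -> : foldr (@partial_derivative R 1) (fun v => D 0%N (v ord0 ord0)) s =
    (fun v => D (size s) (v ord0 ord0)).
  by elim: s => //= j s ->; have [] := @partial_derivative1 _ _ j (dD (size s)).
split=> [v|j v]; last first.
  by have [_] := @partial_derivative1 _ _ j (dD (size s)); exact.
have cD : {for v ord0 ord0, continuous (D (size s))}.
  apply: differentiable_continuous; apply/derivable1_diffP.
  by have [] := dD (size s) (v ord0 ord0).
apply: (@continuous_comp _ _ _ (fun v : 'rV[R]_1 => v ord0 ord0) (D (size s))) => //.
exact: coord_continuous.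
Qed.

(** [softplus] is a smooth function with slope between 0 and 1, and its slope
    [logistic] is a smoothed indicator of [k x > c]. *)
Definition logistic (k c x : R) : R := (1 + expR (c - k * x))^-1.
Definition softplus (k c x : R) : R := k^-1 * ln (1 + expR (k * x - c)).

Lemma logistic_gt0 k c x : 0 < logistic k c x.
Proof. by rewrite invr_gt0 addr_gt0// expR_gt0. Qed.

Lemma logistic_le1 k c x : logistic k c x <= 1.
Proof. by rewrite invf_le1 ?addr_gt0 ?expR_gt0// lerDl expR_ge0. Qed.

Lemma is_derive_affine (k c x : R) : is_derive x 1 (fun y => k * y + c) k.
Proof.
have d : is_derive x 1 (fun y => k * y + c) (k *: 1 + 0).
  exact: is_deriveD (is_deriveZ k (is_derive_id x 1)) (is_derive_cst c x 1).
by apply: (is_derive_eq d); rewrite /GRing.scale/= mulr1 addr0.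
Qed.

Lemma is_derive_logistic (k c x : R) :
  is_derive x 1 (logistic k c) (k * (logistic k c x * (1 - logistic k c x))).
Proof.
have e0 : 1 + expR (c - k * x) != 0 by rewrite gt_eqF// addr_gt0// expR_gt0.
have de : is_derive x 1 (fun y => expR (c - k * y)) (- k * expR (c - k * x)).
  rewrite (_ : (fun y => _) = expR \o (fun y => - k * y + c)); last first.
    by apply/funext => y /=; rewrite mulNr addrC.
  rewrite mulrC (_ : c - k * x = - k * x + c); last by rewrite mulNr addrC.
  by apply: is_derive1_comp; exact: is_derive_affine.
have d1 : is_derive x 1 (fun y => 1 + expR (c - k * y)) (- k * expR (c - k * x)).
  rewrite -[X in is_derive _ _ _ X]add0r; exact: is_deriveD.
apply: is_derive_eq; first exact: is_deriveV.
rewrite /GRing.scale/= /logistic; field.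
by [].
Qed.

Lemma is_derive_softplus (k c x : R) : k != 0 -> is_derive x 1 (softplus k c) (logistic k c x).
Proof.
move=> k0; have e0 : 0 < 1 + expR (k * x - c) by rewrite addr_gt0// expR_gt0.
have de : is_derive x 1 (fun y => expR (k * y - c)) (k * expR (k * x - c)).
  rewrite mulrC; apply: (@is_derive1_comp _ expR (fun y => k * y - c)).
  exact: is_derive_affine.
have d1 : is_derive x 1 (fun y => 1 + expR (k * y - c)) (k * expR (k * x - c)).
  rewrite -[X in is_derive _ _ _ X]add0r; exact: is_deriveD.
have d2 := @is_derive1_comp _ (@ln R) (fun y => 1 + expR (k * y - c)) x _ _
  (is_derive1_ln e0) d1.
have d3 : is_derive x 1 (softplus k c)
    (k^-1 *: ((1 + expR (k * x - c))^-1 * (k * expR (k * x - c)))).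
  exact: (is_deriveZ k^-1 d2).
apply: (is_derive_eq d3); rewrite /logistic /GRing.scale/=.
have -> : expR (c - k * x) = (expR (k * x - c))^-1 by rewrite -expRN opprB.
have E := expR_gt0 (k * x - c).
field.
by rewrite k0 /= !gt_eqF// addr_gt0.
Qed.

(** Since [logistic' = k logistic (1 - logistic)], all derivatives are polynomials in
    [logistic]. *)
Lemma logistic_jet (k c : R) : exists D : nat -> R -> R,
  D 0%N = logistic k c /\ forall n (x : R), is_derive x 1 (D n) (D n.+1 x).
Proof.
pose step (q : {poly R}) := q^`() * (k *: ('X * (1 - 'X))).
exists (fun n x => (iter n step 'X).[logistic k c x]); split.
  by apply/funext => x; rewrite /= hornerX.
move=> n x; rewrite iterS /step; set q := iter n _ _.
have d := @is_derive1_comp _ (horner q) (logistic k c) x _ _ (is_derive_poly q _)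
  (is_derive_logistic k c x).
by apply: (is_derive_eq d); rewrite !hornerE.
Qed.

(** The constant makes the function vanish at 0, as stability of A0 requires. *)
Lemma smooth_softplus (k c : R) : k != 0 ->
  smooth (fun v : 'rV[R]_1 => softplus k c (v ord0 ord0) - softplus k c 0).
Proof.
move=> k0; have [D [D0 dD]] := logistic_jet k c.
pose D' n := if n is n'.+1 then D n' else (fun x => softplus k c x - softplus k c 0).
apply: (@smooth_of_jet D') => -[|n] x /=; last exact: dD.
rewrite D0 -[X in is_derive _ _ _ X]subr0.
by apply: is_deriveB; exact: is_derive_softplus.
Qed.

Lemma logistic_bounded_borel k c : bounded_borel (logistic k c).
Proof.
split; last first.
  by exists 1 => x; rewrite ger0_norm ?logistic_le1// ltW// logistic_gt0.
apply: continuous_measurable_fun => x; apply: differentiable_continuous.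
by apply/derivable1_diffP; have [] := is_derive_logistic k c x.
Qed.

Lemma softplus_oi (k c x : R) : k != 0 ->
  softplus k c x - softplus k c 0 = oriented_integral (logistic k c) 0 x.
Proof.
move=> k0; apply/esym/oi_FTC.
  move=> y; apply: differentiable_continuous.
  by apply/derivable1_diffP; have [] := is_derive_logistic k c y.
by move=> y; exact: is_derive_softplus.
Qed.

Lemma logistic_lip (k c x y : R) : 0 <= k ->
  `|logistic k c y - logistic k c x| <= k * `|y - x|.
Proof.
move=> k0; pose g (z : R) := k * (logistic k c z * (1 - logistic k c z)).
have cl : continuous (logistic k c).
  move=> z; apply: differentiable_continuous.
  by apply/derivable1_diffP; have [] := is_derive_logistic k c z.
have cg : continuous g.
  move=> z; apply: cvgM; first exact: cvg_cst.
  by apply: cvgM; [exact: cl|apply: cvgB; [exact: cvg_cst|exact: cl]].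
have gk z : `|g z| <= k.
  have l0 := logistic_gt0 k c z; have l1 := logistic_le1 k c z.
  have h0 : 0 <= logistic k c z * (1 - logistic k c z).
    by rewrite mulr_ge0 ?subr_ge0// ltW.
  rewrite ger0_norm; last exact: mulr_ge0.
  rewrite /g ler_piMr//.
  by rewrite mulr_ile1 ?subr_ge0//; [exact: ltW|rewrite gerBl ltW].
rewrite -(@oi_FTC _ (logistic k c) g x y cg (is_derive_logistic k c)).
apply: oi_bound => //; split; first exact: continuous_measurable_fun.
by exists k.
Qed.

(** Steepness [n ^ 2] and shift [n]: at [x] the exponent is [n (1 - n (x - c))], which
    tends to +oo for [x <= c], including [x = c], and to -oo for [x > c]. *)
Lemma logistic_cvg (c x : R) :
  logistic (n%:R ^+ 2) (n%:R ^+ 2 * c + n%:R) x @[n --> \oo] -->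
  (\1_(`]c, +oo[%classic) x : R).
Proof.
rewrite indic_lt.
have e n : logistic (n%:R ^+ 2) (n%:R ^+ 2 * c + n%:R) x =
    (1 + expR (n%:R * (1 - n%:R * (x - c))))^-1.
  by rewrite /logistic; congr ((1 + expR _)^-1); ring.
have small (n : nat) z : n%:R <= z -> (1 + expR z)^-1 <= n.+1%:R^-1 :> R.
  move=> nz; rewrite lef_pV2 ?posrE ?addr_gt0 ?expR_gt0// -natr1 addrC lerD2l.
  by apply: (le_trans nz); apply: le_trans (expR_ge1Dx z); rewrite lerDr.
apply/subr_cvg0; apply: cvg0P => eps eps0.
have [N HN] := cvg0_ex (@cvg_harmonic R) eps0.
have {}HN n : (N <= n)%N -> n.+1%:R^-1 <= eps by move=> /HN; exact: le_trans (ler_norm _).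
have [cx|xc] := ltP c x; last first.
  exists N => n /HN; rewrite subr0 e ger0_norm; last first.
    by rewrite invr_ge0 addr_ge0// expR_ge0.
  apply: le_trans; apply: small; rewrite ler_peMr//.
  have : 0 <= n%:R * (c - x) by rewrite mulr_ge0// subr_ge0.
  by lra.
have [K HK] : exists K : nat, 2 / (x - c) <= K%:R.
  by exists (Num.truncn (2 / (x - c))).+1; apply: ltW; exact: truncnS_gt.
exists (maxn N K) => n; rewrite geq_max => /andP[/HN nN nK]; apply: le_trans nN.
rewrite e; set z := _ * _.
have nz : n%:R <= - z.
  have : 2 <= n%:R * (x - c).
    rewrite -ler_pdivrMr ?subr_gt0//; apply: (le_trans HK); by rewrite ler_nat.
  have n0 : 0 <= n%:R :> R by [].
  by rewrite /z; nra.
have := small n (- z) nz; apply: le_trans.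
have E := expR_gt0 z; rewrite expRN.
have -> : (1 + expR z)^-1 - 1 = - (1 + (expR z)^-1)^-1.
  by field; rewrite !gt_eqF// addr_gt0.
by rewrite normrN ger0_norm// invr_ge0 addr_ge0// invr_ge0 ltW.
Qed.

End smooth_functions.

(** * The domain of the Dirichlet form *)

Section dirichlet_domain.
Context d (T : measurableType d) (R : realType) (P : probability T R).
Context (M : markov_data T R) (HM : full_markov_triple P M).
Local Notation Int := (@Int _ _ _ P).
Local Notation Ex := (@Ex _ _ _ P).
Local Notation L2 := (@L2 _ _ _ P).
Local Notation A0 := (alg0 M).
Local Notation Gam := (cdc M).
Local Notation DomE := (DomE P M).
Local Notation form_approx := (form_approx P M).
Implicit Types F G H u v w : T -> R.

Local Notation En F := (energy P M F F).

Lemma A0_meas u : A0 u -> measurable_fun setT u.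
Proof. by move=> /(alg0_sub HM)/(alg_measurable HM). Qed.

Lemma A0_L2 u : A0 u -> L2 u.
Proof.
move=> Au; have [C uC] := alg0_bounded HM Au.
by apply: (@L2_bdd _ _ _ _ _ C) => //; exact: A0_meas.
Qed.

Lemma A0_Int u : A0 u -> Int u.
Proof. by move=> /A0_L2; exact: L2_Int. Qed.

Lemma A0_lin a u v : A0 u -> A0 v -> A0 (fun t => a * u t + v t).
Proof. exact: alg0_lin HM _ _ _. Qed.

Lemma A0B u v : A0 u -> A0 v -> A0 (u \- v).
Proof.
move=> Au Av; have := A0_lin (-1) Av Au.
by congr A0; apply/funext => t /=; ring.
Qed.

Lemma A0_cdc u v : A0 u -> A0 v -> Int (Gam u v).
Proof. by move=> Au Av; apply: A0_Int; exact: (cdc_alg0 HM). Qed.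

Lemma A0_cdc_sqr a u v : A0 u -> A0 v -> \forall t \ae P,
  Gam (fun s => a * u s + v s) (fun s => a * u s + v s) t =
  a ^+ 2 * Gam u u t + 2 * a * Gam u v t + Gam v v t.
Proof.
move=> Au Av; have Aw := A0_lin a Au Av.
have h1 := cdc_lin HM a Au Av Aw; have h2 := cdc_sym HM Au Aw.
have h3 := cdc_sym HM Av Aw; have h4 := cdc_lin HM a Au Av Au.
have h5 := cdc_lin HM a Au Av Av; have h6 := cdc_sym HM Au Av.
apply: filter_app h6; apply: filter_app h5; apply: filter_app h4.
apply: filter_app h3; apply: filter_app h2; apply: filterS h1.
by move=> t -> -> -> -> -> <-; ring.
Qed.

Lemma A0_energy_lin a u v : A0 u -> A0 v ->
  En (fun t => a * u t + v t) <= 2 * a ^+ 2 * En u + 2 * En v.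
Proof.
move=> Au Av; rewrite /energy -!ExZ; [|exact: A0_cdc..].
rewrite -ExD; [|by apply: IntZ; exact: A0_cdc..].
apply: Ex_le; first by apply: A0_cdc; exact: A0_lin.
  by apply: IntD; apply: IntZ; exact: A0_cdc.
have h1 := A0_cdc_sqr a Au Av; have h2 := A0_cdc_sqr (- a) Au Av.
have h3 := cdc_ge0 HM (alg0_sub HM (A0_lin (- a) Au Av)).
apply: filter_app h3; apply: filter_app h2; apply: filterS h1.
by move=> t -> ->; lra.
Qed.

Lemma A0_cdc0 : \forall t \ae P, Gam (cst 0) (cst 0) t = 0.
Proof.
apply/(cdc_eq0 HM); first exact: alg_0 HM.
by exists 0; exact: nearW.
Qed.

Lemma A0_energy0 : En (cst 0) = 0.
Proof.
rewrite -[RHS](Ex_cst P 0); apply: Ex_ae_eq => //.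
  by apply: Int_meas; apply: A0_cdc; exact: (alg0_0 HM).
exact: A0_cdc0.
Qed.

Lemma form_approxP F (u : nat -> T -> R) : L2 F ->
  form_approx F u <->
  [/\ forall n, A0 (u n),
     Ex (fun t => (F t - u n t) ^+ 2) @[n --> \oo] --> (0 : R) &
     forall e : R, 0 < e -> exists N, forall m n, (N <= m)%N -> (N <= n)%N ->
        En (u m \- u n) < e].
Proof.
by move=> lF; split=> -[Au cu En_u]; split => //;
  apply/(@norm2_cvg _ _ _ P (fun n => F \- u n)) => // n;
  apply: L2B => //; exact: A0_L2.
Qed.

Lemma DomE_L2 F : DomE F -> L2 F.
Proof. by case=> /LfunL2. Qed.

Lemma DomE_meas F : DomE F -> measurable_fun setT F.
Proof. by move=> /DomE_L2[]. Qed.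

Lemma cdc_Int F G : DomE F -> DomE G -> Int (Gam F G).
Proof. by move=> DF DG; apply/Lfun1_integrable; exact: (cdc_L1 HM). Qed.

Lemma cdc_lim F G (u v : nat -> T -> R) : DomE F -> DomE G ->
  form_approx F u -> form_approx G v ->
  L1lim P (fun n => Gam (u n) (v n)) (Gam F G).
Proof.
move=> DF DG Fu Gv.
have iG n : Int (Gam (u n) (v n)).
  by apply: A0_cdc; [case: Fu|case: Gv].
split => //; first exact: cdc_Int.
apply: (norm1_cvg _ (cdc_cont HM DF DG Fu Gv)) => n.
by apply: IntB => //; exact: cdc_Int.
Qed.

Lemma form_approx_cst u : A0 u -> form_approx u (fun=> u).
Proof.
move=> Au; apply/(form_approxP _ (A0_L2 Au)); split => //.
  by under eq_fun do (under eq_fun do rewrite subrr expr0n/=; rewrite Ex_cst); exact: cvg_cst.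
move=> e e0; exists 0%N => m n _ _.
by rewrite (_ : u \- u = cst 0) ?A0_energy0//; apply/funext => t /=; rewrite subrr.
Qed.

Lemma A0_DomE u : A0 u -> DomE u.
Proof.
by move=> Au; split; [apply/LfunL2; exact: A0_L2|exists (fun=> u); exact: form_approx_cst].
Qed.

Lemma form_approx_lin a F G (u v : nat -> T -> R) : L2 F -> L2 G ->
  form_approx F u -> form_approx G v ->
  form_approx (fun t => a * F t + G t) (fun n t => a * u n t + v n t).
Proof.
move=> lF lG /(form_approxP _ lF)[Au cu eu] /(form_approxP _ lG)[Av cv ev].
apply/(form_approxP _ (L2_lin a lF lG)); split.
- by move=> n; exact: A0_lin.
- apply: cvg0_le (cvg0D (cvg0Z (2 * a ^+ 2) cu) (cvg0Z 2 cv)) => n.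
  have lu : L2 (fun t => F t - u n t) by apply: L2B => //; exact: A0_L2.
  have lv : L2 (fun t => G t - v n t) by apply: L2B => //; exact: A0_L2.
  rewrite -!ExZ; [|by case: lv|by case: lu].
  rewrite -ExD; [|by apply: IntZ; case: lu|by apply: IntZ; case: lv].
  rewrite ger0_norm; last by apply: Rintegral_ge0 => t _; exact: sqr_ge0.
  apply: Ex_le.
  + by apply: (L2B _ _).2; [exact: L2_lin|apply: L2_lin; exact: A0_L2].
  + by apply: IntD; apply: IntZ; [case: lu|case: lv].
  + apply: nearW => t; have := sqr_ge0 (a * (F t - u n t) - (G t - v n t)); lra.
- move=> e e0; have [|N1 H1] := eu (e / (4 * (a ^+ 2 + 1))).
    by rewrite divr_gt0// mulr_gt0// ltr_wpDl ?sqr_ge0.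
  have [|N2 H2] := ev (e / 4); first by rewrite divr_gt0.
  exists (maxn N1 N2) => m n; rewrite !geq_max => /andP[m1 m2] /andP[n1 n2].
  rewrite (_ : _ \- _ = fun t => a * (u m \- u n) t + (v m \- v n) t); last first.
    by apply/funext => t /=; ring.
  apply: (le_lt_trans (A0_energy_lin _ _ _)); [exact: A0B..|].
  have {}H1 := H1 m n m1 n1; have {}H2 := H2 m n m2 n2.
  have a0 := sqr_ge0 a.
  rewrite ltr_pdivlMr in H1; last by rewrite mulr_gt0// ltr_wpDl.
  have : 0 <= En (u m \- u n).
    by apply: Ex_ge0; [apply: A0_cdc|apply: (cdc_ge0 HM); apply: (alg0_sub HM)]; exact: A0B.
  nra.
Qed.

Lemma DomE_lin a F G : DomE F -> DomE G -> DomE (fun t => a * F t + G t).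
Proof.
move=> DF DG; have lF := DomE_L2 DF; have lG := DomE_L2 DG.
case: DF DG => _ [u Fu] [_ [v Gv]].
split; first by apply/LfunL2; exact: L2_lin.
by exists (fun n t => a * u n t + v n t); exact: form_approx_lin.
Qed.

Lemma DomE0 : DomE (cst 0).
Proof. by apply: A0_DomE; exact: (alg0_0 HM). Qed.

Lemma DomEZ a F : DomE F -> DomE (fun t => a * F t).
Proof.
move=> DF; have := DomE_lin a DF DomE0.
by under eq_fun do rewrite addr0.
Qed.

Lemma DomED F G : DomE F -> DomE G -> DomE (fun t => F t + G t).
Proof.
move=> DF DG; have := DomE_lin 1 DF DG.
by under eq_fun do rewrite mul1r.
Qed.

Lemma DomEB F G : DomE F -> DomE G -> DomE (fun t => F t - G t).
Proof.
move=> DF DG; have := DomE_lin (-1) DG DF.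
by under eq_fun do rewrite mulN1r addrC.
Qed.

Lemma cdc_linl a F G H : DomE F -> DomE G -> DomE H -> \forall t \ae P,
  Gam (fun s => a * F s + G s) H t = a * Gam F H t + Gam G H t.
Proof.
move=> DF DG DH; have lF := DomE_L2 DF; have lG := DomE_L2 DG.
have [_ [u Fu]] := DF; have [_ [v Gv]] := DG; have [_ [w Hw]] := DH.
have DFG := DomE_lin a DF DG.
have Lu := cdc_lim DF DH Fu Hw; have Lv := cdc_lim DG DH Gv Hw.
have Luv := cdc_lim DFG DH (form_approx_lin a lF lG Fu Gv) Hw.
apply: (L1lim_uniq Luv); apply: L1lim_ae (L1lim_lin a Lu Lv) _ _ => n.
  by case: Luv.
have [Au _ _] := Fu; have [Av _ _] := Gv; have [Aw _ _] := Hw.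
have := cdc_lin HM a (Au n) (Av n) (Aw n).
by apply: filterS => t ->.
Qed.

Lemma cdcC F G : DomE F -> DomE G -> \forall t \ae P, Gam F G t = Gam G F t.
Proof.
move=> DF DG; have [_ [u Fu]] := DF; have [_ [v Gv]] := DG.
have Lu := cdc_lim DF DG Fu Gv; have Lv := cdc_lim DG DF Gv Fu.
apply: (L1lim_uniq Lu); apply: L1lim_ae Lv _ _ => n; first by case: Lu.
have [Au _ _] := Fu; have [Av _ _] := Gv.
exact: (cdc_sym HM (Av n) (Au n)).
Qed.

Lemma cdc_linr a F G H : DomE F -> DomE G -> DomE H -> \forall t \ae P,
  Gam H (fun s => a * F s + G s) t = a * Gam H F t + Gam H G t.
Proof.
move=> DF DG DH.
apply: filter_app (cdcC (DomE_lin a DF DG) DH).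
apply: filter_app (cdcC DF DH); apply: filter_app (cdcC DG DH).
by apply: filterS (cdc_linl a DF DG DH) => t -> -> -> ->.
Qed.

Lemma cdcFF_ge0 F : DomE F -> \forall t \ae P, 0 <= Gam F F t.
Proof.
move=> DF; have [_ [u Fu]] := DF; apply: L1lim_ge0 (cdc_lim DF DF Fu Fu) _ => n.
by apply: (cdc_ge0 HM); apply: (alg0_sub HM); case: Fu.
Qed.

Lemma cdc_sqr a F G : DomE F -> DomE G -> \forall t \ae P,
  Gam (fun s => a * F s + G s) (fun s => a * F s + G s) t =
  a ^+ 2 * Gam F F t + 2 * a * Gam F G t + Gam G G t.
Proof.
move=> DF DG; have DH := DomE_lin a DF DG.
apply: filter_app (cdcC DF DG).
apply: filter_app (cdc_linr a DF DG DG); apply: filter_app (cdc_linr a DF DG DF).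
by apply: filterS (cdc_linl a DF DG DH) => t -> -> -> <-; ring.
Qed.

(** Polarized form of [0 <= Gam (e F +- G)]; with [e] at our disposal, it does the
    work of the Cauchy-Schwarz inequality. *)
Lemma cdc_young (e : R) F G : 0 < e -> DomE F -> DomE G -> \forall t \ae P,
  `|Gam F G t| <= 2^-1 * (e * Gam F F t + e^-1 * Gam G G t).
Proof.
move=> e0 DF DG.
apply: filter_app (cdcFF_ge0 (DomE_lin e DF DG)).
apply: filter_app (cdcFF_ge0 (DomE_lin (- e) DF DG)).
apply: filter_app (cdc_sqr (- e) DF DG).
apply: filterS (cdc_sqr e DF DG) => t -> -> h1 h2.
have {}h1 : 2 * Gam F G t <= e * Gam F F t + e^-1 * Gam G G t.
  rewrite -(ler_pM2l e0) mulrDr [X in _ <= _ + X]mulrA divff ?gt_eqF// mul1r.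
  by move: h1; lra.
have {}h2 : - (2 * Gam F G t) <= e * Gam F F t + e^-1 * Gam G G t.
  rewrite -(ler_pM2l e0) mulrDr [X in _ <= _ + X]mulrA divff ?gt_eqF// mul1r.
  by move: h2; lra.
by rewrite ler_norml; apply/andP; split; lra.
Qed.

Lemma energy_ge0 F : DomE F -> 0 <= En F.
Proof. by move=> DF; apply: Ex_ge0; [exact: cdc_Int|exact: cdcFF_ge0]. Qed.

Lemma energy_sqr a F G : DomE F -> DomE G ->
  En (fun t => a * F t + G t) = a ^+ 2 * En F + 2 * a * energy P M F G + En G.
Proof.
move=> DF DG; have DH := DomE_lin a DF DG.
have iF := cdc_Int DF DF; have iG := cdc_Int DG DG; have iFG := cdc_Int DF DG.
rewrite -!ExZ// -ExD; [|exact: IntZ..].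
rewrite -ExD//; last by apply: IntD; exact: IntZ.
apply: Ex_ae_eq; last exact: cdc_sqr.
  by apply: Int_meas; exact: cdc_Int.
by apply: (@Int_meas _ _ _ P); apply: IntD => //; apply: IntD; exact: IntZ.
Qed.

Lemma energy_linB F G : DomE F -> DomE G ->
  En (fun t => F t - G t) <= 2 * En F + 2 * En G.
Proof.
move=> DF DG.
have /energy_ge0 := DomE_lin 1 DG DF; rewrite energy_sqr//.
rewrite (_ : (fun t => F t - G t) = (fun t => -1 * G t + F t)).
  by rewrite energy_sqr//; lra.
by apply/funext => t; ring.
Qed.

Lemma energy_linD F G : DomE F -> DomE G ->
  En (fun t => F t + G t) <= 2 * En F + 2 * En G.
Proof.
move=> DF DG.
have /energy_ge0 := DomE_lin (-1) DG DF; rewrite energy_sqr//.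
rewrite (_ : (fun t => F t + G t) = (fun t => 1 * G t + F t)).
  by rewrite energy_sqr//; lra.
by apply/funext => t; ring.
Qed.

Lemma cdc_L1_bound (e : R) F G : 0 < e -> DomE F -> DomE G ->
  Ex (fun t => `|Gam F G t|) <= 2^-1 * (e * En F + e^-1 * En G).
Proof.
move=> e0 DF DG.
have iF := cdc_Int DF DF; have iG := cdc_Int DG DG.
rewrite -!ExZ// -ExD; [|exact: IntZ..].
rewrite -ExZ; last by apply: IntD; exact: IntZ.
apply: Ex_le; last exact: cdc_young.
  by apply: Int_abs; exact: cdc_Int.
by apply: IntZ; apply: IntD; exact: IntZ.
Qed.

Lemma L1lim_energy (w : nat -> T -> R) F G : DomE F -> (forall n, DomE (w n)) ->
  DomE G -> En (fun t => F t - w n t) @[n --> \oo] --> (0 : R) ->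
  L1lim P (fun n => Gam (w n) G) (Gam F G).
Proof.
move=> DF Dw DG c0; split; [exact: cdc_Int|by move=> n; exact: cdc_Int|].
apply: (young_cvg0 c0 (energy_ge0 DG)) => [n|n k k0].
  by apply: energy_ge0; exact: DomEB.
have DFw := DomEB DF (Dw n).
rewrite ger0_norm; last exact: Rintegral_ge0.
have -> : Ex (fun t => `|Gam F G t - Gam (w n) G t|) =
          Ex (fun t => `|Gam (fun s => F s - w n s) G t|).
  apply: Ex_ae_eq.
  - by apply: (@Int_meas _ _ _ P); apply: Int_dist; exact: cdc_Int.
  - by apply: (@Int_meas _ _ _ P); apply: Int_abs; exact: cdc_Int.
  - apply: filterS (cdc_linl (-1) (Dw n) DF DG) => t.
    rewrite (_ : (fun s => -1 * w n s + F s) = (fun s => F s - w n s)).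
      by move=> ->; congr `|_|; ring.
    by apply/funext => s; ring.
exact: cdc_L1_bound.
Qed.

Lemma form_approx_energy F (u : nat -> T -> R) : DomE F -> form_approx F u ->
  En (fun t => F t - u n t) @[n --> \oo] --> (0 : R).
Proof.
move=> DF Fu; have [Au _ eu] := Fu; apply: cvg0P => e e0.
have [N HN] := eu e e0; exists N => n Nn.
have Dn := DomEB DF (A0_DomE (Au n)).
have En_n : form_approx (fun t => F t - u n t) (fun m t => u m t - u n t).
  have := form_approx_lin (-1) (A0_L2 (Au n)) (DomE_L2 DF) (form_approx_cst (Au n)) Fu.
  congr form_approx; first by apply/funext => t; ring.
  by apply/funext => m; apply/funext => t; ring.
rewrite ger0_norm; last exact: energy_ge0.
have := L1lim_Ex (cdc_lim Dn Dn En_n En_n); move/cvgr_to_le; apply.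
by exists N => // m Nm; apply: ltW; exact: HN.
Qed.

(** Replace each [w n] by an element of A0 within [1 / (n + 1)] of it in the form
    norm: a Cauchy sequence of Dom(E) becomes an approximating sequence from A0. *)
Lemma DomE_closed (w : nat -> T -> R) F : (forall n, DomE (w n)) -> L2 F ->
  Ex (fun t => (F t - w n t) ^+ 2) @[n --> \oo] --> (0 : R) ->
  (forall e : R, 0 < e -> exists N, forall m n, (N <= m)%N -> (N <= n)%N ->
     En (fun t => w m t - w n t) < e) ->
  DomE F /\ En (fun t => F t - w n t) @[n --> \oo] --> (0 : R).
Proof.
move=> Dw lF cw ew.
have approx n : exists u, [/\ A0 u, Ex (fun t => (w n t - u t) ^+ 2) <= n.+1%:R^-1 &
    En (fun t => w n t - u t) <= n.+1%:R^-1].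
  have [_ [u wu]] := Dw n; have e0 : 0 < n.+1%:R^-1 :> R by rewrite invr_gt0.
  have [Au c2 _] := (form_approxP _ (DomE_L2 (Dw n))).1 wu.
  have [N1 H1] := cvg0_ex c2 e0.
  have [N2 H2] := cvg0_ex (form_approx_energy (Dw n) wu) e0.
  exists (u (maxn N1 N2)); split=> //.
    by apply: le_trans (ler_norm _) (H1 _ _); exact: leq_maxl.
  by apply: le_trans (ler_norm _) (H2 _ _); exact: leq_maxr.
have [u Hu] := choice approx.
have Au n : A0 (u n) by case: (Hu n).
have inv0 : n.+1%:R^-1 @[n --> \oo] --> (0 : R) by exact: cvg_harmonic.
have Fu : form_approx F u.
  apply/(form_approxP _ lF); split => //.
    apply: cvg0_le (cvg0D (cvg0Z 2 cw) (cvg0Z 2 inv0)) => n.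
    have [_ h _] := Hu n; rewrite ger0_norm; last first.
      by apply: Rintegral_ge0 => t _; exact: sqr_ge0.
    have lw : L2 (fun t => F t - w n t) by apply: L2B => //; exact: DomE_L2.
    have lu : L2 (fun t => w n t - u n t).
      by apply: L2B; [exact: DomE_L2|exact: A0_L2].
    apply: le_trans (_ : 2 * Ex (fun t => (F t - w n t) ^+ 2) +
       2 * Ex (fun t => (w n t - u n t) ^+ 2) <= _); last by rewrite lerD2l ler_pM2l.
    rewrite -!ExZ; [|by case: lu|by case: lw].
    rewrite -ExD; [|by apply: IntZ; case: lw|by apply: IntZ; case: lu].
    apply: Ex_le.
    + by apply: (L2B _ _).2 => //; exact: A0_L2.
    + by apply: IntD; apply: IntZ; [case: lw|case: lu].
    + by apply: nearW => t; have := sqr_ge0 ((F t - w n t) - (w n t - u n t)); lra.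
  move=> e e0; have [|N1 H1] := ew (e / 16%:R); first by rewrite divr_gt0.
  have [|N2 H2] := cvg0_ex inv0 (_ : 0 < e / 16%:R); first by rewrite divr_gt0.
  exists (maxn N1 N2) => m n; rewrite !geq_max => /andP[m1 m2] /andP[n1 n2].
  have [_ _ hm] := Hu m; have [_ _ hn] := Hu n.
  have Dm := DomEB (Dw m) (A0_DomE (Au m)); have Dn := DomEB (Dw n) (A0_DomE (Au n)).
  have {}H1 := H1 m n m1 n1.
  have {m2}Hm : m.+1%:R^-1 <= e / 16%:R := le_trans (ler_norm _) (H2 m m2).
  have {n2}Hn : n.+1%:R^-1 <= e / 16%:R := le_trans (ler_norm _) (H2 n n2).
  rewrite (_ : u m \- u n = fun t => (w m t - w n t) -
     ((w m t - u m t) - (w n t - u n t))); last by apply/funext => t /=; ring.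
  apply: (le_lt_trans (energy_linB (DomEB (Dw m) (Dw n)) (DomEB Dm Dn))).
  have {}hm := le_trans hm Hm; have {}hn := le_trans hn Hn.
  by move: (energy_linB Dm Dn) hm hn H1 e0; clear; lra.
have DF : DomE F by split; [exact/LfunL2|exists u].
split => //; have cu := form_approx_energy DF Fu.
apply: cvg0_le (cvg0D (cvg0Z 2 cu) (cvg0Z 2 inv0)) => n.
have [_ _ h] := Hu n; rewrite ger0_norm; last by apply: energy_ge0; exact: DomEB.
have Du := DomEB DF (A0_DomE (Au n)); have Dn := DomEB (Dw n) (A0_DomE (Au n)).
rewrite (_ : (fun t => F t - w n t) = fun t => (F t - u n t) - (w n t - u n t)).
  by apply: (le_trans (energy_linB Du Dn)); rewrite lerD2l ler_pM2l.
by apply/funext => t; ring.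
Qed.

Lemma DomE_cst c : DomE (fun=> c).
Proof.
have [D1 _] := DomL_1 HM; have := DomEZ c D1.
by under eq_fun do rewrite /= mulr1.
Qed.

Lemma energy_cst1 : En (cst 1) = 0.
Proof.
have D1 := DomL_1 HM; have [D1' _] := D1.
have := gen_DomL_ibp HM D1 D1'; move/eqP; rewrite -eqr_oppLR => /eqP <-.
apply/eqP; rewrite oppr_eq0; apply/eqP; rewrite -[RHS](Ex_cst P 0).
apply: Ex_ae_eq => //; last by apply: filterS (gen_1 HM) => t ->; rewrite mulr0.
apply: (@Int_meas _ _ _ P); apply: L2M; first exact: DomE_L2.
by apply/LfunL2; exact: (gen_DomL_L2 HM).
Qed.

(** [L 1 = 0] makes the energy of the constant 1 vanish; then apply [cdc_L1_bound] with
    large [k]. *)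
Lemma cdc_cstl c G : DomE G -> \forall t \ae P, Gam (fun=> c) G t = 0.
Proof.
move=> DG; have D1 := DomE_cst 1.
have h : Ex (fun t => `|Gam (fun=> 1) G t|) = 0.
  apply/eqP; rewrite eq_le Rintegral_ge0// andbT.
  apply/ler_addgt0Pr => e e0; rewrite add0r; have G0 := energy_ge0 DG.
  pose k := (En G + 1) / e; have k0 : 0 < k by rewrite divr_gt0// ltr_wpDl.
  apply: (le_trans (cdc_L1_bound k0 D1 DG)); rewrite energy_cst1 mulr0 add0r.
  have : k^-1 * En G <= e.
    rewrite /k invf_div mulrAC ler_pdivrMr ?ltr_wpDl// ler_pM2l//.
    by rewrite lerDl.
  have : 0 <= k^-1 * En G by rewrite mulr_ge0// invr_ge0 ltW.
  lra.
have h1 : \forall t \ae P, `|Gam (fun=> 1) G t| = 0.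
  by apply: Ex_eq0 => //; [apply: Int_abs; exact: cdc_Int|exact: nearW].
have := cdc_linl (c - 1) D1 D1 DG.
rewrite (_ : (fun s => (c - 1) * 1 + 1) = fun=> c); last by apply/funext => t; ring.
by apply: filter_app; apply: filterS h1 => t /normr0_eq0 -> ->; rewrite mulr0 addr0.
Qed.

Lemma cdc_addcst c F G : DomE F -> DomE G ->
  \forall t \ae P, Gam (fun s => F s + c) G t = Gam F G t.
Proof.
move=> DF DG; have := cdc_linl 1 DF (DomE_cst c) DG.
rewrite (_ : (fun s => 1 * F s + c) = fun s => F s + c); last first.
  by apply/funext => t; rewrite mul1r.
by apply: filter_app; apply: filterS (cdc_cstl c DG) => t -> ->; rewrite mul1r addr0.
Qed.

(** Against a fixed [W] in A0 the form is continuous already in L2, so that the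
    identity on A0 passes to the limit. *)
Lemma energy_ibp_A0 V W : DomE V -> A0 W ->
  energy P M V W = - Ex (fun t => V t * gen M W t).
Proof.
move=> DV AW; have [_ [u Vu]] := DV; have [Au cu _] := (form_approxP _ (DomE_L2 DV)).1 Vu.
have ALW := gen_alg0 HM AW; have lLW := A0_L2 ALW; have lV := DomE_L2 DV.
have h1 := L1lim_Ex (cdc_lim DV (A0_DomE AW) Vu (form_approx_cst AW)).
have h2 := L2M_cvg lV (fun n => A0_L2 (Au n)) lLW cu.
apply: (cvg_unique (@norm_hausdorff _ _) h1).
apply: (cvg_eq _ (cvgN h2)) => n.
have [h _] := gen_ibp HM (alg0_sub HM (Au n)) AW.
by rewrite -[RHS]opprK; congr (- _).
Qed.

(** * The chain rule for bounded slopes *)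

Lemma A0_softplus (k c : R) u : k != 0 -> A0 u ->
  A0 (fun t => oriented_integral (logistic k c) 0 (u t)) /\
  forall v, A0 v -> \forall t \ae P,
    Gam (fun t => oriented_integral (logistic k c) 0 (u t)) v t =
    logistic k c (u t) * Gam u v t.
Proof.
move=> k0 Au; have sPsi := smooth_softplus c k0.
set Psi := (fun v : 'rV[R]_1 => _) in sPsi.
have Au' : forall i : 'I_1, A0 ((fun=> u) i) by [].
have E : eval_at Psi (fun=> u) = fun t => oriented_integral (logistic k c) 0 (u t).
  by apply/funext => t; rewrite /eval_at /Psi mxE softplus_oi.
rewrite -E; split=> [|v Av].
  by apply: (alg0_smooth HM) => //; rewrite /Psi mxE subrr.
have := cdc_diffusion HM sPsi (fun i => alg0_sub HM (Au' i)) (alg0_sub HM Av).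
apply: filterS => t ->; rewrite big_ord1; congr (_ * _).
have dS (x : R) : is_derive x 1 (fun x => softplus k c x - softplus k c 0) (logistic k c x).
  rewrite -[X in is_derive _ _ _ X]subr0.
  by apply: is_deriveB; exact: is_derive_softplus.
have [-> _] := @partial_derivative1 _ _ _ ord0 dS.
by rewrite /eval_at mxE.
Qed.

(** With [p, q] the slopes at [u] and [v], the left-hand side is
    [p ^ 2 Gam u u - 2 p q Gam u v + q ^ 2 Gam v v], that is, [p q] times
    [Gam (u - v) (u - v)] plus [(p - q) (p Gam u u - q Gam v v)]. *)
Lemma A0_energy_softplus (k c : R) u v : k != 0 -> A0 u -> A0 v ->
  let Phi x := oriented_integral (logistic k c) 0 x in
  \forall t \ae P,
  Gam (fun s => Phi (u s) - Phi (v s)) (fun s => Phi (u s) - Phi (v s)) t <=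
  Gam (u \- v) (u \- v) t +
  `|logistic k c (u t) - logistic k c (v t)| * (Gam u u t + Gam v v t).
Proof.
move=> k0 Au Av Phi.
have [APu cu] := A0_softplus c k0 Au; have [APv cv] := A0_softplus c k0 Av.
have := A0_cdc_sqr (-1) APv APu; have := A0_cdc_sqr (-1) Av Au.
have -> : (fun s => -1 * Phi (v s) + Phi (u s)) = (fun s => Phi (u s) - Phi (v s)).
  by apply/funext => s; ring.
have -> : (fun s => -1 * v s + u s) = u \- v by apply/funext => s /=; ring.
move=> h1; apply: filter_app; apply: filter_app h1.
apply: filter_app (cdc_ge0 HM (alg0_sub HM Au)).
apply: filter_app (cdc_ge0 HM (alg0_sub HM Av)).
apply: filter_app (cdc_ge0 HM (alg0_sub HM (A0B Au Av))).
apply: filter_app (cu _ APu); apply: filter_app (cdc_sym HM Au APu).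
apply: filter_app (cu _ Au); apply: filter_app (cv _ APv).
apply: filter_app (cdc_sym HM Av APv); apply: filter_app (cv _ Av).
apply: filter_app (cv _ APu); apply: filter_app (cdc_sym HM Av APu).
apply: filter_app (cu _ Av).
apply: filterS (cdc_sym HM Au Av) => t e0 e1 e2 e3 e4 e5 e6 e7 e8 e9 g1 g2 g3 e10 e11.
rewrite {}e11 {}e3 {}e2 {}e1 {}e0 {}e6 {}e5 {}e4 {}e9 {}e8 {}e7.
rewrite {}e10 in g1 *.
have p0 := logistic_gt0 k c (u t); have p1 := logistic_le1 k c (u t).
have q0 := logistic_gt0 k c (v t); have q1 := logistic_le1 k c (v t).
move: (logistic k c (u t)) (logistic k c (v t)) p0 p1 q0 q1 => p q p0 p1 q0 q1.
move: (Gam v u t) (Gam u u t) (Gam v v t) g1 g2 g3 => x y z g1 g2 g3.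
have pq : p * q <= 1 by rewrite mulr_ile1// ltW.
have h1 : p * q * ((-1) ^+ 2 * z + 2 * -1 * x + y) <= (-1) ^+ 2 * z + 2 * -1 * x + y.
  by rewrite ler_piMl.
have h2 : (p - q) * (p * y - q * z) <= `|p - q| * (y + z).
  apply: (le_trans (ler_norm _)); rewrite normrM ler_wpM2l//.
  apply: (le_trans (ler_normB _ _)); rewrite !normrM lerD//.
    by rewrite (ger0_norm g3) gtr0_norm// ler_piMl.
  by rewrite (ger0_norm g2) gtr0_norm// ler_piMl.
by lra.
Qed.

(** Base point 0 matches the convention [Psi 0 = 0] for A0; [chain_rule_base] changes
    it. *)
Definition chain_rule F (b : R -> R) : Prop :=
  DomE (fun t => oriented_integral b 0 (F t)) /\
  forall G, DomE G -> \forall t \ae P,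
    Gam (fun s => oriented_integral b 0 (F s)) G t = b (F t) * Gam F G t.

(** Along an approximation [u] of [F] from A0, the images of [u] are approximations of
    the image of [F]: in the bound of [A0_energy_softplus] the difference of the slopes
    is bounded by 1 and small in L1, hence a small weight in the sense of
    [Ex_weighted_small], while [Gam (u n) (u n)] stays close to [Gam F F] in L1. *)
Lemma chain_rule_logistic (k c : R) F : 0 < k -> DomE F -> chain_rule F (logistic k c).
Proof.
move=> k0 DF; have kn0 : k != 0 by rewrite gt_eqF.
set phi := logistic k c; pose Phi x := oriented_integral phi 0 x.
have bphi : bounded_borel phi by exact: logistic_bounded_borel.
have phi1 x : `|phi x| <= 1.
  by rewrite ger0_norm ?logistic_le1// ltW// logistic_gt0.
have phiB1 x y : `|phi x - phi y| <= 1.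
  have := logistic_gt0 k c x; have := logistic_le1 k c x.
  have := logistic_gt0 k c y; have := logistic_le1 k c y.
  by rewrite -/phi ler_norml => ? ? ? ?; apply/andP; split; lra.
have Phi_lip x y : `|Phi x - Phi y| <= `|x - y|.
  rewrite /Phi (@oi_chasles _ phi 0 y x bphi) addrAC subrr add0r.
  by apply: (le_trans (oi_bound _ _ bphi phi1)); rewrite mul1r.
have mPhi : measurable_fun setT Phi by exact: oi_measurable.
have mphi : measurable_fun setT phi by have [] := bphi.
have lF := DomE_L2 DF; have mF := DomE_meas DF.
have lPhi : L2 (fun t => Phi (F t)).
  apply: (L2_le _ _ lF); first exact: measurableT_comp.
  by apply: nearW => t; have := Phi_lip (F t) 0; rewrite {2}/Phi oi_xx !subr0.
have [_ [u Fu]] := DF; have [Au cu eu] := (form_approxP _ lF).1 Fu.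
have mu_ n : measurable_fun setT (u n) := A0_meas (Au n).
have lFu n : L2 (fun t => F t - u n t) by apply: L2B => //; exact: A0_L2.
have c1 := L1_of_L2 lFu cu.
have APu n : A0 (fun t => Phi (u n t)) := (A0_softplus c kn0 (Au n)).1.
have L1u := cdc_lim DF DF Fu Fu; have [iFF iuu cuu] := L1u.
have Pu : form_approx (fun t => Phi (F t)) (fun n t => Phi (u n t)).
  apply/(form_approxP _ lPhi); split => //.
    apply: cvg0_le cu => n; rewrite ger0_norm; last first.
      by apply: Rintegral_ge0 => t _; exact: sqr_ge0.
    apply: Ex_le; first by apply: (L2B lPhi _).2; exact: A0_L2.
      by case: (lFu n).
    apply: nearW => t; rewrite -[leLHS]real_normK ?num_real//.
    by rewrite -[leRHS]real_normK ?num_real// lerXn2r.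
  move=> e e0; have e4 : 0 < e / 12%:R by rewrite divr_gt0.
  have [dl dl0 small] := Ex_weighted_small iFF ler01 e4.
  have [N1 H1] := eu _ e4; have [N2 H2] := cvg0_ex cuu e4.
  have d2 : 0 < dl / k / 2 by rewrite !divr_gt0.
  have [N3 H3] := cvg0_ex c1 d2.
  - exists (maxn N1 (maxn N2 N3)) => m n.
    rewrite !geq_max => /andP[m1 /andP[m2 m3]] /andP[n1 /andP[n2 n3]].
    have Auu := A0B (Au m) (Au n).
    have mpq : measurable_fun setT (fun t => `|phi (u m t) - phi (u n t)|).
      by apply: measurableT_comp => //; apply: measurable_funB; exact: measurableT_comp.
    have b1 t : `| `|phi (u m t) - phi (u n t)| | <= 1 by rewrite normr_id.
    have iw X : Int X -> Int (fun t => `|phi (u m t) - phi (u n t)| * X t).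
      by apply: IntM_bdd => //; exact: nearW.
    (* The Lipschitz bound on the logistic function makes the weight small in L1. *)
    have wF : Ex (fun t => `| `|phi (u m t) - phi (u n t)| * Gam F F t |) <= e / 12%:R.
      apply: (small _ (fun t => k * (`|F t - u m t| + `|F t - u n t|))) => //.
      - exact: nearW.
      - apply: nearW => t; rewrite normr_id (le_trans (logistic_lip _ _ _ (ltW k0)))//.
        rewrite ler_wpM2l ?(ltW k0)//.
        by rewrite (distrC (F t) (u m t)) ler_distD.
      - by apply: IntZ; apply: IntD; apply: Int_abs; exact: L2_Int.
      - have i1 n' : Int (fun t => `|F t - u n' t|) by apply: Int_abs; exact: L2_Int.
        rewrite ExZ; last exact: IntD.
        rewrite ExD// mulrC -ler_pdivlMr//.
        have := le_trans (ler_norm _) (H3 m m3).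
        by have := le_trans (ler_norm _) (H3 n n3); lra.
    have wu n' : (N2 <= n')%N ->
        Ex (fun t => `|phi (u m t) - phi (u n t)| * Gam (u n') (u n') t) <= e / 6%:R.
      move=> /H2 h; apply: (@le_trans _ _ (Ex (fun t =>
        `| `|phi (u m t) - phi (u n t)| * Gam F F t |) +
        Ex (fun t => `|Gam F F t - Gam (u n') (u n') t|))).
        rewrite -ExD; [|exact: Int_abs (iw _ _)|exact: Int_dist].
        apply: Ex_le; [exact: iw|apply: IntD; [exact: Int_abs (iw _ _)|exact: Int_dist]|].
        apply: nearW => t.
        move: (Gam F F t) (Gam (u n') (u n') t) (b1 t); rewrite normr_id.
        move: `|phi (u m t) - phi (u n t)| (normr_ge0 (phi (u m t) - phi (u n t))) => w w0 x y w1.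
        apply: (@le_trans _ _ (w * x + w * `|x - y|)).
          by rewrite -mulrDr ler_wpM2l//; have := ler_norm (y - x); rewrite distrC; lra.
        by rewrite lerD ?ler_norm// ler_piMl.
      have := le_trans (ler_norm _) h; lra.
    rewrite (_ : _ \- _ = fun s => Phi (u m s) - Phi (u n s))//.
    apply: (@le_lt_trans _ _ (En (u m \- u n) + (Ex (fun t =>
       `|phi (u m t) - phi (u n t)| * Gam (u m) (u m) t) + Ex (fun t =>
       `|phi (u m t) - phi (u n t)| * Gam (u n) (u n) t)))).
      have iG := A0_cdc Auu Auu.
      rewrite -ExD; [|exact: iw..].
      rewrite -ExD//; last by apply: IntD; exact: iw.
      apply: Ex_le.
      + by apply: A0_cdc; exact: A0B.
      + by apply: IntD => //; apply: IntD; exact: iw.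
      + by apply: filterS (A0_energy_softplus c kn0 (Au m) (Au n)) => t; rewrite mulrDr.
    have := wu m m2; have := wu n n2; have := H1 m n m1 n1; lra.
have DPhi : DomE (fun t => Phi (F t)).
  by split; [exact/LfunL2|exists (fun n t => Phi (u n t))].
split => // G DG; have [_ [v Gv]] := DG; have [Av _ _] := Gv.
have L1 := cdc_lim DPhi DG Pu Gv; have L2 := cdc_lim DF DG Fu Gv.
have [iFG iuv cuv] := L2.
have mphiF : measurable_fun setT (fun t => phi (F t)) by exact: measurableT_comp.
have mphiu n : measurable_fun setT (fun t => phi (u n t)) by exact: measurableT_comp.
have iuv' n : Int (fun t => phi (u n t) * Gam (u n) (v n) t).
  by apply: (@IntM_bdd _ _ _ _ _ _ 1) => //; apply: nearW => t; exact: phi1.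
have iFG' : Int (fun t => phi (F t) * Gam F G t).
  by apply: (@IntM_bdd _ _ _ _ _ _ 1) => //; apply: nearW => t; exact: phi1.
have {L1}L1 : L1lim P (fun n t => phi (u n t) * Gam (u n) (v n) t)
    (Gam (fun t => Phi (F t)) G).
  apply: (L1lim_ae L1) => // n.
  exact: (A0_softplus c kn0 (Au n)).2 _ (Av n).
apply: (L1lim_uniq L1); split => //.
have mw n : measurable_fun setT (fun t => phi (F t) - phi (u n t)).
  exact: measurable_funB.
have iw n : Int (fun t => (phi (F t) - phi (u n t)) * Gam F G t).
  by apply: (@IntM_bdd _ _ _ _ _ _ 1) => //; exact: nearW.
have cw : Ex (fun t => `|(phi (F t) - phi (u n t)) * Gam F G t|) @[n --> \oo] --> (0 : R).
  apply: cvg0P => e e0; have [dl dl0 small] := Ex_weighted_small iFG ler01 e0.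
  have [N HN] := cvg0_ex c1 (divr_gt0 dl0 k0); exists N => n /HN h.
  rewrite ger0_norm; last exact: Rintegral_ge0.
  have i1 : Int (fun t => `|F t - u n t|) by apply: Int_abs; exact: L2_Int.
  apply: (small _ (fun t => k * `|F t - u n t|)) => //.
  - exact: nearW.
  - by apply: nearW => t; apply: logistic_lip; exact: ltW.
  - exact: IntZ.
  - by rewrite ExZ// mulrC -ler_pdivlMr//; exact: le_trans (ler_norm _) h.
apply: cvg0_le (cvg0D cw cuv) => n; rewrite ger0_norm; last exact: Rintegral_ge0.
rewrite -ExD; [|exact: Int_abs|exact: Int_dist].
apply: Ex_le; [exact: Int_dist|by apply: IntD; [exact: Int_abs|exact: Int_dist]|].
apply: nearW => t.
rewrite (_ : _ - _ = (phi (F t) - phi (u n t)) * Gam F G t +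
   phi (u n t) * (Gam F G t - Gam (u n) (v n) t)); last by ring.
by rewrite (le_trans (ler_normD _ _))// lerD// normrM ler_piMl.
Qed.

Lemma chain_rule_lin c F b g : DomE F -> bounded_borel b -> bounded_borel g ->
  chain_rule F b -> chain_rule F g -> chain_rule F (fun x => c * b x + g x).
Proof.
move=> DF bb bg [Db Cb] [Dg Cg].
have E : (fun t => oriented_integral (fun x => c * b x + g x) 0 (F t)) =
   (fun t => c * oriented_integral b 0 (F t) + oriented_integral g 0 (F t)).
  by apply/funext => t; rewrite oi_lin.
split=> [|G DG]; rewrite E; first exact: DomE_lin.
apply: filter_app (cdc_linl c Db Dg DG).
apply: filter_app (Cb _ DG); apply: filterS (Cg _ DG) => t -> -> ->; ring.
Qed.

Lemma slope_energy F W b : DomE F -> DomE W -> bounded_borel b ->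
  (forall G, DomE G -> \forall t \ae P, Gam W G t = b (F t) * Gam F G t) ->
  Int (fun t => b (F t) ^+ 2 * Gam F F t) /\
  En W = Ex (fun t => b (F t) ^+ 2 * Gam F F t).
Proof.
move=> DF DW [mb [C bC]] Wb.
have i : Int (fun t => b (F t) ^+ 2 * Gam F F t).
  apply: (@IntM_bdd _ _ _ _ _ _ (C ^+ 2)); last exact: cdc_Int.
    by apply: measurable_funX; apply: measurableT_comp => //; exact: DomE_meas.
  by apply: nearW => t; rewrite normrX lerXn2r// nnegrE//; exact: le_trans (bC 0).
split => //; apply: Ex_ae_eq; [by apply: Int_meas; exact: cdc_Int|exact: Int_meas i|].
apply: filter_app (Wb _ DW); apply: filter_app (cdcC DF DW).
by apply: filterS (Wb _ DF) => t e1 e2 ->; rewrite e2 e1; ring.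
Qed.

(** The energy of the difference of two primitives is
    [E[(b_ m - b_ n)(F) ^ 2 Gam F F]], small by dominated convergence; completeness of
    the domain then provides the limit. *)
Lemma chain_rule_lim F (b_ : nat -> R -> R) (g : R -> R) (C : R) : DomE F ->
  (forall n, measurable_fun setT (b_ n)) -> (forall n x, `|b_ n x| <= C) ->
  (forall n, chain_rule F (b_ n)) -> (forall x, b_ ^~ x @ \oo --> g x) ->
  chain_rule F g.
Proof.
move=> DF mb_ bC cb cg.
have mF := DomE_meas DF; have lF := DomE_L2 DF; have iFF := cdc_Int DF DF.
have C0 : 0 <= C := le_trans (normr_ge0 _) (bC 0%N 0).
have gC x : `|g x| <= C.
  by apply: (cvgr_to_le (cvg_norm (cg x))); exact: nearW.
have mg : measurable_fun setT g by apply: (measurable_fun_cvg mb_) => x _.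
have bb_ n : bounded_borel (b_ n) by split => //; exists C.
have bg : bounded_borel g by split => //; exists C.
pose w n t := oriented_integral (b_ n) 0 (F t).
pose W t := oriented_integral g 0 (F t).
have oiC f (bf : bounded_borel f) (fC : forall x, `|f x| <= C) t :
    `|oriented_integral f 0 (F t)| <= C * `|F t|.
  by have := oi_bound 0 (F t) bf fC; rewrite subr0.
have mW : measurable_fun setT W by apply: measurableT_comp => //; exact: oi_measurable.
have mw n : measurable_fun setT (w n).
  by apply: measurableT_comp => //; exact: oi_measurable.
have mbF n : measurable_fun setT (fun t => b_ n (F t)) by exact: measurableT_comp.
have mgF : measurable_fun setT (fun t => g (F t)) by exact: measurableT_comp.
have lCF : L2 (fun t => C * F t) by exact: L2Z.
have lW : L2 W.
  by apply: (L2_le mW _ lCF); apply: nearW => t; rewrite normrM (ger0_norm C0) oiC.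
have ptW t : w ^~ t @ \oo --> W t.
  apply: (@oi_dct _ b_ g (fun=> C)) => //.
  by apply: bounded_borel_integrable; exact: bounded_borel_cst.
have cw : Ex (fun t => (W t - w n t) ^+ 2) @[n --> \oo] --> (0 : R).
  apply: (@Ex_dct0 _ _ _ _ _ (fun t => 4 * (C * F t) ^+ 2)).
  - by move=> n; apply: measurable_funX; exact: measurable_funB.
  - by apply: nearW => t; apply: cvg0_sqr; exact: cvg0_subl.
  - by apply: IntZ; case: lCF.
  - move=> n; apply: nearW => t; rewrite ger0_norm ?sqr_ge0//.
    rewrite -real_normK ?num_real// (_ : 4 * _ = (2 * (C * `|F t|)) ^+ 2); last first.
      by rewrite !exprMn real_normK ?num_real//; ring.
    rewrite lerXn2r ?nnegrE ?mulr_ge0//.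
    apply: (le_trans (ler_normB _ _)); rewrite mulr_natl mulr2n lerD//.
      exact: oiC.
    exact: oiC.
pose a n := Ex (fun t => (b_ n (F t) - g (F t)) ^+ 2 * Gam F F t).
have ia n : Int (fun t => (b_ n (F t) - g (F t)) ^+ 2 * Gam F F t).
  apply: (@IntM_bdd _ _ _ _ _ _ ((C + C) ^+ 2)) => //.
    by apply: measurable_funX; exact: measurable_funB.
  apply: nearW => t; rewrite normrX lerXn2r ?nnegrE ?addr_ge0//.
  by rewrite (le_trans (ler_normB _ _))// lerD.
have a0 : a @ \oo --> (0 : R).
  apply: (@Ex_dct0 _ _ _ _ _ (fun t => (C + C) ^+ 2 * `|Gam F F t|)).
  - by move=> n; exact: Int_meas (ia n).
  - by apply: nearW => t; apply: cvg0Mr; apply: cvg0_sqr; exact: cvg0_subr.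
  - by apply: IntZ; exact: Int_abs.
  - move=> n; apply: nearW => t; rewrite normrM ler_wpM2r//.
    rewrite normrX lerXn2r ?nnegrE ?addr_ge0//.
    by rewrite (le_trans (ler_normB _ _))// lerD.
have Cauchy e : 0 < e -> exists N, forall m n, (N <= m)%N -> (N <= n)%N ->
    En (fun t => w m t - w n t) < e.
  move=> e0; have e8 : 0 < e / 8%:R by rewrite divr_gt0.
  have [N HN] := cvg0_ex a0 e8; exists N => m n Nm Nn.
  have cmn := chain_rule_lin (-1) DF (bb_ n) (bb_ m) (cb n) (cb m).
  have [imn] := slope_energy DF cmn.1 (bounded_borel_lin (-1) (bb_ n) (bb_ m)) cmn.2.
  rewrite (_ : (fun t => oriented_integral _ 0 (F t)) = fun t => w m t - w n t); last first.
    by apply/funext => t; rewrite oi_lin// mulN1r addrC.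
  move=> ->; apply: (@le_lt_trans _ _ (2 * a m + 2 * a n)); last first.
    have := le_trans (ler_norm _) (HN m Nm); have := le_trans (ler_norm _) (HN n Nn).
    by lra.
  rewrite /a -!ExZ// -ExD; [|exact: IntZ..].
  apply: Ex_le => //; first by apply: IntD; exact: IntZ.
  apply: filterS (cdcFF_ge0 DF) => t G0; rewrite !mulrA -mulrDl ler_wpM2r//.
  have := sqr_ge0 (b_ m (F t) - g (F t) + (b_ n (F t) - g (F t))).
  by lra.
have Dw n : DomE (w n) by have [] := cb n.
have [DW eW] := DomE_closed Dw lW cw Cauchy.
split => // G DG; have iFG := cdc_Int DF DG.
have LW := L1lim_energy DW Dw DG eW.
have LW' : L1lim P (fun n t => b_ n (F t) * Gam F G t) (Gam W G).
  apply: (L1lim_ae LW) => [n|n]; last by have [_] := cb n; exact.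
  by apply: (@IntM_bdd _ _ _ _ _ _ C) => //; exact: nearW.
apply: (L1lim_uniq LW'); have igF : Int (fun t => g (F t) * Gam F G t).
  by apply: (@IntM_bdd _ _ _ _ _ _ C) => //; exact: nearW.
have [_ ibF _] := LW'; split => //.
apply: (@Ex_dct0 _ _ _ _ _ (fun t => (C + C) * `|Gam F G t|)).
- by move=> n; apply: (@Int_meas _ _ _ P); exact: Int_dist.
- apply: nearW => t; have /cvg_norm := cvg0Mr (Gam F G t) (cvg0_subl (cg (F t))).
  by rewrite normr0; apply: cvg_eq => n; rewrite mulrBl.
- by apply: IntZ; exact: Int_abs.
- move=> n; apply: nearW => t; rewrite normr_id -mulrBl normrM ler_wpM2r//.
  by rewrite (le_trans (ler_normB _ _))// lerD.
Qed.

(** The slopes that satisfy the chain rule form a monotone class, and it contains the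
    rays as limits of logistic functions. *)
Lemma chain_rule_bounded F b : DomE F -> bounded_borel b -> chain_rule F b.
Proof.
move=> DF; apply: monotone_class.
- move=> c.
  apply: (@chain_rule_lim F (fun n => logistic (n.+1%:R ^+ 2) (n.+1%:R ^+ 2 * c + n.+1%:R)) _ 1 DF).
  + by move=> n; have [] := logistic_bounded_borel (n.+1%:R ^+ 2) (n.+1%:R ^+ 2 * c + n.+1%:R).
  + by move=> n x; rewrite ger0_norm ?logistic_le1// ltW// logistic_gt0.
  + by move=> n; apply: chain_rule_logistic => //; rewrite exprn_gt0.
  + by move=> x; have := @logistic_cvg R c x; rewrite -cvg_shiftS.
- by move=> c b1 g bb1 bg; exact: chain_rule_lin.
- by move=> b_ g C mb_ bC cb cg; exact: (chain_rule_lim DF mb_ bC cb cg).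
Qed.

Lemma chain_rule_base F b a : DomE F -> bounded_borel b ->
  DomE (fun t => oriented_integral b a (F t)) /\
  forall G, DomE G -> \forall t \ae P,
    Gam (fun s => oriented_integral b a (F s)) G t = b (F t) * Gam F G t.
Proof.
move=> DF bb; have [D0 C0] := chain_rule_bounded DF bb.
pose c := oriented_integral b a 0.
have E : (fun t => oriented_integral b a (F t)) = (fun t => oriented_integral b 0 (F t) + c).
  by apply/funext => t; rewrite (@oi_chasles _ b a 0 (F t) bb) addrC.
rewrite {}E; clearbody c; split=> [|G DG]; first exact: (DomED D0 (DomE_cst c)).
have h1 := cdc_addcst c D0 DG; have h2 := C0 _ DG.
by apply: filter_app h1; apply: filterS h2 => t e1 e2; rewrite e2 e1.
Qed.

(** * Products and closability *)

(** On [-C, C] the square is a primitive of a bounded function. *)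
Lemma DomE_sqr V (C : R) : 0 <= C -> DomE V -> (forall t, `|V t| <= C) ->
  DomE (fun t => V t ^+ 2) /\
  forall G, DomE G -> \forall t \ae P, Gam (fun s => V s ^+ 2) G t = 2 * V t * Gam V G t.
Proof.
move=> C0 DV VC.
pose b x : R := 2 * Num.max (- C) (Num.min x C).
have bE x : `|x| <= C -> b x = 2 * x.
  by rewrite ler_norml => /andP[h1 h2]; rewrite /b (min_idPl h2) (max_idPr h1).
have bb : bounded_borel b.
  split; first by apply: measurable_funM => //; apply: measurable_maxr => //; exact: measurable_minr.
  exists (2 * C) => x; rewrite normrM ger0_norm// ler_wpM2l// ler_norml.
  by rewrite le_max lexx/= ge_max ge_min lexx orbT (le_trans _ C0) ?oppr_le0.
have E t : oriented_integral b 0 (V t) = V t ^+ 2.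
  have -> : oriented_integral b 0 (V t) = oriented_integral (fun y => 2 * y) 0 (V t).
    apply: eq_oi => y /=; rewrite in_itv/= => /andP[h1 h2]; apply: bE.
    have := VC t; rewrite !ler_norml => /andP[h3 h4].
    rewrite (le_trans _ h1) ?(le_trans h2)//; first by rewrite ge_max C0.
    by rewrite le_min oppr_le0 C0.
  have d2 (y : R) : is_derive y 1 (fun z : R => z * z) (2 * y).
    apply: (is_derive_eq (is_deriveM (is_derive_id y 1) (is_derive_id y 1))).
    by rewrite /GRing.scale/= mulr1 mulr_natl mulr2n.
  have c2 : continuous (fun y : R => 2 * y).
    by move=> y; apply: cvgM; [exact: cvg_cst|exact: cvg_id].
  by rewrite (oi_FTC _ _ c2 d2) mulr0 subr0 expr2.
have [DW CW] := chain_rule_bounded DV bb.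
have W : (fun t => V t ^+ 2) = fun t => oriented_integral b 0 (V t).
  by apply/funext => t; rewrite E.
rewrite W; split => // G DG; apply: filterS (CW _ DG) => t ->.
by rewrite bE.
Qed.

(** By polarization from [DomE_sqr]. *)
Lemma DomE_mul V W (C : R) : 0 <= C -> DomE V -> DomE W -> (forall t, `|V t| <= C) ->
  (forall t, `|W t| <= C) ->
  DomE (fun t => V t * W t) /\
  forall G, DomE G -> \forall t \ae P,
    Gam (fun s => V s * W s) G t = V t * Gam W G t + W t * Gam V G t.
Proof.
move=> C0 DV DW VC WC; have CC : 0 <= C + C by exact: addr_ge0.
have DS := DomE_lin 1 DV DW; have DD := DomE_lin (-1) DV DW.
have [|DS2 CS] := DomE_sqr CC DS.
  by move=> t; rewrite mul1r (le_trans (ler_normD _ _))// lerD.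
have [|DD2 CD] := DomE_sqr CC DD.
  by move=> t; rewrite mulN1r (le_trans (ler_normD _ _))// normrN lerD.
have E : (fun t => V t * W t) = (fun t => 4^-1 * (1 * V t + W t) ^+ 2 +
    (- 4^-1 * (-1 * V t + W t) ^+ 2)) by apply/funext => t; field.
have DD2' := DomEZ (- 4^-1) DD2.
rewrite E; split=> [|G DG]; first exact: DomE_lin.
apply: filter_app (cdc_linl 4^-1 DS2 DD2' DG).
have -> : (fun t => - 4^-1 * (-1 * V t + W t) ^+ 2) =
    (fun t => - 4^-1 * (-1 * V t + W t) ^+ 2 + 0) by apply/funext => t; rewrite addr0.
apply: filter_app (cdc_linl (- 4^-1) DD2 (DomE_cst 0) DG).
apply: filter_app (cdc_cstl 0 DG).
apply: filter_app (CS _ DG); apply: filter_app (CD _ DG).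
apply: filter_app (cdc_linl 1 DV DW DG).
apply: filterS (cdc_linl (-1) DV DW DG) => t e1 e2 e3 e4 e5 e6 e7.
by rewrite e7 e6 e5 e4 e3 e2 e1; field.
Qed.

Lemma energy_linl a F G H : DomE F -> DomE G -> DomE H ->
  energy P M (fun t => a * F t + G t) H = a * energy P M F H + energy P M G H.
Proof.
move=> DF DG DH; have iF := cdc_Int DF DH; have iG := cdc_Int DG DH.
rewrite -ExZ// -ExD//; last exact: IntZ.
apply: Ex_ae_eq; last exact: cdc_linl.
  by apply: Int_meas; apply: cdc_Int => //; exact: DomE_lin.
by apply: (@Int_meas _ _ _ P); apply: IntD => //; exact: IntZ.
Qed.

Lemma energyC F G : DomE F -> DomE G -> energy P M F G = energy P M G F.
Proof.
move=> DF DG; apply: Ex_ae_eq; last exact: cdcC.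
  by apply: Int_meas; exact: cdc_Int.
by apply: Int_meas; exact: cdc_Int.
Qed.

Lemma energy_young (k : R) F G : 0 < k -> DomE F -> DomE G ->
  `|energy P M F G| <= 2^-1 * (k * En F + k^-1 * En G).
Proof.
move=> k0 DF DG; apply: le_trans (cdc_L1_bound k0 DF DG).
by apply: Ex_absle; exact: cdc_Int.
Qed.

(** Split [v n] as [ramp (v n) + (v n - ramp (v n))]. The first part is bounded, so its
    pairing with [W] is an integral against [L W] and tends to 0. The second part has
    slope [s n = 1 - ramp_slope (v n)], which tends to 0 almost surely; since [v n] is
    Cauchy, it is enough to see [s n] act on a fixed [Gam (v N) W]. *)
Lemma energy_cvg0_A0 (v : nat -> T -> R) W : (forall n, DomE (v n)) ->
  (\forall t \ae P, v ^~ t @ \oo --> (0 : R)) ->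
  (forall e : R, 0 < e -> exists N, forall m n, (N <= m)%N -> (N <= n)%N ->
     En (fun t => v m t - v n t) < e) ->
  A0 W -> energy P M (v n) W @[n --> \oo] --> (0 : R).
Proof.
move=> Dv v0 Cv AW; have DW := A0_DomE AW.
pose s n t := 1 - ramp_slope (v n t).
have mv n := DomE_meas (Dv n).
have ms n : measurable_fun setT (s n).
  have [mr _] := @ramp_slope_bounded R.
  by apply: measurable_funB => //; exact: measurableT_comp.
have s1 n t : `|s n t| <= 1.
  by rewrite /s /ramp_slope indicE; case: (_ \in _); rewrite ?subrr ?normr0 ?subr0 ?normr1.
have iv n : Int (Gam (v n) W) := cdc_Int (Dv n) DW.
have is_ n X : Int X -> Int (fun t => s n t * X t).
  by apply: IntM_bdd => //; exact: nearW.
have iLW : Int (gen M W) by apply: A0_Int; exact: (gen_alg0 HM).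
have c1 : Ex (fun t => ramp (v n t) * gen M W t) @[n --> \oo] --> (0 : R).
  apply: (@Ex_dct0 _ _ _ _ _ (fun t => `|gen M W t|)).
  - move=> n; apply: measurable_funM; last exact: Int_meas iLW.
    apply: measurableT_comp => //; apply: oi_measurable.
    exact: ramp_slope_bounded.
  - apply: filterS v0 => t vt; apply: cvg0Mr.
    have /cvg_norm := vt; rewrite normr0; apply: cvg0_le => n; exact: ramp_ler.
  - exact: Int_abs.
  - by move=> n; apply: nearW => t; rewrite normrM ler_piMl// ramp_le1.
have E n : energy P M (v n) W =
    Ex (fun t => s n t * Gam (v n) W t) - Ex (fun t => ramp (v n t) * gen M W t).
  have [Dr Cr] := chain_rule_bounded (Dv n) (@ramp_slope_bounded R).
  rewrite -(energy_ibp_A0 Dr AW) -ExD; [|exact: is_|exact: cdc_Int].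
  apply: Ex_ae_eq; [exact: Int_meas (iv n)| |].
    by apply: (@Int_meas _ _ _ P); apply: IntD; [exact: is_|exact: cdc_Int].
  by apply: filterS (Cr _ DW) => t ->; rewrite /s; ring.
apply: (cvg_eq (fun n => esym (E n))).
rewrite -[X in _ --> X](subr0 (0 : R)); apply: cvgB => //.
apply: cvg0P => e e0; pose k := (En W + 1) / e; have W0 := energy_ge0 DW.
have k0 : 0 < k by rewrite divr_gt0// ltr_wpDl.
have e4 : 0 < e / 4 by rewrite divr_gt0.
have e2 : 0 < e / 2 / k by apply: divr_gt0 => //; exact: divr_gt0.
have [N HN] := Cv _ e2.
have c2 : Ex (fun t => s n t * Gam (v N) W t) @[n --> \oo] --> (0 : R).
  apply: (@Ex_dct0 _ _ _ _ _ (fun t => `|Gam (v N) W t|)).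
  - by move=> n; apply: (@Int_meas _ _ _ P); exact: is_.
  - by apply: filterS v0 => t vt; apply: cvg0Mr; exact: cvg_ramp_slope.
  - exact: Int_abs.
  - by move=> n; apply: nearW => t; rewrite normrM ler_piMl.
have [N' HN'] := cvg0_ex c2 e4.
exists (maxn N N') => n; rewrite geq_max => /andP[Nn N'n].
have DvN := DomEB (Dv n) (Dv N).
apply: (@le_trans _ _ (Ex (fun t => `|Gam (fun s => v n s - v N s) W t|) +
    `|Ex (fun t => s n t * Gam (v N) W t)|)).
  have i1 := cdc_Int DvN DW; have i2 := is_ n _ (iv N).
  have i3 : Int (fun t => s n t * Gam (fun s => v n s - v N s) W t) by exact: is_.
  have -> : Ex (fun t => s n t * Gam (v n) W t) =
      Ex (fun t => s n t * Gam (fun s => v n s - v N s) W t) +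
      Ex (fun t => s n t * Gam (v N) W t).
    rewrite -ExD//; apply: Ex_ae_eq.
    - by apply: (@Int_meas _ _ _ P); exact: is_.
    - by apply: (@Int_meas _ _ _ P); exact: IntD.
    - have := cdc_linl (-1) (Dv N) (Dv n) DW.
      rewrite (_ : (fun s => -1 * v N s + v n s) = (fun s => v n s - v N s)).
        by apply: filterS => t ->; ring.
      by apply/funext => t; ring.
  rewrite (le_trans (ler_normD _ _))// lerD2r (le_trans (Ex_absle i3))//.
  apply: Ex_le; [exact: Int_abs|exact: Int_abs|].
  by apply: nearW => t; rewrite normrM ler_piMl.
have h1 := cdc_L1_bound k0 DvN DW.
have h2 : k * En (fun t => v n t - v N t) <= e / 2.
  by rewrite mulrC -ler_pdivlMr//; apply: ltW; exact: HN.
have h3 : k^-1 * En W <= e.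
  by rewrite /k invf_div mulrAC ler_pdivrMr ?ltr_wpDl// ler_pM2l// lerDl.
have h4 := HN' n N'n.
lra.
Qed.

(** Closability for almost sure convergence. Expand
    [E(v n - v N) = E(v n) - 2 E(v n, v N) + E(v N)]: the left-hand side is small by
    the Cauchy property, and [E(v n, v N)] tends to 0 by [energy_cvg0_A0] after
    approximating [v N] from A0, the energies [E(v n)] being bounded. *)
Lemma energy_cvg0_ae (v : nat -> T -> R) : (forall n, DomE (v n)) ->
  (\forall t \ae P, v ^~ t @ \oo --> (0 : R)) ->
  (forall e : R, 0 < e -> exists N, forall m n, (N <= m)%N -> (N <= n)%N ->
     En (fun t => v m t - v n t) < e) ->
  En (v n) @[n --> \oo] --> (0 : R).
Proof.
move=> Dv v0 Cv; apply: cvg0P => e e0.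
have e4 : 0 < e / 4 by rewrite divr_gt0.
have [N HN] := Cv _ e4.
pose K := 2 * (e / 4) + 2 * En (v N).
have vN0 := energy_ge0 (Dv N).
have K0 : 0 <= K by rewrite /K; lra.
have bK n : (N <= n)%N -> En (v n) <= K.
  move=> Nn; have := energy_linD (DomEB (Dv n) (Dv N)) (Dv N).
  rewrite (_ : (fun t => v n t - v N t + v N t) = v n); last first.
    by apply/funext => t; rewrite subrK.
  by have := HN n N Nn (leqnn N); rewrite /K; lra.
pose k := e / 4 / (K + 1); have k0 : 0 < k by rewrite !divr_gt0// ltr_wpDl.
have [_ [u uN]] := Dv N; have [Au _ _] := uN.
have ke : 0 < k * (e / 4) by rewrite mulr_gt0.
have [j /(_ j (leqnn _)) Hj] := cvg0_ex (form_approx_energy (Dv N) uN) ke.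
have Duj := A0_DomE (Au j); have DNj := DomEB (Dv N) Duj.
have e16 : 0 < e / 16%:R by rewrite divr_gt0.
have [N' HN'] := cvg0_ex (energy_cvg0_A0 Dv v0 Cv (Au j)) e16.
exists (maxn N N') => n; rewrite geq_max => /andP[Nn N'n].
rewrite ger0_norm; last exact: energy_ge0.
have h1 := HN n N Nn (leqnn N).
have h2 : `|energy P M (v n) (v N)| <= e / 16%:R + 2^-1 * (k * En (v n) +
    k^-1 * En (fun t => v N t - u j t)).
  have -> : energy P M (v n) (v N) = energy P M (v n) (u j) +
      energy P M (v n) (fun t => v N t - u j t).
    rewrite !(energyC (Dv n))// -[energy _ _ (u j) _]mul1r -energy_linl//.
    by congr (energy P M _ _); apply/funext => t; ring.
  rewrite (le_trans (ler_normD _ _))// lerD//; first exact: HN'.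
  by apply: energy_young.
have h3 : k * En (v n) <= e / 4.
  rewrite /k mulrAC ler_pdivrMr ?ltr_wpDl// ler_pM2l//.
  by have := bK n Nn; lra.
have h4 : k^-1 * En (fun t => v N t - u j t) <= e / 4.
  by rewrite -(ler_pM2l k0) mulrA divff ?gt_eqF// mul1r; exact: le_trans (ler_norm _) Hj.
have h5 : En (fun t => v n t - v N t) = En (v n) - 2 * energy P M (v n) (v N) + En (v N).
  have := energy_sqr (-1) (Dv N) (Dv n).
  rewrite (_ : (fun t => -1 * v N t + v n t) = (fun t => v n t - v N t)).
    by move=> ->; rewrite (energyC (Dv N) (Dv n)); ring.
  by apply/funext => t; ring.
move: h2; rewrite ler_norml => /andP[_ h2].
move: h1; rewrite h5; lra.
Qed.

(** * The chain rule for slopes of finite energy *)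

Lemma primitive_cvg F f g a : is_primitive P F a g f -> measurable_fun setT g ->
  \forall t \ae P, oriented_integral (truncate n g) a (F t) @[n --> \oo] --> f (F t).
Proof.
move=> fE mg; apply: filterS fE => t [ig ->].
apply: (@oi_dct _ _ _ (fun y => `|g y|)) => //.
- by move=> n; exact: truncate_measurable.
- by move=> y; exact: truncate_cvg.
- exact: integrable_norm.
- by move=> n y; exact: truncate_le.
Qed.

(** When the energy that the chain rule predicts is finite, the chain rule holds:
    the truncated primitives converge almost surely and their energies converge. *)
Lemma chain_rule_unbounded F (f g : R -> R) a : DomE F -> DomE (f \o F) ->
  is_primitive P F a g f -> measurable_fun setT g ->
  Int (fun t => g (F t) ^+ 2 * Gam F F t) ->
  forall W, DomE W -> \forall t \ae P, Gam (f \o F) W t = g (F t) * Gam F W t.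
Proof.
move=> DF DfF fE mg ig2 W DW; have mF := DomE_meas DF.
pose g_ n := truncate n g; have bg n : bounded_borel (g_ n) by exact: truncate_bounded.
have mgF : measurable_fun setT (fun t => g (F t)) by exact: measurableT_comp.
have mg_F n : measurable_fun setT (fun t => g_ n (F t)).
  by apply: measurableT_comp => //; exact: truncate_measurable.
pose A n t := oriented_integral (g_ n) a (F t).
have DA n : DomE (A n) by have [] := chain_rule_base a DF (bg n).
pose v n t := f (F t) - A n t.
have Dv n : DomE (v n) by exact: DomEB.
have v0 : \forall t \ae P, v ^~ t @ \oo --> (0 : R).
  by apply: filterS (primitive_cvg fE mg) => t; exact: cvg0_subl.
pose e n := Ex (fun t => (g_ n (F t) - g (F t)) ^+ 2 * Gam F F t).
have trunc_sqr n y : (g_ n y - g y) ^+ 2 <= g y ^+ 2.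
  by rewrite /g_ /truncate; case: ifP; rewrite ?subrr ?expr0n ?sqr_ge0// sub0r sqrrN.
have iFF := cdc_Int DF DF; have FF0 := cdcFF_ge0 DF.
have ie n : Int (fun t => (g_ n (F t) - g (F t)) ^+ 2 * Gam F F t).
  apply: (Int_le _ _ ig2).
    apply: measurable_funM; last exact: Int_meas iFF.
    by apply: measurable_funX; exact: measurable_funB.
  apply: filterS FF0 => t G0; rewrite normrM (ger0_norm G0) ger0_norm ?sqr_ge0//.
  by rewrite ler_wpM2r.
have e0 : e @ \oo --> (0 : R).
  apply: (@Ex_dct0 _ _ _ _ _ (fun t => g (F t) ^+ 2 * Gam F F t)) => //.
  - by move=> n; exact: Int_meas (ie n).
  - apply: nearW => t; apply: cvg0Mr; apply: cvg0_sqr; apply: cvg0_subr.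
    exact: truncate_cvg.
  - move=> n; apply: filterS FF0 => t G0; rewrite normrM (ger0_norm G0).
    by rewrite ger0_norm ?sqr_ge0// ler_wpM2r.
have Cv (r : R) : 0 < r -> exists N, forall m n, (N <= m)%N -> (N <= n)%N ->
    En (fun t => v m t - v n t) < r.
  move=> r0; have r8 : 0 < r / 8%:R by rewrite divr_gt0.
  have [N HN] := cvg0_ex e0 r8; exists N => m n Nm Nn.
  have bmn := bounded_borel_lin (-1) (bg m) (bg n).
  have [Dmn smn] := chain_rule_base a DF bmn.
  have [imn] := slope_energy DF Dmn bmn smn.
  rewrite (_ : (fun t => oriented_integral _ a (F t)) = fun t => v m t - v n t); last first.
    by apply/funext => t; rewrite oi_lin// /v /A; ring.
  move=> ->; apply: (@le_lt_trans _ _ (2 * e m + 2 * e n)); last first.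
    have := le_trans (ler_norm _) (HN m Nm); have := le_trans (ler_norm _) (HN n Nn).
    by lra.
  rewrite /e -!ExZ// -ExD; [|exact: IntZ..].
  apply: Ex_le => //; first by apply: IntD; exact: IntZ.
  apply: filterS FF0 => t G0; rewrite !mulrA -mulrDl ler_wpM2r//.
  have := sqr_ge0 (g_ m (F t) - g (F t) + (g_ n (F t) - g (F t))).
  by lra.
have LW : L1lim P (fun n => Gam (A n) W) (Gam (f \o F) W).
  by apply: L1lim_energy => //; exact: energy_cvg0_ae Dv v0 Cv.
apply: (L1lim_ae_lim LW).
  by apply: measurable_funM => //; apply: Int_meas; exact: cdc_Int.
have /ae_foralln : forall n, \forall t \ae P, Gam (A n) W t = g_ n (F t) * Gam F W t.
  by move=> n; have [_] := chain_rule_base a DF (bg n); exact.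
apply: filterS => t Ht; under eq_fun do rewrite Ht.
by apply: cvgM; [exact: truncate_cvg|exact: cvg_cst].
Qed.

(** * The function tau and the chain rule for f_0 *)

Section density.
Variables (F : T -> R) (DF : DomE F).
Variables (p : R) (p_gt1 : 1 < p).
Hypothesis inv_moment : (\int[P]_t ((Gam F F t)%:E^-1 `^ p) < +oo)%E.
Variables (tau : R -> R) (tauE : is_condexp P F (Gam F F) tau).
Variables (f : R -> R) (a : R).
Hypothesis f_DomL : DomL P M (f \o F).
Hypothesis fE : is_primitive P F a (fun y => 1 / tau y) f.
Local Notation GF := (Gam F F).
Local Notation G0 := (f \o F).
Local Notation Z0 := (gen M G0).
Local Notation q := (fun t => (tau (F t))^-1).

Let mF : measurable_fun setT F := DomE_meas DF.
Let iGF : Int GF := cdc_Int DF DF.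
Let GF0 : \forall t \ae P, 0 <= GF t := cdcFF_ge0 DF.
Let mtau : measurable_fun setT tau. Proof. by have [] := tauE. Qed.
Let mtauV : measurable_fun setT (fun y => (tau y)^-1) := measurable_funV mtau.
Let mq : measurable_fun setT q := measurableT_comp mtauV mF.
Let itau : Int (fun t => tau (F t)). Proof. by have [] := tauE. Qed.
Let GF_gt0 : \forall t \ae P, 0 < GF t.
Proof. by have [] := inv_moment_Int (Int_meas iGF) GF0 p_gt1 inv_moment. Qed.
Let iGFV : Int (fun t => (GF t)^-1).
Proof. by have [] := inv_moment_Int (Int_meas iGF) GF0 p_gt1 inv_moment. Qed.

(** On the event [tau(F) <= 0] the conditional expectation of the positive variable
    [Gam F F] is nonpositive, so that this event is null. *)
Lemma tau_gt0 : \forall t \ae P, 0 < tau (F t).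
Proof.
pose b : R -> R := \1_([set y | tau y <= 0]).
have mb : measurable_fun setT b.
  apply: measurable_indic; rewrite (_ : [set y | _] = ~` [set y | 0 < tau y]).
    by apply: measurableC; exact: measurable_superlevel.
  by apply/seteqP; split => y /=; rewrite leNgt => /negP.
have b01 y : `|b y| <= 1.
  by rewrite /b indicE; case: (_ \in _); rewrite ?normr1 ?normr0.
have iM X : Int X -> Int (fun t => b (F t) * X t).
  apply: (@IntM_bdd _ _ _ _ _ _ 1); last exact: nearW.
  exact: measurableT_comp.
have bge0 y : 0 <= b y by rewrite /b indicE.
have := condexp_Ex tauE mF iGF mb (iM _ (IntB iGF itau)).
under [X in Ex X = _ -> _]eq_fun do rewrite mulrBr.
rewrite ExB; [|exact: iM..] => E.
have h1 : Ex (fun t => b (F t) * tau (F t)) <= 0.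
  rewrite -(Ex_cst P 0); apply: Ex_le; [exact: iM|exact: Int_cst|].
  apply: nearW => t; rewrite /b indicE; case: (boolP (F t \in _)) => [|_].
    by rewrite inE/= => ?; rewrite mul1r.
  by rewrite mul0r.
have h2 : \forall t \ae P, 0 <= b (F t) * GF t.
  by apply: filterS GF0 => t ?; rewrite mulr_ge0.
have h3 := Ex_ge0 (iM _ iGF) h2.
have : Ex (fun t => b (F t) * GF t) = 0 by lra.
move/(Ex_eq0 (iM _ iGF) h2) => h4.
apply: filter_app GF_gt0; apply: filterS h4 => t /eqP; rewrite mulf_eq0 => /orP[].
  rewrite /b indicE; case: (boolP (_ \in _)) => [_ /=|tF _ _]; first by rewrite oner_eq0.
  by rewrite ltNge; apply: contra tF => tF; rewrite inE.
by move=> /eqP ->; rewrite ltxx.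
Qed.

(** [1 / Gamma >= 2 / tau - Gamma / tau ^ 2], the tangent line of the inverse at
    [tau], and the right-hand side has the expectation of [1 / tau]. *)
Lemma Int_tauV : Int q.
Proof.
pose w y : R := `|(tau y)^-1|.
have mw : measurable_fun setT w by exact: measurableT_comp.
have i1 : Int (fun t => w (F t) * 1).
  apply: (@Int_of_truncate _ _ _ _ _ _ _ (Ex (fun t => (GF t)^-1))) => //.
  - exact: Int_cst.
  - exact: nearW.
  - by move=> x; exact: normr_ge0.
  - move=> n; pose b := truncate n w; have [mb [C bC]] := truncate_bounded n mw.
    have iM k X : Int X -> Int (fun t => b (F t) ^+ k * X t).
      apply: (@IntM_bdd _ _ _ _ _ _ (C ^+ k)).
        by apply: measurable_funX; exact: measurableT_comp.
      apply: nearW => t; rewrite normrX lerXn2r ?nnegrE//.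
      exact: le_trans (bC 0).
    have mb2 : measurable_fun setT (fun y => b y ^+ 2) by exact: measurable_funX.
    have := condexp_Ex tauE mF iGF mb2 (iM 2%N _ (IntB iGF itau)).
    under [X in Ex X = _ -> _]eq_fun do rewrite mulrBr.
    rewrite ExB; [|exact: iM..] => E.
    have i1 : Int (fun t => b (F t) * 1) by have := iM 1%N _ (Int_cst P 1); under eq_fun do rewrite expr1.
    have e1 : Ex (fun t => b (F t) ^+ 2 * tau (F t)) = Ex (fun t => b (F t) * 1).
      apply: Ex_ae_eq; [exact: Int_meas (iM _ _ itau)|exact: Int_meas i1|].
      apply: filterS tau_gt0 => t t0; rewrite /b /truncate; case: ifP => _.
        by rewrite /w gtr0_norm ?invr_gt0// expr2 -mulrA mulVf ?gt_eqF.
      by rewrite expr0n/= !mul0r.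
    have : Ex (fun t => 2 * (b (F t) * 1) - b (F t) ^+ 2 * GF t) <= Ex (fun t => (GF t)^-1).
      apply: Ex_le => //; first by apply: IntB; [exact: IntZ|exact: iM].
      apply: filterS GF_gt0 => t t0; rewrite -(ler_pM2r t0) mulVf ?gt_eqF//.
      have := sqr_ge0 (b (F t) * GF t - 1); lra.
    rewrite ExB; [|exact: IntZ|exact: iM].
    by rewrite ExZ//; lra.
apply: (Int_ae_eq i1 mq).
by apply: filterS tau_gt0 => t t0; rewrite mulr1 /w gtr0_norm// invr_gt0.
Qed.

Let tau_q : \forall t \ae P, q t * tau (F t) = 1.
Proof. by apply: filterS tau_gt0 => t t0; rewrite mulVf// gt_eqF. Qed.

(** [Gam F F / tau(F)] has conditional expectation 1. *)
Lemma Int_GF_q : Int (fun t => q t * GF t).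
Proof.
pose w y : R := `|(tau y)^-1|.
have mw : measurable_fun setT w by exact: measurableT_comp.
have [||iw _] := condexp_ge0 (w := w) tauE mF iGF GF0 mw.
- by move=> x; exact: normr_ge0.
- apply: (Int_ae_eq (Int_cst P 1)).
    by apply: measurable_funM; [exact: measurableT_comp|exact: Int_meas itau].
  by apply: filterS tau_gt0 => t t0; rewrite /w gtr0_norm ?invr_gt0// mulVf// gt_eqF.
apply: (Int_ae_eq iw (measurable_funM mq (Int_meas iGF))).
by apply: filterS tau_gt0 => t t0; rewrite /w gtr0_norm ?invr_gt0.
Qed.

Let DG0 : DomE G0. Proof. by have [] := f_DomL. Qed.

(** Here the energy predicted for [f(F)], [E[Gam F F / tau(F) ^ 2]], equals
    [E[1 / tau(F)]] and is finite by [Int_tauV]. *)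
Lemma cdc_G0 W : DomE W -> \forall t \ae P, Gam G0 W t = q t * Gam F W t.
Proof.
move=> DW; pose g y : R := 1 / tau y.
have mg : measurable_fun setT g by apply: measurable_funM.
have [|||i2 _] := condexp_ge0 (w := fun y => g y ^+ 2) tauE mF iGF GF0.
- exact: measurable_funX.
- by move=> x; exact: sqr_ge0.
- apply: (Int_ae_eq Int_tauV).
    by apply: measurable_funM; [apply: measurable_funX; exact: measurableT_comp|exact: Int_meas itau].
  by apply: filterS tau_gt0 => t t0; rewrite /g div1r expr2 -mulrA mulVf ?mulr1// gt_eqF.
apply: filterS (chain_rule_unbounded DF DG0 fE mg i2 DW) => t ->.
by rewrite /g div1r.
Qed.

Let lZ0 : L2 Z0. Proof. by apply/LfunL2; exact: (gen_DomL_L2 HM). Qed.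
Let iZ0 : Int Z0 := L2_Int lZ0.

Lemma Ex_primitive_G0 b c : bounded_borel b ->
  Ex (fun t => oriented_integral b c (F t) * Z0 t) = - Ex (fun t => b (F t) * (q t * GF t)).
Proof.
move=> bb; have [Db Cb] := chain_rule_base c DF bb; have [mb [C bC]] := bb.
have := gen_DomL_ibp HM f_DomL Db; rewrite -/(Ex _) => ->; congr (- _).
apply: Ex_ae_eq; first by apply: Int_meas; exact: cdc_Int.
  apply: (@Int_meas _ _ _ P); apply: (@IntM_bdd _ _ _ _ _ _ C); last exact: Int_GF_q.
    exact: measurableT_comp.
  exact: nearW.
apply: filter_app (cdc_G0 Db); apply: filter_app (cdcC DF Db).
by apply: filterS (Cb _ DF) => t e1 e2 ->; rewrite e2 e1; ring.
Qed.

(** The weight [Gam F F / tau(F)] of [Ex_primitive_G0] averages to 1 given [F]. *)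
Lemma Ex_primitive_density b c : bounded_borel b ->
  Ex (fun t => oriented_integral b c (F t) * Z0 t) = - Ex (fun t => b (F t)).
Proof.
move=> bb; rewrite Ex_primitive_G0//; congr (- _); have [mb [C bC]] := bb.
have iM X : Int X -> Int (fun t => b (F t) * X t).
  by apply: IntM_bdd; [exact: measurableT_comp|apply: nearW => t; exact: bC].
have mw : measurable_fun setT (fun y => b y * (tau y)^-1) by exact: measurable_funM.
have e : (fun t => b (F t) * q t * (GF t - tau (F t))) =
    fun t => b (F t) * (q t * GF t) - b (F t) * (q t * tau (F t)).
  by apply/funext => t; ring.
have iqt : Int (fun t => q t * tau (F t)).
  apply: (Int_ae_eq (Int_cst P 1) (measurable_funM mq (Int_meas itau))).
  by apply: filterS tau_q => t /= ->.
have := condexp_Ex tauE mF iGF mw; rewrite e => /(_ (IntB (iM _ Int_GF_q) (iM _ iqt))).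
rewrite ExB; [|exact: iM Int_GF_q|exact: iM iqt] => /eqP; rewrite subr_eq0 => /eqP ->.
apply: Ex_ae_eq; first exact: Int_meas (iM _ iqt).
  exact: measurableT_comp.
by apply: filterS tau_q => t ->; rewrite mulr1.
Qed.

(** By [Ex_primitive_density] the mass of an interval is at most its length times
    [E|L f_0(F)|]. *)
Lemma law_atomless c : \forall t \ae P, F t != c.
Proof.
have mi n : bounded_borel (\1_(`[c, c + n.+1%:R^-1[%classic) : R -> R).
  by apply: bounded_borel_indic; exact: measurable_itv.
have m1 : measurable [set t | F t = c].
  by rewrite -[X in measurable X]setTI; apply: (mF measurableT (Y := [set c])); exact: measurable_set1.
pose u t : R := \1_([set t | F t = c]) t.
have iu : Int u.
  apply: (@Int_bdd _ _ _ _ _ 1); first exact: measurable_indic.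
  by apply: nearW => t; rewrite /u indicE; case: (_ \in _); rewrite ?normr1 ?normr0.
have : \forall t \ae P, u t = 0.
  apply: (@ae_eq0_of_small _ _ _ _ u (fun n => n.+1%:R^-1 * Ex (fun t => `|Z0 t|))) => //.
  - by apply: nearW => t; rewrite /u indicE.
  - move=> n; have cn : c <= c + n.+1%:R^-1 by rewrite lerDl invr_ge0.
    have [mb [C bC]] := mi n.
    apply: (@le_trans _ _ (Ex (fun t => \1_(`[c, c + n.+1%:R^-1[%classic) (F t)))).
      apply: Ex_le => //.
        apply: (@Int_bdd _ _ _ _ _ C); first exact: measurableT_comp.
        exact: nearW.
      apply: nearW => t; rewrite /u !indicE ler_nat; case: (boolP (t \in _)) => //.
      by rewrite inE/= => ->; rewrite mem_set//= in_itv/= lexx ltrDl invr_gt0 ltr0n.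
    rewrite -[leLHS]opprK -(Ex_primitive_density c (mi n)).
    have lb : L2 (fun t => oriented_integral \1_(`[c, c + n.+1%:R^-1[%classic) c (F t)).
      by apply: DomE_L2; have [] := chain_rule_base c DF (mi n).
    have iZ := L2M lb lZ0.
    apply: (le_trans (ler_norm _)); rewrite normrN; apply: (le_trans (Ex_absle iZ)).
    rewrite -ExZ; last exact: Int_abs.
    apply: Ex_le; [exact: Int_abs|by apply: IntZ; exact: Int_abs|].
    apply: nearW => t; rewrite normrM ler_wpM2r//.
    have i0 : 0 <= n.+1%:R^-1 :> R by rewrite invr_ge0.
    rewrite oi_indic//; case: ifPn => [_|]; first by rewrite normr0.
    rewrite -ltNge => cF; case: ifPn => [Fc|_].
      by rewrite gtr0_norm ?subr_gt0// lerBlDl.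
    by rewrite addrAC subrr add0r ger0_norm.
  - exact: (cvg0Mr _ (@cvg_harmonic R)).
apply: filterS => t; rewrite /u indicE => /eqP; apply: contraTN => /eqP Fc.
by rewrite mem_set// oner_eq0.
Qed.

(** * Test functions of F *)

(** Bounded test functions of [F], recorded with their slopes: products are then
    covered by the Leibniz rule for [Gam], without one for primitives. *)
Definition slope (psi psi' : R -> R) : Prop :=
  [/\ bounded_borel psi, bounded_borel psi', DomE (fun t => psi (F t)) &
      forall G, DomE G -> \forall t \ae P,
        Gam (fun s => psi (F s)) G t = psi' (F t) * Gam F G t].

Lemma slope_mul psi psi' phi phi' : slope psi psi' -> slope phi phi' ->
  slope (fun y => psi y * phi y) (fun y => psi y * phi' y + phi y * psi' y).
Proof.
move=> [bpsi bpsi' Dpsi Spsi] [bphi bphi' Dphi Sphi].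
have [_ [C1 psiC]] := bpsi; have [_ [C2 phiC]] := bphi.
have C10 : 0 <= C1 := le_trans (normr_ge0 _) (psiC 0).
have C20 : 0 <= C2 := le_trans (normr_ge0 _) (phiC 0).
have [||D S] := DomE_mul (addr_ge0 C10 C20) Dpsi Dphi.
- by move=> t; rewrite (le_trans (psiC _))// lerDl.
- by move=> t; rewrite (le_trans (phiC _))// lerDr.
split => //.
- exact: bounded_borelM.
- have := bounded_borel_lin 1 (bounded_borelM bpsi bphi') (bounded_borelM bphi bpsi').
  by under eq_fun do rewrite mul1r.
- move=> G DG; apply: filter_app (S _ DG); apply: filter_app (Spsi _ DG).
  by apply: filterS (Sphi _ DG) => t -> -> ->; ring.
Qed.

Lemma slope_lin c psi psi' phi phi' : slope psi psi' -> slope phi phi' ->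
  slope (fun y => c * psi y + phi y) (fun y => c * psi' y + phi' y).
Proof.
move=> [bpsi bpsi' Dpsi Spsi] [bphi bphi' Dphi Sphi]; split.
- exact: bounded_borel_lin.
- exact: bounded_borel_lin.
- exact: DomE_lin.
- move=> G DG; apply: filter_app (cdc_linl c Dpsi Dphi DG).
  apply: filter_app (Spsi _ DG).
  by apply: filterS (Sphi _ DG) => t -> -> ->; ring.
Qed.

Lemma slope_cst c : slope (fun=> c) (fun=> 0).
Proof.
split; [exact: bounded_borel_cst|exact: bounded_borel_cst|exact: DomE_cst|].
by move=> G DG; apply: filterS (cdc_cstl c DG) => t ->; rewrite mul0r.
Qed.

Lemma slope_indic x y : x <= y ->
  slope (oriented_integral \1_(`[x, y[%classic) x) \1_(`[x, y[%classic).
Proof.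
move=> xy; have bi : bounded_borel (\1_(`[x, y[%classic) : R -> R).
  by apply: bounded_borel_indic; exact: measurable_itv.
have [D S] := chain_rule_base x DF bi; split => //.
split; first exact: oi_measurable.
exists (y - x) => z; rewrite oi_indic//; case: (leP z x) => xz.
  by rewrite normr0 subr_ge0.
case: (leP z y) => zy; last by rewrite ger0_norm// subr_ge0.
by rewrite gtr0_norm ?subr_gt0// lerB.
Qed.

(** * The iterated functions f_k *)

Section iterate.
Variables (h fk : R -> R).
Hypothesis DG : DomE (fk \o F).
Hypothesis fkE : is_primitive P F a (fun y => h y / tau y) fk.
Hypotheses (mh : measurable_fun setT h) (ih : Int (fun t => h (F t))).
Local Notation G := (fk \o F).
Let g y : R := h y / tau y.
(* [X1] and [X2] are Gamma(f_0(F), F) and Gamma(f_0(F), f_k(F)), by [cdc_G0]. *)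
Local Notation X1 := (fun t => q t * GF t).
Local Notation X2 := (fun t => q t * Gam F G t).

Let mg : measurable_fun setT g.
Proof. by apply: measurable_funM. Qed.

Let mgF : measurable_fun setT (fun t => g (F t)) := measurableT_comp mg mF.

Let iX2 : Int X2.
Proof.
apply: (Int_ae_eq (cdc_Int DG0 DG)); last exact: cdc_G0.
by apply: measurable_funM => //; apply: Int_meas; exact: cdc_Int.
Qed.

(** Pair [ramp (G - A n) psi(F)] with the generator at [f_0(F)], where [A n] is the
    primitive of the truncated [g], which obeys the chain rule. Almost surely
    [G - A n] tends to 0, so that the ramp tends to 0 while its slope tends to 1: in
    the limit the integration by parts reads [0 = E[psi(F) (X2 - g(F) X1)]]. *)
Lemma slope_identity psi psi' : slope psi psi' ->
  Int (fun t => psi (F t) * (g (F t) * X1 t)) ->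
  Ex (fun t => psi (F t) * X2 t) = Ex (fun t => psi (F t) * (g (F t) * X1 t)).
Proof.
move=> [bpsi bpsi' Dpsi Spsi] ipsi.
have [mpsi [C psiC]] := bpsi; have [mpsi' [C' psi'C]] := bpsi'.
have C0 : 0 <= C := le_trans (normr_ge0 _) (psiC 0).
pose g_ n := truncate n g; have bg n : bounded_borel (g_ n) by exact: truncate_bounded.
have mg_F n : measurable_fun setT (fun t => g_ n (F t)).
  by apply: measurableT_comp => //; exact: truncate_measurable.
pose A n t := oriented_integral (g_ n) a (F t).
pose H n t := fk (F t) - A n t.
have DA n : DomE (A n) by have [] := chain_rule_base a DF (bg n).
have SA n W : DomE W -> \forall t \ae P, Gam (A n) W t = g_ n (F t) * Gam F W t.
  by have [_] := chain_rule_base a DF (bg n); exact.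
have DH n : DomE (H n) by exact: DomEB.
have mH n := DomE_meas (DH n).
have H0 : \forall t \ae P, H ^~ t @ \oo --> (0 : R).
  by apply: filterS (primitive_cvg fkE mg) => t; exact: cvg0_subl.
have rbb := @ramp_slope_bounded R.
have Dr n : DomE (fun t => ramp (H n t)) by have [] := chain_rule_bounded (DH n) rbb.
have Sr n W : DomE W -> \forall t \ae P,
    Gam (fun s => ramp (H n s)) W t = ramp_slope (H n t) * Gam (H n) W t.
  by have [_] := chain_rule_bounded (DH n) rbb; exact.
have mrs n : measurable_fun setT (fun t => ramp_slope (H n t)).
  by have [mr _] := rbb; exact: measurableT_comp.
have mr n : measurable_fun setT (fun t => ramp (H n t)) := DomE_meas (Dr n).
have rs1 y : `|@ramp_slope R y| <= 1.
  by rewrite /ramp_slope indicE; case: (_ \in _); rewrite ?normr1 ?normr0.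
pose W n t := ramp (H n t) * psi (F t).
have [DW SW] : (forall n, DomE (W n)) /\ forall n V, DomE V -> \forall t \ae P,
    Gam (W n) V t = ramp (H n t) * Gam (fun s => psi (F s)) V t +
       psi (F t) * Gam (fun s => ramp (H n s)) V t.
  have rC n t : `|ramp (H n t)| <= C + 1 by rewrite (le_trans (ramp_le1 _))// lerDr.
  have pC t : `|psi (F t)| <= C + 1 by rewrite (le_trans (psiC _))// lerDl.
  have C1 : 0 <= C + 1 by rewrite addr_ge0.
  by split=> n; have [] := DomE_mul C1 (Dr n) Dpsi (rC n) pC.
(* The integration by parts for [W n], gathered under one expectation. *)
pose S n t := W n t * Z0 t + ramp (H n t) * psi' (F t) * X1 t +
  ramp_slope (H n t) * psi (F t) * X2 t -
  ramp_slope (H n t) * psi (F t) * (g_ n (F t) * X1 t).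
have mX1 := Int_meas Int_GF_q; have mX2 := Int_meas iX2.
have mpF : measurable_fun setT (fun t => psi (F t)) by exact: measurableT_comp.
have mp'F : measurable_fun setT (fun t => psi' (F t)) by exact: measurableT_comp.
have mS n : measurable_fun setT (S n).
  apply: measurable_funB.
    apply: measurable_funD.
      apply: measurable_funD; first by apply: measurable_funM; [exact: DomE_meas|exact: Int_meas iZ0].
      by apply: measurable_funM => //; exact: measurable_funM.
    by apply: measurable_funM => //; exact: measurable_funM.
  by apply: measurable_funM; exact: measurable_funM.
pose dom t := C * `|Z0 t| + C' * `|X1 t| + C * `|X2 t| + `|psi (F t) * (g (F t) * X1 t)|.
have idom : Int dom.
  apply: IntD; last exact: Int_abs.
  apply: IntD; last by apply: IntZ; exact: Int_abs.
  by apply: IntD; apply: IntZ; apply: Int_abs => //; exact: Int_GF_q.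
have Sdom n t : `|S n t| <= dom t.
  rewrite /S /dom; apply: (le_trans (ler_normB _ _)); rewrite lerD//; last first.
    rewrite -mulrA normrM -[leRHS]mul1r; apply: ler_pM => //.
    rewrite !(normrM (psi _)) !(normrM _ (X1 t)); apply: ler_wpM2l => //.
    by apply: ler_wpM2r => //; exact: truncate_le.
  apply: (le_trans (ler_normD _ _)); rewrite lerD//; last first.
    by rewrite normrM ler_wpM2r// normrM -[leRHS]mul1r ler_pM.
  apply: (le_trans (ler_normD _ _)); rewrite lerD//.
    by rewrite normrM ler_wpM2r// normrM -[leRHS]mul1r ler_pM// ramp_le1.
  by rewrite normrM ler_wpM2r// normrM -[leRHS]mul1r ler_pM// ramp_le1.
have Slim : \forall t \ae P, S ^~ t @ \oo --> psi (F t) * X2 t - psi (F t) * (g (F t) * X1 t).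
  apply: filterS H0 => t Ht.
  have hr : ramp (H n t) @[n --> \oo] --> (0 : R).
    by move/cvg_norm : Ht; rewrite normr0; apply: cvg0_le => n; exact: ramp_ler.
  have hs : ramp_slope (H n t) @[n --> \oo] --> (1 : R).
    apply/subr_cvg0; move: (cvg_ramp_slope Ht) => /cvgN; rewrite oppr0.
    by apply: cvg_eq => n /=; rewrite opprB.
  have c1 : W n t * Z0 t @[n --> \oo] --> (0 : R) by exact: (cvg0Mr _ (cvg0Mr _ hr)).
  have c2 : ramp (H n t) * psi' (F t) * X1 t @[n --> \oo] --> (0 : R).
    exact: (cvg0Mr _ (cvg0Mr _ hr)).
  have c3 : ramp_slope (H n t) * psi (F t) * X2 t @[n --> \oo] --> psi (F t) * X2 t.
    rewrite -[psi (F t) in X in _ --> X]mul1r.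
    by apply: cvgM; [apply: cvgM => //; exact: cvg_cst|exact: cvg_cst].
  have c4 : ramp_slope (H n t) * psi (F t) * (g_ n (F t) * X1 t) @[n --> \oo] -->
      psi (F t) * (g (F t) * X1 t).
    rewrite -[psi (F t) in X in _ --> X]mul1r.
    apply: cvgM; first by apply: cvgM => //; exact: cvg_cst.
    by apply: cvgM; [exact: truncate_cvg|exact: cvg_cst].
  rewrite -[psi (F t) * X2 t]add0r.
  exact: (cvgB (cvgD (cvg0D c1 c2) c3) c4).
have iWZ n : Int (fun t => W n t * Z0 t) by exact: L2M (DomE_L2 (DW n)) lZ0.
have i2 n : Int (fun t => ramp (H n t) * psi' (F t) * X1 t).
  apply: (@IntM_bdd _ _ _ _ _ _ C'); last exact: Int_GF_q.
    exact: measurable_funM.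
  by apply: nearW => t; rewrite normrM -[leRHS]mul1r ler_pM// ramp_le1.
have brs n t : `|ramp_slope (H n t) * psi (F t)| <= C.
  by rewrite normrM -[leRHS]mul1r ler_pM.
have i3 n : Int (fun t => ramp_slope (H n t) * psi (F t) * X2 t).
  apply: (@IntM_bdd _ _ _ _ _ _ C) => //; first exact: measurable_funM.
  exact: nearW.
have i4 n : Int (fun t => ramp_slope (H n t) * psi (F t) * (g_ n (F t) * X1 t)).
  apply: (@IntM_bdd _ _ _ _ _ _ C); [exact: measurable_funM|exact: nearW|].
  have [_ [D gD]] := bg n.
  apply: (@IntM_bdd _ _ _ _ _ _ D) => //; [exact: nearW|exact: Int_GF_q].
have ES n : Ex (S n) = 0.
  rewrite ExB; [|by apply: IntD => //; exact: IntD|exact: i4].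
  rewrite ExD; [|exact: IntD|exact: i3].
  rewrite ExD; [|exact: iWZ|exact: i2].
  have := gen_DomL_ibp HM f_DomL (DW n); rewrite -/(Ex _) => ->.
  suff -> : energy P M G0 (W n) = Ex (fun t => ramp (H n t) * psi' (F t) * X1 t) +
      Ex (fun t => ramp_slope (H n t) * psi (F t) * X2 t) -
      Ex (fun t => ramp_slope (H n t) * psi (F t) * (g_ n (F t) * X1 t)) by ring.
  rewrite -ExD// -ExB//; last exact: IntD.
  apply: Ex_ae_eq; first by apply: Int_meas; exact: cdc_Int.
    by apply: (@Int_meas _ _ _ P); apply: IntB => //; exact: IntD.
  apply: filter_app (cdc_G0 (DW n)); apply: filter_app (cdcC DF (DW n)).
  apply: filter_app (SW n _ DF); apply: filter_app (Spsi _ DF).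
  apply: filter_app (Sr n _ DF).
  have HE : H n = fun s => -1 * A n s + fk (F s) by apply/funext => s; rewrite /H mulN1r addrC.
  have := cdc_linl (-1) (DA n) DG DF; rewrite -HE => lin.
  apply: filter_app lin; apply: filter_app (cdcC DF DG).
  by apply: filterS (SA n _ DF) => t -> -> -> -> -> -> -> ->; ring.
have [||_ _ _ lim] := @Ex_dct _ _ _ P S
   (fun t => psi (F t) * X2 t - psi (F t) * (g (F t) * X1 t)) dom mS _ Slim idom.
- apply: measurable_funB; first exact: measurable_funM.
  exact: Int_meas ipsi.
- by move=> n; apply: nearW => t; exact: Sdom.
have E0 : Ex (fun t => psi (F t) * X2 t - psi (F t) * (g (F t) * X1 t)) = 0.
  apply: (cvg_unique (@norm_hausdorff _ _) lim).
  by apply: cvg_near_cst; apply: nearW => n; rewrite ES.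
move: E0; rewrite ExB// => [/eqP|]; first by rewrite subr_eq0 => /eqP.
by apply: (@IntM_bdd _ _ _ _ _ _ C) => //; exact: nearW.
Qed.

Let q_gt0 : \forall t \ae P, 0 < q t.
Proof. by apply: filterS tau_gt0 => t; rewrite invr_gt0. Qed.

(** Testing the generator at [f_0(F)] against primitives of truncations of [|g|]:
    these are bounded by the integral of [|g|], whatever the truncation. *)
Lemma Int_local al be : lebesgue_measure.-integrable `[al, be] (EFin \o g) ->
  Int (fun t => \1_(`[al, be[%classic) (F t) * (g (F t) * X1 t)).
Proof.
move=> ig; pose w y : R := \1_(`[al, be[%classic) y * `|g y|.
have mw : measurable_fun setT w.
  by apply: measurable_funM; [exact: measurable_indic|exact: measurableT_comp].
have w0 x : 0 <= w x by rewrite /w indicE mulr_ge0.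
have X10 : \forall t \ae P, 0 <= X1 t.
  by apply: filter_app GF0; apply: filterS q_gt0 => t ? ?; rewrite mulr_ge0// ltW.
pose K := \int[lebesgue_measure]_(y in `[al, be]) `|g y|.
have Kb n x : `|oriented_integral (truncate n w) al x| <= K.
  have ib := bounded_borel_integrable (Num.min al x) (Num.max al x) (truncate_bounded n mw).
  apply: (le_trans (oi_abs_le ib)).
  apply: fine_le.
  - by apply: integrable_fin_num => //; exact: (integrable_norm ib).
  - by apply: integrable_fin_num => //; exact: (integrable_norm ig).
  have mtw : measurable_fun setT (fun y => `|truncate n w y|%:E).
    apply/measurable_EFinP; apply: measurableT_comp => //.
    exact: truncate_measurable.
  apply: (@le_trans _ _ (\int[lebesgue_measure]_y `|truncate n w y|%:E)%E).
    by apply: ge0_subset_integral.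
  rewrite [leRHS]integral_mkcond; apply: ge0_le_integral => //.
  - apply/(measurable_restrictT _ _).1 => //; apply/measurable_EFinP.
    by apply: measurable_funTS; exact: measurableT_comp.
  - move=> y _; rewrite /restrict; apply: (@le_trans _ _ (w y)%:E).
      by rewrite lee_fin -[leRHS]ger0_norm//; exact: truncate_le.
    rewrite /w indicE; case: (boolP (y \in `[al, be[%classic)) => [|_].
      rewrite inE/= in_itv/= => /andP[h1 h2]; rewrite mem_set ?mul1r//=.
      by rewrite in_itv/= h1 ltW.
    by rewrite mul0r; case: ifP => _; [rewrite lee_fin|exact: lexx].
have iw : Int (fun t => w (F t) * X1 t).
  apply: (@Int_of_truncate _ _ _ _ _ _ _ (K * Ex (fun t => `|Z0 t|))) => //.
    exact: Int_GF_q.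
  move=> n; have bn := truncate_bounded n mw.
  rewrite -[leLHS]opprK -(Ex_primitive_G0 al bn).
  have lb : L2 (fun t => oriented_integral (truncate n w) al (F t)).
    by apply: DomE_L2; have [] := chain_rule_base al DF bn.
  have iZ := L2M lb lZ0.
  apply: (le_trans (ler_norm _)); rewrite normrN; apply: (le_trans (Ex_absle iZ)).
  rewrite -ExZ; last exact: Int_abs.
  apply: Ex_le; [exact: Int_abs|by apply: IntZ; exact: Int_abs|].
  by apply: nearW => t; rewrite normrM ler_wpM2r.
apply: (Int_le _ _ iw).
  apply: measurable_funM; first by apply: measurableT_comp => //; exact: measurable_indic.
  by apply: measurable_funM => //; exact: Int_meas Int_GF_q.
apply: filterS X10 => t X1t; rewrite normrM (normrM (g _)) (ger0_norm X1t) /w mulrA.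
by rewrite indicE ger0_norm.
Qed.

Lemma Int_g_GF : Int (fun t => g (F t) * GF t).
Proof.
have [|||iw _] := condexp_ge0 (w := fun y => `|g y|) tauE mF iGF GF0.
- exact: measurableT_comp.
- by move=> x; exact: normr_ge0.
- apply: (Int_ae_eq (Int_abs ih)).
    by apply: measurable_funM; [exact: measurableT_comp|exact: Int_meas itau].
  apply: filterS tau_gt0 => t t0; rewrite /g normrM -{2}(gtr0_norm t0) -mulrA -normrM.
  by rewrite mulVf ?normr1 ?mulr1// gt_eqF.
apply: (Int_le _ _ iw); first by apply: measurable_funM => //; exact: Int_meas iGF.
by apply: filterS GF0 => t GFt; rewrite normrM (ger0_norm GFt).
Qed.

(** Take [psi = kappa * steep_ramp j x] in [slope_identity], with [kappa] a bump that
    vanishes outside the interval: [Int_local] provides the integrability that is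
    needed. As [j] grows, [kappa(F) (X2 - g(F) X1)] has integral 0 over every [x < F],
    hence against every function of [F], and [v tau / kappa] is the one that gives the
    claim. *)
Lemma local_null (al be : R) (v : R -> R) : al <= be ->
  lebesgue_measure.-integrable `[al, be] (EFin \o g) -> bounded_borel v ->
  Ex (fun t => \1_(`]al, be[%classic) (F t) * (v (F t) * (Gam F G t - g (F t) * GF t))) = 0.
Proof.
move=> ab ig [mv [Cv vC]].
pose r := oriented_integral \1_(`[al, be[%classic) al.
(* The product of the distances to the endpoints, inside the interval. *)
pose kap y := r y * (be - al - r y).
have rE y : r y = if y <= al then 0 else if y <= be then y - al else be - al.
  by rewrite /r oi_indic.
have kapP y : (al < y < be)%R = (0 < kap y)%R.
  rewrite /kap rE; case: (leP y al) => h0; first by rewrite mul0r ltxx.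
  case: (leP y be) => h2 /=; last by rewrite subrr mulr0 ltxx ltNge (ltW h2).
  case: (ltP y be) => h3; first by rewrite mulr_gt0//; lra.
  by rewrite (_ : y = be) ?subrr ?mulr0 ?ltxx//; lra.
have kap0 y : 0 <= kap y.
  rewrite /kap rE; case: (leP y al) => h0; first by rewrite mul0r.
  by case: (leP y be) => h2; rewrite mulr_ge0; lra.
have kapC y : kap y <= (be - al) ^+ 2 * \1_(`[al, be[%classic) y.
  rewrite indicE; case: (boolP (y \in _)) => [|]; rewrite ?inE/= ?in_itv/=.
    move=> /andP[h1 h2]; rewrite mulr1 /kap rE; case: (leP y al) => h0; first by rewrite mul0r sqr_ge0.
    by rewrite (ltW h2) expr2 ler_pM//; lra.
  move=> /negP yI; rewrite mulr0 leNgt -kapP; apply/negP => /andP[h1 h2].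
  by apply: yI; rewrite inE/= in_itv/= h2 ltW.
have sr : slope r \1_(`[al, be[%classic) := slope_indic ab.
have [dk sk] : exists dk, slope kap dk.
  have := slope_mul sr (slope_lin (-1) sr (slope_cst (be - al))).
  rewrite (_ : (fun y => r y * _) = kap) => [|]; first by eexists; eassumption.
  by apply/funext => y; rewrite /kap; ring.
have mkap : measurable_fun setT kap by have [[]] := sk.
pose rho (j : nat) (x y : R) : R := steep_ramp j x y.
have srho j x : exists d0, slope (rho j x) d0.
  have xj : x <= x + j.+1%:R^-1 by rewrite lerDl invr_ge0.
  have := slope_lin j.+1%:R (slope_indic xj) (slope_cst 0).
  by under [X in slope X]eq_fun do rewrite addr0; eexists; eassumption.
have rho01 j x y : 0 <= rho j x y <= 1 := steep_ramp01 j x y.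
have rho_cvg x y : rho j x y @[j --> \oo] --> (\1_(`]x, +oo[%classic) y : R).
  exact: steep_ramp_cvg.
have mkF : measurable_fun setT (fun t => kap (F t)) by exact: measurableT_comp.
have kC y : `|kap y| <= (be - al) ^+ 2.
  rewrite ger0_norm// (le_trans (kapC y))// indicE.
  by case: (_ \in _); rewrite ?mulr1// mulr0 sqr_ge0.
pose Y t := X2 t - g (F t) * X1 t.
have ikX2 : Int (fun t => kap (F t) * X2 t).
  by apply: (@IntM_bdd _ _ _ _ _ _ ((be - al) ^+ 2)) => //; exact: nearW.
have mgX1 : measurable_fun setT (fun t => g (F t) * X1 t).
  by apply: measurable_funM => //; exact: Int_meas Int_GF_q.
have ikgX1 : Int (fun t => kap (F t) * (g (F t) * X1 t)).
  apply: (Int_le _ _ (IntZ ((be - al) ^+ 2) (Int_abs (Int_local ig)))).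
    exact: measurable_funM.
  apply: nearW => t; move: (g (F t) * X1 t) => z; rewrite (normrM (kap _)) (normrM _ z) mulrA ler_wpM2r//.
  by rewrite ger0_norm// (le_trans (kapC _))// ler_wpM2l ?sqr_ge0// ler_norm.
have ikY : Int (fun t => kap (F t) * Y t).
  by rewrite /Y; under eq_fun do rewrite mulrBr; exact: IntB.
have ray x : Ex (fun t => \1_(`]x, +oo[%classic) (F t) * (kap (F t) * Y t)) = 0.
  have mrF j : measurable_fun setT (fun t => rho j x (F t)).
    by have [d0 [[m0 _] _ _ _]] := srho j x; exact: measurableT_comp.
  have rn j t : `|rho j x (F t)| <= 1.
    by have /andP[? ?] := rho01 j x (F t); rewrite ger0_norm.
  have E0 j : Ex (fun t => rho j x (F t) * (kap (F t) * Y t)) = 0.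
    have [d0 s0] := srho j x.
    have iM X : Int X -> Int (fun t => rho j x (F t) * X t).
      by apply: (@IntM_bdd _ _ _ _ _ _ 1) => //; exact: nearW.
    have e1 (X : T -> R) : (fun t => rho j x (F t) * kap (F t) * X t) =
        (fun t => rho j x (F t) * (kap (F t) * X t)).
      by apply/funext => t; rewrite mulrA.
    have := slope_identity (slope_mul s0 sk); rewrite !e1 => /(_ (iM _ ikgX1)) E.
    rewrite (_ : (fun t => _) = fun t => rho j x (F t) * (kap (F t) * X2 t) -
        rho j x (F t) * (kap (F t) * (g (F t) * X1 t))).
      by rewrite ExB; [rewrite E subrr|exact: iM|exact: iM].
    by apply/funext => t; rewrite /Y; ring.
  have mkY := Int_meas ikY.
  have [|||||_ _ _ lim] := @Ex_dct _ _ _ P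
     (fun j t => rho j x (F t) * (kap (F t) * Y t))
     (fun t => \1_(`]x, +oo[%classic) (F t) * (kap (F t) * Y t))
     (fun t => `|kap (F t) * Y t|).
  - by move=> j; exact: measurable_funM.
  - by apply: measurable_funM => //; exact: measurableT_comp.
  - by apply: nearW => t; apply: cvgM; [exact: rho_cvg|exact: cvg_cst].
  - exact: Int_abs.
  - by move=> j; apply: nearW => t; rewrite normrM -[leRHS]mul1r ler_wpM2r.
  apply: (cvg_unique (@norm_hausdorff _ _) lim).
  by apply: cvg_near_cst; apply: nearW => j; rewrite E0.
pose I := (\1_(`]al, be[%classic) : R -> R).
have mI : measurable_fun setT I by apply: measurable_indic; exact: measurable_itv.
pose w y := I y * (v y * tau y) * (kap y)^-1.
have mw : measurable_fun setT w.
  apply: measurable_funM; last exact: measurable_funV.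
  by apply: measurable_funM => //; exact: measurable_funM.
pose V t := I (F t) * (v (F t) * (Gam F G t - g (F t) * GF t)).
have wV : \forall t \ae P, V t = w (F t) * (kap (F t) * Y t).
  apply: filterS tau_q => t tq; rewrite /V /w /Y /I indicE.
  case: (boolP (F t \in _)) => [|_]; last by rewrite !mul0r.
  rewrite inE/= in_itv/= kapP => kt; rewrite !mul1r.
  have -> : v (F t) * tau (F t) * (kap (F t))^-1 *
    (kap (F t) * (q t * Gam F G t - g (F t) * (q t * GF t))) =
    (kap (F t) * (kap (F t))^-1) * v (F t) * (q t * tau (F t)) *
     (Gam F G t - g (F t) * GF t) by ring.
  by rewrite divff ?gt_eqF// tq mul1r mulr1.
have iV : Int V.
  have b1 t : `|I (F t) * v (F t)| <= Cv.
    rewrite normrM -[leRHS]mul1r ler_pM// /I indicE.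
    by case: (_ \in _); rewrite ?normr1 ?normr0.
  rewrite /V; under eq_fun do rewrite mulrA.
  apply: (@IntM_bdd _ _ _ _ _ _ Cv); [|exact: nearW|].
    by apply: measurable_funM; exact: measurableT_comp.
  by apply: IntB; [exact: cdc_Int|exact: Int_g_GF].
have mwY : measurable_fun setT (fun t => w (F t) * (kap (F t) * Y t)).
  by apply: measurable_funM; [exact: measurableT_comp|exact: Int_meas ikY].
rewrite (Ex_ae_eq (Int_meas iV) mwY wV).
by apply: Ex_ray_zero => //; exact: Int_ae_eq iV mwY wV.
Qed.

Let g_integrable x : Prop :=
  lebesgue_measure.-integrable `[Num.min a x, Num.max a x] (EFin \o g).

Let g_integrable_ae : \forall t \ae P, g_integrable (F t).
Proof. by apply: filterS fkE => t []. Qed.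

(** Only a maximum of the set where [g] is integrable from [a] on could fail, and a
    single value of [F] has probability 0. *)
Let g_integrable_beyond : \forall t \ae P, exists2 y, g_integrable y & F t < y.
Proof.
have [[c [Jc cmax]]|nomax] := pselect (exists c, g_integrable c /\ forall y, g_integrable y -> y <= c).
  apply: filter_app (law_atomless c); apply: filterS g_integrable_ae => t Jt Ft.
  by exists c => //; rewrite lt_neqAle Ft cmax.
apply: filterS g_integrable_ae => t Jt; apply: contrapT => nex.
apply: nomax; exists (F t); split => // y Jy; rewrite leNgt; apply/negP => Fy.
by apply: nex; exists y.
Qed.

Let g_integrable_before : \forall t \ae P, exists2 y, g_integrable y & y < F t.
Proof.
have [[c [Jc cmin]]|nomin] := pselect (exists c, g_integrable c /\ forall y, g_integrable y -> c <= y).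
  apply: filter_app (law_atomless c); apply: filterS g_integrable_ae => t Jt Ft.
  by exists c => //; rewrite lt_neqAle eq_sym Ft cmin.
apply: filterS g_integrable_ae => t Jt; apply: contrapT => nex.
apply: nomin; exists (F t); split => // y Jy; rewrite leNgt; apply/negP => Fy.
by apply: nex; exists y.
Qed.

(** The carre du champ of [F] and [f_k(F)] has the conditional expectation that the
    chain rule predicts, [(h / tau) tau = h]. The intervals where [g] is integrable
    exhaust the law of [F], and [local_null] applies to each of them. *)
Lemma cdc_iterate (v : R -> R) : bounded_borel v ->
  Ex (fun t => v (F t) * Gam F G t) = Ex (fun t => v (F t) * h (F t)).
Proof.
move=> bv; have [mv [C vC]] := bv.
have Ja : g_integrable a.
  apply: measurable_bounded_integrable.
  - exact: measurable_itv.
  - by rewrite minxx maxxx /= lebesgue_measure_itv/= lte_fin ltxx.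
  - exact: measurable_funTS.
  - exists `|g a|; split; first exact: num_real.
    move=> K gK y; rewrite minxx maxxx set_itv1 => /= ->; exact: ltW.
have [b [Jb ab b_far]] := cofinal_sequence Ja.
have JNa : g_integrable (- (- a)) by rewrite opprK.
have [c [Jc ac c_far]] := cofinal_sequence (J := fun y => g_integrable (- y)) JNa.
have ca n : - c n <= a by rewrite lerNl.
have ig n : lebesgue_measure.-integrable `[- c n, b n] (EFin \o g).
  apply: (integrable_itv_join mg (ca n) (ab n)).
    by have := Jc n; rewrite /g_integrable (min_idPr (ca n)) (max_idPl (ca n)).
  by have := Jb n; rewrite /g_integrable (min_idPl (ab n)) (max_idPr (ab n)).
pose V t := v (F t) * (Gam F G t - g (F t) * GF t).
have iv X : Int X -> Int (fun t => v (F t) * X t).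
  by apply: IntM_bdd; [exact: measurableT_comp|apply: nearW => t; exact: vC].
have iV : Int V by apply: iv; apply: IntB; [exact: cdc_Int|exact: Int_g_GF].
have V0 n : Ex (fun t => \1_(`]- c n, b n[%classic) (F t) * V t) = 0.
  exact: (local_null (le_trans (ca n) (ab n))).
have [|||||_ _ _ lim] := @Ex_dct _ _ _ P
   (fun n t => \1_(`]- c n, b n[%classic) (F t) * V t) V (fun t => `|V t|).
- move=> n; apply: measurable_funM; last exact: Int_meas iV.
  by have [mI _] := bounded_borel_indic (measurable_itv `]- c n, b n[); exact: measurableT_comp.
- exact: Int_meas iV.
- apply: filter_app g_integrable_beyond; apply: filterS g_integrable_before.
  move=> t [y Jy yF] [z Jz Fz]; apply: cvg_near_cst.
  have h1 := b_far _ _ Jz Fz.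
  have h2 : \forall n \near \oo, - F t < c n.
    by apply: (c_far _ (- y)); rewrite ?opprK// ltrN2.
  apply: filterS2 h1 h2 => n h1 h2.
  by rewrite indicE mem_set ?mul1r//= in_itv/= h1 andbT ltrNl.
- exact: Int_abs.
- move=> n; apply: nearW => t; rewrite normrM -[leRHS]mul1r ler_wpM2r// indicE.
  by case: (_ \in _); rewrite ?normr1 ?normr0.
have : Ex V = 0.
  apply: (cvg_unique (@norm_hausdorff _ _) lim).
  by apply: cvg_near_cst; apply: nearW => n; rewrite V0.
have iGG := cdc_Int DF DG; have igG := Int_g_GF.
have -> : Ex V = Ex (fun t => v (F t) * Gam F G t) - Ex (fun t => v (F t) * (g (F t) * GF t)).
  rewrite -ExB; [|exact: iv|exact: iv]; congr Ex.
  by apply/funext => t; rewrite /V mulrBr.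
move/eqP; rewrite subr_eq0 => /eqP ->.
have gtau : \forall t \ae P, g (F t) * tau (F t) = h (F t).
  by apply: filterS tau_gt0 => t t0; rewrite /g mulfVK// gt_eqF.
have igtau : Int (fun t => g (F t) * tau (F t)).
  apply: (Int_ae_eq ih); first by apply: measurable_funM => //; exact: Int_meas itau.
  by apply: filterS gtau => t ->.
have e : (fun t => v (F t) * g (F t) * (GF t - tau (F t))) =
    fun t => v (F t) * (g (F t) * GF t) - v (F t) * (g (F t) * tau (F t)).
  by apply/funext => t; ring.
have := condexp_Ex tauE mF iGF (measurable_funM mv mg).
rewrite /= e => /(_ (IntB (iv _ igG) (iv _ igtau))).
rewrite ExB; [|exact: iv|exact: iv] => /eqP; rewrite subr_eq0 => /eqP ->.
apply: Ex_ae_eq; [exact: Int_meas (iv _ igtau)|exact: Int_meas (iv _ ih)|].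
by apply: filterS gtau => t ->.
Qed.
End iterate.

(** * Derivatives of the distribution function *)

Let survival x : R -> R := \1_(`[x, +oo[%classic).

Let survival_bb x : bounded_borel (survival x).
Proof. by apply: bounded_borel_indic; exact: measurable_itv. Qed.

Let Int_bb b Z : bounded_borel b -> Int Z -> Int (fun t => b (F t) * Z t).
Proof.
move=> [mb [C bC]]; apply: IntM_bdd; first exact: measurableT_comp.
by apply: nearW => t; exact: bC.
Qed.

(** The difference quotient of a ramp differs from the indicator of [x <= F] only
    where [F] is within the increment of [x], a set that shrinks to the null set
    [F = x]. *)
Lemma survival_derivative (Q : R -> R) Z : Int Z ->
  (forall x y : R, x <= y ->
    Q y - Q x = - Ex (fun t => oriented_integral \1_(`[x, y[%classic) x (F t) * Z t)) ->
  forall x : R, is_derive x 1 Q (- Ex (fun t => survival x (F t) * Z t)).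
Proof.
move=> iZ QE x; have mZ := Int_meas iZ.
pose near_x (e : R) : R -> R := \1_(`[x - e, x + e]%classic).
have bn e : bounded_borel (near_x e) by apply: bounded_borel_indic; exact: measurable_itv.
have near1 e t : `|near_x e (F t)| <= 1.
  by rewrite /near_x indicE; case: (_ \in _); rewrite ?normr1 ?normr0.
have small : Ex (fun t => near_x n.+1%:R^-1 (F t) * `|Z t|) @[n --> \oo] --> (0 : R).
  apply: (@Ex_dct0 _ _ _ _ _ (fun t => `|Z t|)).
  - by move=> n; apply: Int_meas; apply: Int_bb => //; exact: Int_abs.
  - apply: filterS (law_atomless x) => t Fx.
    have d0 : 0 < `|F t - x| by rewrite normr_gt0 subr_eq0.
    have d2 : 0 < `|F t - x| / 2 by rewrite divr_gt0.
    have [N HN] := cvg0_ex (@cvg_harmonic R) d2.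
    apply: cvg_near_cst; exists N => // n /= /HN; rewrite /harmonic/= ger0_norm ?invr_ge0//.
    rewrite /near_x; move: (n.+1%:R^-1) => i hi; rewrite indicE memNset ?mul0r//= in_itv/=.
    move=> /andP[h1 h2].
    have : `|F t - x| <= i by rewrite ler_norml; apply/andP; split; lra.
    by move: d0 hi; move: `|_| => D; lra.
  - exact: Int_abs.
  - by move=> n; apply: nearW => t; rewrite normrM normr_id -[leRHS]mul1r ler_wpM2r.
pose lo (e : R) := Num.min x (x + e); pose hi (e : R) := Num.max x (x + e).
pose k (e y : R) : R :=
  (hi e - lo e)^-1 * oriented_integral \1_(`[lo e, hi e[%classic) (lo e) y.
have lohi (e : R) : lo e <= hi e by rewrite ge_min !le_max !lexx ?orbT.
have kbb (e : R) : bounded_borel (k e).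
  have [sb _ _ _] := slope_indic (lohi e).
  exact: (bounded_borelM (bounded_borel_cst _) sb).
have QkE (e : R) : e != 0 -> e^-1 * (Q (e + x) - Q x) = - Ex (fun t => k e (F t) * Z t).
  have [sb _ _ _] := slope_indic (lohi e).
  have iS := Int_bb sb iZ; have := QE _ _ (lohi e).
  have -> : Ex (fun t => k e (F t) * Z t) = (hi e - lo e)^-1 *
      Ex (fun t => oriented_integral \1_(`[lo e, hi e[%classic) (lo e) (F t) * Z t).
    by rewrite -ExZ//; congr Ex; apply/funext => t; rewrite /k mulrA.
  rewrite -mulrN => <-; rewrite /hi /lo (addrC e).
  case: (ltgtP 0 e) => // e0 _.
    have xe : x <= x + e by rewrite lerDl ltW.
    by rewrite (max_idPr xe) (min_idPl xe) addrAC subrr add0r.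
  have xe : x + e <= x by rewrite gerDl ltW.
  rewrite (max_idPl xe) (min_idPr xe) opprD addrA subrr add0r invrN.
  by rewrite -[Q x - _]opprB mulrNN.
have kE (e y : R) : e != 0 -> `|k e y - survival x y| <= near_x `|e| y.
  move=> e0; apply: (le_trans (ramp_error _ _ _)).
  - rewrite lt_neqAle lohi andbT /lo /hi.
    have xe : x != x + e by rewrite -subr_eq0 opprD addrA subrr sub0r oppr_eq0.
    by case: (leP x (x + e)) => // _; rewrite eq_sym.
  - by rewrite /lo /hi ge_min le_max lexx.
  rewrite /near_x !indicE ler_nat; case: (boolP (y \in `[lo e, _]%classic)) => // h.
  rewrite mem_set//=; move: h; rewrite inE/= !in_itv/= /lo /hi => /andP[h1 h2].
  have := ler_norm e; have := ler_norm (- e); rewrite normrN => e1 e2.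
  move: h1 h2; case: (leP x (x + e)) => xe; move: e1 e2; move: (`|e|) => E *; apply/andP; split; lra.
have quot (e : R) N : e != 0 -> `|e| <= N.+1%:R^-1 ->
    `|e^-1 * (Q (e + x) - Q x) - (- Ex (fun t => survival x (F t) * Z t))| <=
    Ex (fun t => near_x N.+1%:R^-1 (F t) * `|Z t|).
  move=> e0 eN; rewrite QkE// opprK addrC -ExB; [|exact: Int_bb|exact: Int_bb].
  apply: (le_trans (Ex_absle _)); first by apply: IntB; exact: Int_bb.
  apply: Ex_le.
  - by apply: Int_dist; exact: Int_bb.
  - by apply: Int_bb => //; exact: Int_abs.
  apply: nearW => t; rewrite -mulrBl normrM ler_wpM2r// distrC.
  apply: (le_trans (kE _ _ e0)); rewrite /near_x !indicE ler_nat.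
  case: (boolP (F t \in `[x - `|e|, _]%classic)) => // h.
  rewrite mem_set//=; move: h; rewrite inE/= !in_itv/= => /andP[h1 h2].
  move: eN h1 h2; move: (N.+1%:R^-1) (`|e|) => i E eN h1 h2.
  by apply/andP; split; lra.
have lim : e^-1 *: ((Q \o shift x) (e *: 1) - Q x) @[e --> 0^'] -->
    (- Ex (fun t => survival x (F t) * Z t)).
  apply/cvgrPdist_le => /= r r0; have [N HN] := cvg0_ex small r0.
  near=> e; rewrite distrC /GRing.scale/= mulr1.
  apply: (le_trans (quot e N _ _)).
  - by near: e; exact: nbhs_dnbhs_neq.
  - near: e; apply: dnbhs0_le; by rewrite invr_gt0.
  - exact: le_trans (ler_norm _) (HN N (leqnn _)).
split; [by apply/cvg_ex; eexists; exact: lim|exact: cvg_lim lim].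
Unshelve. all: by end_near. Qed.

Let survival_diff x y Z : x <= y -> Int Z ->
  - Ex (fun t => survival y (F t) * Z t) - - Ex (fun t => survival x (F t) * Z t) =
  Ex (fun t => \1_(`[x, y[%classic) (F t) * Z t).
Proof.
move=> xy iZ; rewrite opprK addrC -ExB; [|exact: Int_bb|exact: Int_bb].
congr Ex; apply/funext => t; rewrite -mulrBl; congr (_ * _).
have mem_itv (i : interval R) : (F t \in [set` i]%classic) = (F t \in i).
  by rewrite mem_setE.
rewrite /survival !indicE !mem_itv !in_itv/= !andbT.
case: (leP y (F t)) => yF; first by rewrite (le_trans xy yF) subrr.
by rewrite andbT subr0.
Qed.

Lemma condexp_indic Y g (B : set R) : is_condexp P F Y g -> Int Y -> measurable B ->
  Ex (fun t => \1_B (F t) * Y t) = Ex (fun t => \1_B (F t) * g (F t)).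
Proof.
move=> [mg ig Yg] iY mB; have := Yg _ mB.
by rewrite !integral_preimage// => -[].
Qed.

(** Over [x, y[, the integral of [Z = L f_(k-1)(F)] is that of [h(F)], hence that of
    [Gam F (f_k(F))] by [cdc_iterate], hence the energy of [f_k(F)] and a ramp of [F],
    which integration by parts moves onto [L f_k(F)]. *)
Lemma survival_step (h fk : R -> R) Z : Int Z -> is_condexp P F Z h ->
  DomL P M (fk \o F) -> is_primitive P F a (fun y => h y / tau y) fk -> forall x : R,
  is_derive x 1 (fun x => - Ex (fun t => survival x (F t) * Z t))
    (- Ex (fun t => survival x (F t) * gen M (fk \o F) t)).
Proof.
move=> iZ Zh DLk fkE; have [DG _] := DLk; have [mh ih _] := Zh.
have lZk : L2 (gen M (fk \o F)) by apply/LfunL2; exact: (gen_DomL_L2 HM).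
apply: survival_derivative => [|x y xy]; first exact: L2_Int.
rewrite survival_diff// (condexp_indic Zh)//.
have bi : bounded_borel (\1_(`[x, y[%classic) : R -> R).
  by apply: bounded_borel_indic; exact: measurable_itv.
rewrite -(cdc_iterate DG fkE mh ih bi).
have [_ _ Dr Sr] := slope_indic xy.
have := gen_DomL_ibp HM DLk Dr; rewrite -/(Ex _) => ->.
rewrite opprK energyC//; apply: Ex_ae_eq.
- by apply: Int_meas; apply: Int_bb => //; exact: cdc_Int.
- by apply: Int_meas; exact: cdc_Int.
- by apply: filterS (Sr _ DG) => t ->.
Qed.

Lemma distribution_derivative (x : R) :
  is_derive x 1 (fun x => - Ex (fun t => survival x (F t) * 1))
    (- Ex (fun t => survival x (F t) * Z0 t)).
Proof.
apply: survival_derivative => // {}x y xy; rewrite survival_diff//; last exact: Int_cst.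
rewrite Ex_primitive_density ?opprK//; last by apply: bounded_borel_indic; exact: measurable_itv.
by congr Ex; apply/funext => t; rewrite mulr1.
Qed.

(** The derivative of a nondecreasing function. *)
Lemma distribution_derivative_ge0 x : 0 <= - Ex (fun t => survival x (F t) * Z0 t).
Proof.
have [dx <-] := distribution_derivative x.
apply: limr_ge => //; near=> e; rewrite /GRing.scale/= mulr1.
have e0 : e != 0 by near: e; exact: nbhs_dnbhs_neq.
have i1 := Int_cst P 1; have ge0 (u v : R) : 0 <= Ex (fun t => \1_(`[u, v[%classic) (F t) * 1).
  by apply: Rintegral_ge0 => t _; rewrite mulr1 indicE.
case: (ltgtP 0 e) e0 => // e1 _.
  have xe : x <= e + x by rewrite lerDr ltW.
  by rewrite survival_diff// mulr_ge0// invr_ge0 ltW.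
have ex : e + x <= x by rewrite gerDr ltW.
rewrite -mulrNN -invrN opprB survival_diff// mulr_ge0//.
by rewrite invr_ge0 oppr_ge0 ltW.
Unshelve. all: by end_near. Qed.

Lemma distribution_cvg0 : - Ex (fun t => survival x (F t) * 1) @[x --> +oo] --> (0 : R).
Proof.
have ge0 x : 0 <= Ex (fun t => survival x (F t) * 1).
  by apply: Rintegral_ge0 => t _; rewrite mulr1 /survival indicE.
have s0 : Ex (fun t => survival n%:R (F t) * 1) @[n --> \oo] --> (0 : R).
  apply: (@Ex_dct0 _ _ _ _ _ (fun=> 1)) => //.
  - by move=> n; apply: Int_meas; apply: Int_bb => //; exact: Int_cst.
  - apply: nearW => t; apply: cvg_near_cst.
    exists (Num.truncn `|F t|).+1 => // n /= Fn.
    rewrite mulr1 /survival indicE memNset//= in_itv/= andbT => nF.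
    have := truncnS_gt `|F t|; rewrite ltNge; apply/negP/negPn.
    by rewrite (le_trans _ (le_trans nF (ler_norm _)))// ler_nat.
  - exact: Int_cst.
  - move=> n; apply: nearW => t; rewrite mulr1 /survival indicE.
    by case: (_ \in _); rewrite ?normr1 ?normr0.
apply/cvgr0Pnorm_le => e e0; have [N HN] := cvg0_ex s0 e0.
near=> x; rewrite normrN ger0_norm//.
apply: le_trans (le_trans (ler_norm _) (HN N (leqnn _))).
apply: Ex_le; [by apply: Int_bb => //; exact: Int_cst..|].
apply: nearW => t; rewrite !mulr1 /survival !indicE ler_nat.
case: (boolP (F t \in `[x, +oo[%classic)) => // xF.
rewrite mem_set//=; move: xF; rewrite inE/= !in_itv/= !andbT; apply: le_trans.
by near: x; exact: nbhs_pinfty_ge.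
Unshelve. all: by end_near. Qed.

(** Two measures that agree, with finite values, on the rays [x, +oo[ are equal. *)
Lemma density_of_rays (r : R -> R) : measurable_fun setT r -> (forall x, 0 <= r x) ->
  (forall x, P (F @^-1` `[x, +oo[) = (\int[lebesgue_measure]_(y in `[x, +oo[) (r y)%:E)%E) ->
  is_density P F r.
Proof.
move=> mr r0 rays; split => // B mB.
pose dens (A : set R) : \bar R := (\int[lebesgue_measure]_(y in A) (r y)%:E)%E.
have dens0 : dens set0 = 0%E by rewrite /dens integral_set0.
have dens_ge0 A : (0 <= dens A)%E by apply: integral_ge0 => y _; rewrite lee_fin.
have dens_add : semi_sigma_additive dens.
  move=> /= A mA tA mUA; rewrite /dens ge0_integral_bigcup//=; last 2 first.
  - by apply: measurable_funTS; exact/measurable_EFinP.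
  - by move=> y _; rewrite lee_fin.
  by apply: is_cvg_ereal_nneg_natsum_cond => n _ _; exact: dens_ge0.
pose nu : {measure set R -> \bar R} := HB.pack dens
  (isMeasure.Build _ _ _ dens dens0 dens_ge0 dens_add).
pose X : {mfun T >-> R} := mfun_Sub (mem_set mF).
have XE : X = F :> (T -> R) by [].
have -> : P (F @^-1` B) = distribution P X B by [].
rewrite -[RHS]/(nu B).
apply: (measure_unique [set A | exists x : R, A = `[x, +oo[%classic]
  (fun n => `[- n%:R, +oo[%classic)) => //.
- exact: (etrans (@RGenCInfty.measurableE R)).
- move=> _ _ [x ->] [y ->]; exists (Num.max x y); apply/seteqP; split => z /=.
    by rewrite !in_itv/= !andbT => -[xz yz]; rewrite ge_max xz.
  by rewrite !in_itv/= !andbT ge_max => /andP[].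
- by move=> n; exists (- n%:R).
- apply/seteqP; split => // y _; exists (Num.truncn `|y|).+1 => //=.
  rewrite in_itv/= andbT lerNl (le_trans (ler_norm _))// normrN.
  exact: ltW (truncnS_gt _).
- by move=> _ [x ->]; exact: rays.
- by move=> n; apply: (le_lt_trans (probability_le1 _ _)); [exact: measurable_itv|exact: ltry].
Qed.

(** The fundamental theorem of calculus on [x, +oo[ for the primitive [- P(y <= F)],
    which vanishes at +oo. *)
Lemma law_density : continuous (fun x => - Ex (fun t => survival x (F t) * Z0 t)) ->
  is_density P F (fun x => - Ex (fun t => survival x (F t) * Z0 t)).
Proof.
move=> cq; apply: density_of_rays.
- exact: continuous_measurable_fun.
- exact: distribution_derivative_ge0.
move=> x; pose Phi y := - Ex (fun t => survival y (F t) * 1).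
have dPhi (y : R) : derivable Phi y 1 by have [] := distribution_derivative y.
have cPhi : continuous Phi.
  by move=> y; apply: differentiable_continuous; exact/derivable1_diffP.
rewrite (@ge0_continuous_FTC2y _ _ Phi x 0).
- have mx : measurable (`[x, +oo[%classic : set R) by exact: measurable_itv.
  rewrite sub0e -EFinN /Phi opprK -(integral_preimage _ mx (Int_cst P 1))//.
  by rewrite integral_cst ?mul1e//; rewrite -[X in measurable X]setTI; exact: mF.
- by move=> y _; exact: distribution_derivative_ge0.
- exact: continuous_subspaceT.
- exact: distribution_cvg0.
- by move=> y _; exact: dPhi.
- by apply: cvg_at_right_filter; exact: cPhi.
- by move=> y _; rewrite derive1E; have [] := distribution_derivative y.
Qed.
End density.

End dirichlet_domain.

Theorem proposition3p2 (d : measure_display) (T : measurableType d)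
    (R : realType) (P : probability T R) (M : markov_data T R)
    (HM : full_markov_triple P M)
    (F : T -> R) (HF : DomE P M F)
    (p : R) (p_gt1 : 1 < p)
    (inv_moment : (\int[P]_t ((cdc M F F t)%:E^-1 `^ p) < +oo)%E)
    (tau : R -> R) (tauE : is_condexp P F (cdc M F F) tau)
    (f h : nat -> R -> R)
    (f_DomL : forall k, DomL P M (f k \o F))
    (a : R)
    (f0E : is_primitive P F a (fun y => 1 / tau y) (f 0%N))
    (fE : forall k, (1 <= k)%N ->
       is_primitive P F a (fun y => h k y / tau y) (f k))
    (hE : forall k, (1 <= k)%N ->
       is_condexp P F (gen M (f k.-1 \o F)) (h k))
    (h_moment : forall k, (1 <= k)%N ->
       (\int[P]_t (`|cdc M F F t * h k (F t)| `^ (p / (p - 1)))%:E < +oo)%E) :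
  exists pF : R -> R, is_density P F pF /\
    forall k : nat, n_derivable k pF /\
      forall x : R,
        ((derive1n k pF x)%:E =
           - 'E_P[(fun t => \1_[set s | x <= F s] t * gen M (f k \o F) t)%R])%E /\
        ((derive1n k pF x)%:E =
           - 'E_P[(fun t => \1_[set s | x <= F s] t * h k.+1 (F t))%R])%E.
Proof.
pose Z k := gen M (f k \o F).
pose q k x := - Ex P (fun t => \1_(`[x, +oo[%classic) (F t) * Z k t).
have lZ k : L2 P (Z k) by apply/LfunL2; exact: (gen_DomL_L2 HM).
have iZ k : Int P (Z k) by exact: L2_Int.
have hk k : is_condexp P F (Z k) (h k.+1) := hE k.+1 (ltn0Sn k).
have dq k (x : R) : is_derive x 1 (q k) (q k.+1 x).
  exact: (survival_step HM HF p_gt1 inv_moment tauE (f_DomL 0%N) f0E (iZ k) (hk k)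
    (f_DomL k.+1) (fE k.+1 (ltn0Sn k))).
have dnq k : derive1n k (q 0%N) = q k.
  elim: k => [|k IHk]; first by rewrite derive1n0.
  by rewrite derive1nS IHk; apply/funext => x; rewrite derive1E; have [] := dq k x.
exists (q 0%N); split.
  apply: (law_density HM HF p_gt1 inv_moment tauE (f_DomL 0%N) f0E) => x.
  by apply: differentiable_continuous; apply/derivable1_diffP; have [] := dq 0%N x.
move=> k; split=> [j _ x|x]; first by rewrite dnq; have [] := dq j x.
have mF := DomE_meas HF; have [_ ih _] := hk k.
have indE Y : Int P Y -> 'E_P[(fun t => \1_[set s | x <= F s] t * Y t)%R]%E =
    (Ex P (fun t => \1_(`[x, +oo[%classic) (F t) * Y t))%:E.
  move=> iY; have [mb [C bC]] := bounded_borel_indic (measurable_itv `[x, +oo[).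
  rewrite unlock -Ex_ereal.
    apply: eq_integral => t _; congr (_ * _)%:E; rewrite !indicE; congr (nat_of_bool _)%:R.
    by apply/idP/idP; rewrite !inE/= in_itv/= andbT.
  apply: IntM_bdd iY; first exact: (measurableT_comp mb mF).
  by apply: nearW => t; exact: bC.
have mI : measurable (`[x, +oo[%classic : set R) by exact: measurable_itv.
have e := condexp_indic HF (hk k) (iZ k) mI.
rewrite dnq (indE (Z k))// (indE (fun t => h k.+1 (F t)))//.
by rewrite -e EFinN.
Qed.
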